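(* Let $\mathfrak{F}$ be a Fraïssé class of finite relational structures and let $m$ be a positive integer. Suppose: (a) (Distality) $\mathfrak{F}$ has only finitely many minimal marked structures up to isomorphism. (b) (Bounded automorphism groups) For every $X \in \mathfrak{F}$, the order of $\mathrm{Aut}(X)$ divides some power of $m$. Then there is a ring isomorphism $\Theta(\mathfrak{F})[1/m] \cong \mathbf{Z}[1/m]^n$ for some $n$. Moreover, if $r$ is the number of minimal marked structures (up to isomorphism) and $p$ is the smallest prime not dividing $m$, then $n \le p^r$.
   Context: Structures: fix a relational signature; a structure is a finite set with relations of the given arities. An embedding is an injective map that preserves and reflects all relations; subsets carry the induced structure. Given embeddings $i\colon X\to Y$, $j\colon X\to X'$ in a class $\mathfrak{F}$, an amalgamation of $Y$ and $X'$ over $X$ is a structure $Y'\in\mathfrak{F}$ with embeddings $i'\colon X'\to Y'$, $j'\colon Y\to Y'$ such that $i'j=j'i$ and $Y'=\mathrm{im}(i')\cup\mathrm{im}(j')$; amalgamations are considered up to the evident notion of isomorphism. $\mathfrak{F}$ is a Fraïssé class if (1) it has finitely many isomorphism classes of $n$-element structures for each $n$; (2) it is hereditary (if $X\in\mathfrak{F}$ and $Y$ embeds in $X$ then $Y\in\mathfrak{F}$); (3) for any embeddings $i\colon X\to Y$ and $j\colon X\to X'$ with $X,Y,X'\in\mathfrak{F}$, at least one amalgamation of $Y$ and $X'$ over $X$ exists. Marked structures: for $X\in\mathfrak{F}$ and disjoint subsets $A,B\subset X$, say $A$ and $B$ are separated if $X$ (with the inclusion maps) is the unique amalgamation of $X\setminus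 A$ and $X\setminus B$ over $X\setminus(A\cup B)$. Two distinct points are separated if the corresponding singletons are. A marked structure is a pair $(X,x)$ with $X\in\mathfrak{F}$, $x\in X$. An element $y\ne x$ of $X$ is extraneous if it is separated from $x$. $(X,x)$ is minimal if it has no extraneous elements. The ring $\Theta(\mathfrak{F})$: the commutative ring generated by symbols $[i]$, one for each embedding $i\colon X\to Y$ of structures in $\mathfrak{F}$, subject to: (i) $[i]=1$ if $i$ is an isomorphism; (ii) $[j\circ i]=[j]\cdot[i]$ for composable embeddings $i\colon X\to Y$, $j\colon Y\to Z$; (iii) for embeddings $i\colon X\to Y$ and $j\colon X\to X'$, if $(Y'_\alpha,i'_\alpha,j'_\alpha)$, $1\le\alpha\le s$, are all the amalgamations up to isomorphism (with $i'_\alpha\colon X'\to Y'_\alpha$), then $[i]=\sum_{\alpha=1}^s[i'_\alpha]$. Thus ring homomorphisms $\Theta(\mathfrak{F})\to k$ are the same as $k$-valued measures on $\mathfrak{F}$. *)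

(* Defs.v *)
From HB Require Import structures.
From mathcomp Require Import all_boot all_algebra perm generic_quotient.
From mathcomp Require Import boolp zify.

Set Implicit Arguments.
Unset Strict Implicit.
Unset Printing Implicit Defensive.

Import GRing.Theory.

(* [a] lists each [E]-class of elements satisfying [P] exactly once. *)
Definition representatives (T : Type) (P : T -> Prop) (E : T -> T -> Prop)
    (n : nat) (a : 'I_n -> T) : Prop :=
  [/\ forall i, P (a i),
      forall i j, E (a i) (a j) -> i = j
    & forall x, P x -> exists i, E x (a i)].

Definition num_classes (T : Type) (P : T -> Prop) (E : T -> T -> Prop)
    (n : nat) : Prop :=
  exists a : 'I_n -> T, representatives P E a.

Record signature := Signature { symbol : Type; arity : symbol -> nat }.

(* Carriers live in [Set] so that the type of all structures is small enough
   to be (the index type of the generators of) a MathComp ring; nothing is lost,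
   since every finite type is in bijection with one in [Set]. *)
Record structure (L : signature) := Structure {
  carrier :> Set;
  carrier_finite : Finite carrier;
  interp : forall s : symbol L, (arity s).-tuple carrier -> bool
}.

HB.instance Definition _ (L : signature) (X : structure L) := carrier_finite X.

Section Structures.
Variable L : signature.
Implicit Types X Y Z : structure L.

Definition is_embedding X Y (f : X -> Y) : Prop :=
  injective f /\
  forall (s : symbol L) (t : (arity s).-tuple X),
    interp (map_tuple f t) = interp t.

Record embedding X Y := Embedding {
  emb_fun :> X -> Y;
  embP : is_embedding emb_fun
}.

Definition iso X Y : Prop := exists f : embedding X Y, bijective f.

Lemma comp_is_embedding X Y Z (j : embedding Y Z) (i : embedding X Y) :
  is_embedding (j \o i).
Proof.
case: (embP i) (embP j) => [injI relI] [injJ relJ]; split; first exact: inj_comp.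
move=> s t; rewrite -relI -relJ; congr interp.
by apply: val_inj; rewrite /= map_comp.
Qed.

Definition emb_comp X Y Z (j : embedding Y Z) (i : embedding X Y) :
  embedding X Z := Embedding (comp_is_embedding j i).

(* Automorphisms of a structure, among the permutations of its carrier. *)
Definition automorphisms X : {set {perm X}} :=
  [set s : {perm X} | `[< is_embedding (s : X -> X) >]].

Definition induced X (A : {set X}) : structure L :=
  @Structure L {x : X | x \in A} (Finite.class {x : X | x \in A})
    (fun s t => interp (map_tuple val t)).

Lemma induced_val_embedding X (A : {set X}) :
  is_embedding (val : induced A -> X).
Proof. by split; first exact: val_inj. Qed.

Definition induced_val X (A : {set X}) : embedding (induced A) X :=
  Embedding (@induced_val_embedding X A).

Definition incl_fun X (A B : {set X}) (sAB : A \subset B)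
    (x : induced A) : induced B :=
  exist _ (val x) (subsetP sAB _ (valP x)).

Lemma incl_is_embedding X (A B : {set X}) (sAB : A \subset B) :
  is_embedding (incl_fun sAB).
Proof.
split=> [x y /(congr1 val) /= /val_inj // | s t].
rewrite /interp /=; congr (@interp L X s _).
by apply: val_inj; rewrite /= -map_comp.
Qed.

Definition incl X (A B : {set X}) (sAB : A \subset B) :
  embedding (induced A) (induced B) := Embedding (incl_is_embedding sAB).

End Structures.

Section Classes.
Variables (L : signature) (F : structure L -> Prop).
Implicit Types X Y : structure L.

Record amalgam X Y X' (i : embedding X Y) (j : embedding X X') := Amalgam {
  am_obj : structure L;
  am_objF : F am_obj;
  am_i : embedding X' am_obj;
  am_j : embedding Y am_obj;
  am_comm : forall x, am_i (j x) = am_j (i x);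
  am_cover : forall z, (exists x', am_i x' = z) \/ (exists y, am_j y = z)
}.

Definition amalgam_iso X Y X' (i : embedding X Y) (j : embedding X X')
    (a b : amalgam i j) : Prop :=
  exists f : embedding (am_obj a) (am_obj b),
    [/\ bijective f,
        forall x', f (am_i a x') = am_i b x'
      & forall y, f (am_j a y) = am_j b y].

Record fraisse_class : Prop := FraisseClass {
  fraisse_finite : forall n : nat,
    exists c, num_classes (fun X => F X /\ #|{: X}| = n) (@iso L) c;
  fraisse_hereditary : forall X Y, F X -> embedding Y X -> F Y;
  fraisse_amalgamation :
    forall X Y X' (i : embedding X Y) (j : embedding X X'),
      F X -> F Y -> F X' -> inhabited (amalgam i j)
}.

Lemma subset_compl_Ul X (A B : {set X}) : ~: (A :|: B) \subset ~: A.
Proof. by rewrite setCS subsetUl. Qed.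

Lemma subset_compl_Ur X (A B : {set X}) : ~: (A :|: B) \subset ~: B.
Proof. by rewrite setCS subsetUr. Qed.

Section Separated.
Variables (X : structure L) (A B : {set X}).

Definition amalgam_off :=
  amalgam (incl (subset_compl_Ul A B)) (incl (subset_compl_Ur A B)).

Lemma ambient_cover : [disjoint A & B] -> forall z : X,
  (exists x : induced (~: B), val x = z) \/
  (exists y : induced (~: A), val y = z).
Proof.
move=> dAB z; case: (boolP (z \in A)) => zA.
  have zB : z \in ~: B by rewrite inE (disjointFr dAB zA).
  by left; exists (exist _ z zB).
have zA' : z \in ~: A by rewrite inE.
by right; exists (exist _ z zA').
Qed.

Definition ambient_amalgam (FX : F X) (dAB : [disjoint A & B]) : amalgam_off :=
  @Amalgam _ _ _ (incl (subset_compl_Ul A B)) (incl (subset_compl_Ur A B))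
    X FX (induced_val (~: B)) (induced_val (~: A))
    (fun=> erefl) (ambient_cover dAB).

Definition separated : Prop :=
  exists (FX : F X) (dAB : [disjoint A & B]),
    forall a : amalgam_off, amalgam_iso a (ambient_amalgam FX dAB).

End Separated.

Record marked := Marked {
  mk_obj : structure L;
  mk_objF : F mk_obj;
  mk_pt : mk_obj
}.

Definition marked_iso (M N : marked) : Prop :=
  exists f : embedding (mk_obj M) (mk_obj N),
    bijective f /\ f (mk_pt M) = mk_pt N.

Definition extraneous (M : marked) (y : mk_obj M) : Prop :=
  y != mk_pt M /\ separated [set y] [set mk_pt M].

Definition minimal (M : marked) : Prop :=
  forall y : mk_obj M, ~ extraneous y.

End Classes.

Inductive rterm (G : Type) : Type :=
  | rgen of G
  | rzero
  | rone
  | ropp of rterm G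
  | radd of rterm G & rterm G
  | rmul of rterm G & rterm G.
Arguments rzero {G}.
Arguments rone {G}.

HB.instance Definition _ (G : Type) := gen_eqMixin (rterm G).
HB.instance Definition _ (G : Type) := gen_choiceMixin (rterm G).

(* The least congruence that contains [S] and satisfies the axioms of
   commutative rings. *)
Inductive rcong (G : Type) (S : rterm G -> rterm G -> Prop) :
    rterm G -> rterm G -> Prop :=
  | rc_rel a b : S a b -> rcong S a b
  | rc_refl a : rcong S a a
  | rc_sym a b : rcong S a b -> rcong S b a
  | rc_trans a b c : rcong S a b -> rcong S b c -> rcong S a c
  | rc_opp a b : rcong S a b -> rcong S (ropp a) (ropp b)
  | rc_add a b c d :
      rcong S a b -> rcong S c d -> rcong S (radd a c) (radd b d)
  | rc_mul a b c d :
      rcong S a b -> rcong S c d -> rcong S (rmul a c) (rmul b d)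
  | rc_addA a b c : rcong S (radd a (radd b c)) (radd (radd a b) c)
  | rc_addC a b : rcong S (radd a b) (radd b a)
  | rc_add0 a : rcong S (radd rzero a) a
  | rc_addN a : rcong S (radd (ropp a) a) rzero
  | rc_mulA a b c : rcong S (rmul a (rmul b c)) (rmul (rmul a b) c)
  | rc_mulC a b : rcong S (rmul a b) (rmul b a)
  | rc_mul1 a : rcong S (rmul rone a) a
  | rc_mulDl a b c :
      rcong S (rmul (radd a b) c) (radd (rmul a c) (rmul b c)).

Section PresentedRing.
Variables (G : Type) (S : rterm G -> rterm G -> Prop).

Definition rcongb (a b : rterm G) : bool := `[< rcong S a b >].

Lemma rcongb_equiv : equiv_class_of rcongb.
Proof.
split=> [a | a b | b a c].
- by apply/asboolP; apply: rc_refl.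
- by apply/asboolP/asboolP; apply: rc_sym.
- by move=> /asboolP ab /asboolP bc; apply/asboolP; apply: rc_trans ab bc.
Qed.

Canonical rcongb_equiv_rel := EquivRelPack rcongb_equiv.

Definition presented : Type := {eq_quot rcongb}%qT.

HB.instance Definition _ := Choice.on presented.
HB.instance Definition _ := EqQuotient.on presented.

Definition pclass (a : rterm G) : presented := \pi_presented%qT a.

Lemma pclassP a b : pclass a = pclass b <-> rcong S a b.
Proof.
split=> [/eqP | ab]; first by rewrite /pclass eqmodE => /asboolP.
by apply/eqP; rewrite /pclass eqmodE; apply/asboolP.
Qed.

Lemma rcong_repr a : rcong S (repr (pclass a)) a.
Proof. by apply/pclassP; rewrite /pclass reprK. Qed.

Lemma pclass_ind (P : presented -> Prop) :
  (forall a, P (pclass a)) -> forall x, P x.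
Proof. by move=> h x; rewrite -[x]reprK; apply: h. Qed.

Definition popp (x : presented) := pclass (ropp (repr x)).
Definition padd (x y : presented) := pclass (radd (repr x) (repr y)).
Definition pmul (x y : presented) := pclass (rmul (repr x) (repr y)).

Lemma popp_class a : popp (pclass a) = pclass (ropp a).
Proof. by apply/pclassP/rc_opp/rcong_repr. Qed.

Lemma padd_class a b : padd (pclass a) (pclass b) = pclass (radd a b).
Proof. by apply/pclassP/rc_add; apply: rcong_repr. Qed.

Lemma pmul_class a b : pmul (pclass a) (pclass b) = pclass (rmul a b).
Proof. by apply/pclassP/rc_mul; apply: rcong_repr. Qed.

Lemma paddA : associative padd.
Proof.
elim/pclass_ind=> a; elim/pclass_ind=> b; elim/pclass_ind=> c.
by rewrite !padd_class; apply/pclassP/rc_addA.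
Qed.

Lemma paddC : commutative padd.
Proof.
elim/pclass_ind=> a; elim/pclass_ind=> b.
by rewrite !padd_class; apply/pclassP/rc_addC.
Qed.

Lemma padd0 : left_id (pclass rzero) padd.
Proof. by elim/pclass_ind=> a; rewrite padd_class; apply/pclassP/rc_add0. Qed.

Lemma paddN : left_inverse (pclass rzero) popp padd.
Proof.
by elim/pclass_ind=> a; rewrite popp_class padd_class; apply/pclassP/rc_addN.
Qed.

Lemma pmulA : associative pmul.
Proof.
elim/pclass_ind=> a; elim/pclass_ind=> b; elim/pclass_ind=> c.
by rewrite !pmul_class; apply/pclassP/rc_mulA.
Qed.

Lemma pmulC : commutative pmul.
Proof.
elim/pclass_ind=> a; elim/pclass_ind=> b.
by rewrite !pmul_class; apply/pclassP/rc_mulC.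
Qed.

Lemma pmul1 : left_id (pclass rone) pmul.
Proof. by elim/pclass_ind=> a; rewrite pmul_class; apply/pclassP/rc_mul1. Qed.

Lemma pmulDl : left_distributive pmul padd.
Proof.
elim/pclass_ind=> a; elim/pclass_ind=> b; elim/pclass_ind=> c.
by rewrite !(padd_class, pmul_class); apply/pclassP/rc_mulDl.
Qed.

HB.instance Definition _ :=
  GRing.isZmodule.Build presented paddA paddC padd0 paddN.
HB.instance Definition _ :=
  GRing.Zmodule_isComPzRing.Build presented pmulA pmulC pmul1 pmulDl.

End PresentedRing.

Section Theta.
Variables (L : signature) (F : structure L -> Prop).
Implicit Types X Y Z : structure L.

Record generator := Generator {
  gen_src : structure L;
  gen_srcF : F gen_src;
  gen_dst : structure L;
  gen_dstF : F gen_dst;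
  gen_emb : embedding gen_src gen_dst
}.

Definition sym X Y (FX : F X) (FY : F Y) (i : embedding X Y) :
  rterm generator := rgen (Generator FX FY i).

Inductive theta_rel : rterm generator -> rterm generator -> Prop :=
  | theta_iso X Y (FX : F X) (FY : F Y) (i : embedding X Y) :
      bijective i -> theta_rel (sym FX FY i) rone
  | theta_comp X Y Z (FX : F X) (FY : F Y) (FZ : F Z)
        (i : embedding X Y) (j : embedding Y Z) :
      theta_rel (sym FX FZ (emb_comp j i)) (rmul (sym FY FZ j) (sym FX FY i))
  | theta_amalgam X Y X' (FX : F X) (FY : F Y) (FX' : F X')
        (i : embedding X Y) (j : embedding X X')
        (s : nat) (a : 'I_s -> amalgam F i j) :
      representatives (fun=> True) (@amalgam_iso L F X Y X' i j) a ->
      theta_rel (sym FX FY i)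
        (\big[@radd generator/rzero]_(k < s)
            sym FX' (am_objF (a k)) (am_i (a k))).

Definition Theta : comPzRingType := presented theta_rel.

End Theta.

Section Localization.
Local Open Scope ring_scope.
Variables (R : comPzRingType) (c : R).

(* [(x, k)] stands for [x / c ^+ k]. *)
Definition loc_eq (u v : R * nat) : bool :=
  `[< exists t, c ^+ (t + v.2) * u.1 = c ^+ (t + u.2) * v.1 >].

Lemma loc_eq_equiv : equiv_class_of loc_eq.
Proof.
split=> [u | u v | v u w].
- by apply/asboolP; exists 0%N.
- by apply/asboolP/asboolP=> -[t e]; exists t.
move=> /asboolP[t e] /asboolP[t' e']; apply/asboolP.
exists (t + t' + v.2)%N.
have -> : (t + t' + v.2 + w.2 = (t' + w.2) + (t + v.2))%N by lia.
have -> : (t + t' + v.2 + u.2 = (t + u.2) + (t' + v.2))%N by lia.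
by rewrite !(exprD c (_ + _)%N) -!mulrA e -e' mulrCA.
Qed.

Canonical loc_eq_equiv_rel := EquivRelPack loc_eq_equiv.

Definition loc : Type := {eq_quot loc_eq}%qT.

HB.instance Definition _ := Choice.on loc.
HB.instance Definition _ := EqQuotient.on loc.

Definition lfrac (x : R) (k : nat) : loc := \pi_loc%qT (x, k).

Lemma lfracP x k y l :
  lfrac x k = lfrac y l <-> exists t, c ^+ (t + l) * x = c ^+ (t + k) * y.
Proof.
split=> [/eqP | xy]; first by rewrite /lfrac eqmodE => /asboolP.
by apply/eqP; rewrite /lfrac eqmodE; apply/asboolP.
Qed.

Lemma lfrac_repr u : lfrac (repr u).1 (repr u).2 = u.
Proof. by rewrite /lfrac -surjective_pairing reprK. Qed.

Lemma lfrac_ind (P : loc -> Prop) :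
  (forall x k, P (lfrac x k)) -> forall u, P u.
Proof. by move=> h u; rewrite -(lfrac_repr u); apply: h. Qed.

Definition loc_opp (u : loc) := let: (x, k) := repr u in lfrac (- x) k.
Definition loc_add (u v : loc) :=
  let: (x, k) := repr u in let: (y, l) := repr v in
  lfrac (c ^+ l * x + c ^+ k * y) (k + l).
Definition loc_mul (u v : loc) :=
  let: (x, k) := repr u in let: (y, l) := repr v in lfrac (x * y) (k + l).

Lemma loc_oppE x k : loc_opp (lfrac x k) = lfrac (- x) k.
Proof.
rewrite /loc_opp; move: (lfrac_repr (lfrac x k)); case: (repr _) => x' k' /=.
by move=> /lfracP[t e]; apply/lfracP; exists t; rewrite !mulrN e.
Qed.

Lemma loc_addE x k y l :
  loc_add (lfrac x k) (lfrac y l) = lfrac (c ^+ l * x + c ^+ k * y) (k + l).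
Proof.
rewrite /loc_add; move: (lfrac_repr (lfrac x k)); case: (repr _) => x' k' /=.
move: (lfrac_repr (lfrac y l)); case: (repr _) => y' l' /=.
move=> /lfracP[t e] /lfracP[t' e']; apply/lfracP; exists (t + t')%N.
rewrite !mulrDr !mulrA -!exprD; congr (_ + _).
  have -> : (t + t' + (k + l) + l' = (t + l + l') + (t' + k))%N by lia.
  by rewrite exprD -mulrA e' mulrA -exprD; congr (c ^+ _ * _); lia.
have -> : (t + t' + (k + l) + k' = (t' + k + k') + (t + l))%N by lia.
by rewrite exprD -mulrA e mulrA -exprD; congr (c ^+ _ * _); lia.
Qed.

Lemma loc_mulE x k y l :
  loc_mul (lfrac x k) (lfrac y l) = lfrac (x * y) (k + l).
Proof.
rewrite /loc_mul; move: (lfrac_repr (lfrac x k)); case: (repr _) => x' k' /=.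
move: (lfrac_repr (lfrac y l)); case: (repr _) => y' l' /=.
move=> /lfracP[t e] /lfracP[t' e']; apply/lfracP; exists (t + t')%N.
have -> : (t + t' + (k + l) = (t' + k) + (t + l))%N by lia.
have -> : (t + t' + (k' + l') = (t' + k') + (t + l'))%N by lia.
by rewrite (exprD c (t' + k)%N) (exprD c (t' + k')%N) mulrACA e' e mulrACA.
Qed.

Lemma loc_addA : associative loc_add.
Proof.
elim/lfrac_ind=> x k; elim/lfrac_ind=> y l; elim/lfrac_ind=> z n.
rewrite !loc_addE addnA !mulrDr !mulrA -!exprD addrA.
by rewrite [(n + l)%N]addnC [(n + k)%N]addnC.
Qed.

Lemma loc_addC : commutative loc_add.
Proof.
elim/lfrac_ind=> x k; elim/lfrac_ind=> y l.
by rewrite !loc_addE addrC [(k + l)%N]addnC.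
Qed.

Lemma loc_add0 : left_id (lfrac 0 0) loc_add.
Proof.
by elim/lfrac_ind=> x k; rewrite loc_addE mulr0 add0r expr0 mul1r add0n.
Qed.

Lemma loc_addN : left_inverse (lfrac 0 0) loc_opp loc_add.
Proof.
elim/lfrac_ind=> x k; rewrite loc_oppE loc_addE mulrN addNr.
by apply/lfracP; exists 0%N; rewrite !mulr0.
Qed.

Lemma loc_mulA : associative loc_mul.
Proof.
elim/lfrac_ind=> x k; elim/lfrac_ind=> y l; elim/lfrac_ind=> z n.
by rewrite !loc_mulE mulrA addnA.
Qed.

Lemma loc_mulC : commutative loc_mul.
Proof.
elim/lfrac_ind=> x k; elim/lfrac_ind=> y l.
by rewrite !loc_mulE mulrC addnC.
Qed.

Lemma loc_mul1 : left_id (lfrac 1 0) loc_mul.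
Proof. by elim/lfrac_ind=> x k; rewrite loc_mulE mul1r add0n. Qed.

Lemma loc_mulDl : left_distributive loc_mul loc_add.
Proof.
elim/lfrac_ind=> x k; elim/lfrac_ind=> y l; elim/lfrac_ind=> z n.
rewrite !(loc_mulE, loc_addE); apply/lfracP; exists 0%N.
rewrite !mulrDl !mulrDr !mulrA -!exprD; congr (_ + _); congr (c ^+ _ * _ * _); lia.
Qed.

HB.instance Definition _ :=
  GRing.isZmodule.Build loc loc_addA loc_addC loc_add0 loc_addN.
HB.instance Definition _ :=
  GRing.Zmodule_isComPzRing.Build loc loc_mulA loc_mulC loc_mul1 loc_mulDl.

End Localization.

(* Main.v *)
(* Everything rests on the relation [i]^p = [i] + p D(i) for primes p not dividing m, where
   D(i) is a sum of classes. Indeed [i]^p is a sum over the ways to glue p copies of Y along X.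
   The cyclic group of order p permutes these ways, and a nonconstant one that it fixes would
   yield an automorphism of order p of a structure in F, hence m would be divisible by p.
   First, D satisfies the rules of a p-derivation, so that it lifts the identity of Theta to
   a Frobenius lift on a free ring; this forces Theta to have no p-torsion. Second, relation
   (iii) applied to an extraneous point removes it, so Theta is generated by the r minimal
   marked structures, and D(i) is a combination of products of at most p generators.
   Put B = Theta[1/m]. It is torsion-free, x^p - x is in pB for all p not dividing m, and it
   is generated by g_1, ..., g_r with g_j^p - g_j in p times the span of monomials of degree
   at most p. For one such p, Nakayama's lemma over Z_(p) shows that B has finite rank over Z.
   The Frobenius congruences make x(x-1)...(x-N+1)/N! an element of B, as if x were an
   integer. Comparing denominators with the growth of the integer coordinates of a product of
   2N consecutive factors Mg_j + N - b shows that this product vanishes, so each g_j is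
   diagonalizable over Q with rational eigenvalues. The joint eigenvectors give characters of
   B. Their values lie in Z[1/m] because a prime p in the common denominator of the values of
   the g_j contradicts the relation for g_j^p, and they jointly surject because y^p - y is
   divisible by p. Modulo p the characters remain distinct and are determined by the values of
   the generators in F_p, whence the bound p^r. *)
From HB Require Import structures.
From mathcomp Require Import all_boot all_algebra all_fingroup cyclic generic_quotient.
From mathcomp Require Import finmap boolp zify.
From mathcomp.multinomials Require Import monalg.
From Stdlib Require Ring_polynom InitialRing.
Require Import Defs.

Set Implicit Arguments.
Unset Strict Implicit.
Unset Printing Implicit Defensive.
Import GRing.Theory Num.Theory.

(** * An estimate on factorials *)

(** Two obstacles shape the proof. Division by [p] is meaningless in [Theta] until torsion is
    excluded, so [pderiv] counts free orbits and its rules are proved by bijections between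
    patterns. They say that the ideal of relations in the free ring is stable under
    [(phi x - x ^+ p) / p], which is well defined there. Patterns, unlike amalgams up to
    isomorphism, form finite types on which the cyclic group acts by relabelling. Second, [B] has
    finite rank but need not be finitely generated as a group: a lattice stable under the generators
    is obtained only after scaling them by an integer [c], and divisibility in [B] says nothing
    about lattice coordinates at the primes of [c] and [m]. Taking [M] to be a power of [2 * m * c]
    repairs this, for [M * c * g_j + N - b] maps the lattice into its multiple by the gcd of [M] and
    [N - b]. The window is centred because its product then grows like [(N!) ^ 2], while the
    divisors multiply to almost [(2 * N)!], about [4 ^ N] times more; a window on one side would
    gain nothing. *)

Lemma leq_expl a b n : a <= b -> a ^ n <= b ^ n.
Proof. by move=> ab; elim: n => // n IH; rewrite !expnS leq_mul. Qed.

Lemma prod_partn (pi : nat_pred) (s : seq nat) : all (leq 1) s ->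
  \prod_(a <- s) a = (\prod_(a <- s) a`_pi) * \prod_(a <- s) a`_pi^'.
Proof.
move=> /allP s1; rewrite -big_split /=; apply: eq_big_seq => a /s1 a0.
by rewrite partnC.
Qed.

Section Window.
Variables (m k N u s w : nat).
Hypothesis m1 : 1 < m.
Let M := m ^ k.
Hypothesis MN : M %| N.
Hypothesis mu : m ^ s * u = (2 * N)`! * w.
Hypothesis Gu : \prod_(0 <= b < 2 * N) gcdn M ((N - b) + (b - N)) %| u.
Let pi : nat_pred := \pi(m).
Let n := 2 * N.

Let M0 : 0 < M. Proof. by rewrite expn_gt0 (ltnW m1). Qed.

Lemma gcd_window :
  \prod_(0 <= b < n) gcdn M ((N - b) + (b - N)) = \prod_(1 <= a < n.+1) gcdn M a.
Proof.
(* As [M] divides [N], the distance from [b] to [N] has the same gcd with [M] as [b] itself. *)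
have -> : \prod_(0 <= b < n) gcdn M ((N - b) + (b - N)) = \prod_(0 <= b < n) gcdn M b.
  apply: eq_bigr => b _; have /dvdnP[c NE] := MN.
  have [bN|Nb] := leqP b N.
    have -> : (N - b) + (b - N) = N - b by lia.
    apply/eqP; rewrite eqn_dvd !dvdn_gcd !dvdn_gcdl /=.
    rewrite -(@dvdn_addr (N - b) _ _ (dvdn_gcdr M (N - b))) subnK //.
    rewrite (dvdn_trans (dvdn_gcdl _ _) MN) /=.
    by rewrite dvdn_sub ?dvdn_gcdr // (dvdn_trans (dvdn_gcdl _ _) MN).
  have -> : (N - b) + (b - N) = b - N by lia.
  apply/eqP; rewrite eqn_dvd !dvdn_gcd !dvdn_gcdl /=.
  rewrite dvdn_sub ?dvdn_gcdr ?(dvdn_trans (dvdn_gcdl _ _) MN) // andbT.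
  rewrite -{2}(subnK (ltnW Nb)) dvdn_add ?dvdn_gcdr //.
  exact: (dvdn_trans (dvdn_gcdl _ _) MN).
(* The ranges [0 <= b < n] and [1 <= a < n.+1] differ by exchanging [0] for [n], and both of these
   have gcd [M] with [M]. *)
have [n0|n0] := posnP n; first by rewrite n0 !big_geq.
rewrite big_nat_recr //= [LHS]big_ltn // mulnC gcdn0; congr (_ * _).
by apply/esym/gcdn_idPl; rewrite dvdn_mull.
Qed.

Lemma gcd_dvd_part a : 0 < a -> gcdn M a %| a`_pi.
Proof.
move=> a0; have pg : pi.-nat (gcdn M a).
  by apply: pnat_dvd (dvdn_gcdl _ _) _; rewrite pnatX pnat_pi // (ltnW m1).
by rewrite -(part_pnat_id pg) partn_dvd // dvdn_gcdr.
Qed.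

(** The only loss between the known divisors of [u] and [n!]: the part of each [a] at the primes of
    [m] that [gcdn M a] fails to capture. *)
Definition defect := \prod_(1 <= a < n.+1) (a`_pi %/ gcdn M a).

Lemma fact_split :
  n`! = (\prod_(1 <= a < n.+1) a`_pi^') * (\prod_(1 <= a < n.+1) gcdn M a) * defect.
Proof.
rewrite fact_prod (prod_partn pi); last by apply/allP => a; rewrite mem_index_iota => /andP[].
rewrite mulnC -mulnA; congr (_ * _); rewrite /defect -big_split /=.
apply: eq_big_nat => a /andP[a0 _].
by rewrite mulnC divnK // gcd_dvd_part.
Qed.

(** Away from [m], divisibility comes from [mu], where [m ^ s] can be cancelled; at the primes of
    [m] it comes from [Gu]. *)
Lemma fact_dvd_defect : n`! %| u * defect.
Proof.
rewrite fact_split dvdn_mul // Gauss_dvd.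
  apply/andP; split; last by rewrite -gcd_window.
  have cP : coprime (\prod_(1 <= a < n.+1) a`_pi^') (m ^ s).
    rewrite coprime_sym coprimeXl // coprime_sym.
    elim/big_ind: _ => [|x y hx hy|a _]; rewrite ?coprime1n ?coprimeMl ?hx //.
    by rewrite coprime_sym -[m](@part_pnat_id pi) ?coprime_partC // pnat_pi // ltnW.
  rewrite -(Gauss_dvdr _ cP) mu dvdn_mulr // -/n fact_split -mulnA.
  exact: dvdn_mulr.
rewrite big_seq; elim/big_ind: _ => [|x y hx hy|a]; rewrite ?coprime1n ?coprimeMl ?hx //.
rewrite mem_index_iota => /andP[a0 _].
rewrite [X in coprime _ X]big_seq; elim/big_ind: _ => [|x y hx hy|b]; rewrite ?coprimen1 ?coprimeMr ?hx //.
rewrite mem_index_iota => /andP[b0 _]; rewrite coprime_sym.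
exact: coprime_dvdl (gcd_dvd_part b0) (coprime_partC _ _ _).
Qed.

Lemma bad_dvd a : 0 < a -> ~~ (a`_pi %| M) -> has (fun l => l ^ k.+1 %| a) (primes m).
Proof.
move=> a0; apply: contraR => /hasPn h; apply/dvdn_partP; first exact: part_gt0.
move=> l; rewrite mem_primes => /and3P[l_pr _ la].
have lm : l \in primes m by apply: (pnatPpi (part_pnat pi a)); rewrite mem_primes l_pr part_gt0.
have lm' : l %| m by move: lm; rewrite mem_primes => /and3P[].
rewrite p_part; apply: (@dvdn_trans (l ^ k)); last by rewrite dvdn_exp2r.
rewrite dvdn_Pexp2l ?prime_gt1 // -ltnS ltnNge; apply: contra (h l lm) => lk.
apply: dvdn_trans (dvdn_exp2l l lk) _; apply: dvdn_trans (dvdn_part pi a).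
exact: pfactor_dvdnn.
Qed.

(** A factor exceeds 1 only if [l ^ k.+1] divides [a] for some prime [l] of [m]. Each of the at most
    [m] primes accounts for at most [n %/ 2 ^ k.+1] values of [a], and no factor exceeds [n]. *)
Lemma defect_le : 0 < n -> defect <= n ^ (m * (n %/ 2 ^ k.+1)).
Proof.
move=> n0.
pose bad a := ~~ (a`_pi %| M).
apply: (@leq_trans (\prod_(1 <= a < n.+1) n ^ bad a)).
  rewrite /defect big_nat [X in _ <= X]big_nat; apply: leq_prod => a /andP[a0 an].
  rewrite /bad; case: (boolP (a`_pi %| M)) => [aM|_] /=.
    rewrite expn0; suff -> : gcdn M a = a`_pi by rewrite divnn part_gt0.
    by apply/eqP; rewrite eqn_dvd gcd_dvd_part // dvdn_gcd aM dvdn_part.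
  rewrite expn1; apply: leq_trans (leq_div _ _) _.
  by apply: leq_trans (dvdn_leq a0 (dvdn_part pi a)) _.
rewrite -(big_morph _ (expnD n) (expn0 n)) leq_pexp2l //.
apply: (@leq_trans (\sum_(1 <= a < n.+1) \sum_(l <- primes m) (l ^ k.+1 %| a))).
  rewrite big_nat [X in _ <= X]big_nat; apply: leq_sum => a /andP[a0 an].
  rewrite /bad; case: (boolP (a`_pi %| M)) => // nb.
  have /hasP[q qm qa] := bad_dvd a0 nb.
  by rewrite (big_rem q) //= qa.
rewrite exchange_big /=; apply: (@leq_trans (\sum_(l <- primes m) n %/ 2 ^ k.+1)).
  rewrite big_seq [X in _ <= X]big_seq; apply: leq_sum => q qm.
  rewrite -divn_count_dvd leq_div2l ?expn_gt0 // leq_expl //.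
  by move: qm; rewrite mem_primes => /andP[/prime_gt1].
rewrite big_const_seq count_predT iter_addn_0 mulnC leq_mul2r; apply/orP; right.
rewrite -[X in _ <= X](size_iota 1 m); apply: uniq_leq_size (primes_uniq m) _ => q.
rewrite mem_primes mem_iota => /and3P[q_pr _ qm].
by rewrite prime_gt0 //= add1n ltnS dvdn_leq // ltnW.
Qed.

End Window.

Lemma double_fact N : 2 ^ N * (N`! * N`!) <= (2 * N)`!.
Proof.
elim: N => // N IH; have -> : 2 * N.+1 = (2 * N).+2 by lia.
rewrite !factS expnS; set a := 2 ^ N in IH *; set b := N`! in IH *; set c := (2 * N)`! in IH *.
have : (2 * N.+1 * N.+1) * (a * (b * b)) <= ((2 * N).+2 * (2 * N).+1) * c.
  by rewrite leq_mul //; nia.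
by nia.
Qed.

Lemma window_prod_le R N :
  \prod_(0 <= b < 2 * N) (R + ((N - b) + (b - N))) <= ('C(R + N, N) * N`!) ^ 2.
Proof.
rewrite bin_ffact mul2n -addnn (big_cat_nat (n := N)) ?leq_addr //= -mulnn ffact_prod.
apply: leq_mul.
  rewrite big_mkord; apply: leq_prod => b _; have := ltn_ord b; lia.
rewrite -{1}[N]add0n big_addn addnK big_nat_rev big_mkord add0n; apply: leq_prod => b _.
have := ltn_ord b; lia.
Qed.

(** ['C(R + N, N) * 8 ^ N] is one term of the expansion of [(1 + 8) ^ (R + N)]. The weight 8 serves
    because, after squaring, [81 / 64] is less than the base 2 of [double_fact]. *)
Lemma binomial_le R N : 'C(R + N, N) ^ 2 * 64 ^ N <= 81 ^ (R + N).
Proof.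
have -> : 64 = 8 ^ 2 by []. have -> : 81 = 9 ^ 2 by [].
rewrite -!expnM ![2 * _]mulnC !expnM -expnMn leq_expl //.
rewrite -[9]/(1 + 8) Pascal (bigD1 (Ordinal (leq_addl R N : N < (R + N).+1))) //=.
by rewrite exp1n mul1n leq_addr.
Qed.

Lemma exp_dominates (m rho C0 : nat) : 1 < m ->
  exists k W, [/\ 0 < W, 4 * 81 ^ (rho + W) <= 128 ^ W, C0 < 2 ^ (m ^ k)
    & m * W * (W.+1 + k * m) <= 2 ^ k].
Proof.
(* [81 <= 2 ^ 7] gives [4 * 81 ^ rho <= 2 ^ j], and [2 * 81 ^ 2 <= 128 ^ 2] absorbs this factor when
   [W = 2 * j]. *)
move=> m1; pose j := 7 * rho + 2; pose W := 2 * j.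
(* The exponent [k = 3 * t] occurs in its own lower bound, but only linearly: that bound is at most
   [(t.+1) ^ 3 <= 2 ^ k]. *)
pose t := m * W * W.+1 + m * W * m + C0.
exists (3 * t), W; split; first by rewrite /W /j; lia.
- have h : 4 * 81 ^ rho <= 2 ^ j.
    rewrite /j expnD mulnC expnM leq_mul2r /= leq_expl //.
  rewrite expnD mulnA; apply: leq_trans (leq_mul h (leqnn _)) _.
  by rewrite /W !expnM -expnMn leq_expl.
- have tM : t < m ^ (3 * t).
    apply: leq_trans (ltn_expl t m1) _; rewrite leq_pexp2l //; lia.
  have := ltn_expl (m ^ (3 * t)) (isT : 1 < 2); rewrite /t in tM *; lia.
- have h8 : (t.+1) ^ 3 <= 2 ^ (3 * t).
    by rewrite mulnC expnM leq_expl // ltn_expl.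
  apply: leq_trans h8; rewrite !expnS expn0.
  set A := m * W * W.+1 in t *; set D := m * W * m in t *.
  have -> : m * W * (W.+1 + 3 * t * m) = A + 3 * t * D by rewrite /A /D; lia.
  have At : A <= t by rewrite /t; lia.
  have Dt : D <= t by rewrite /t; lia.
  nia.
Qed.

(* A nonzero integer divisible by the prime-to-[m] part of [(2 * N)`!] and by
   [\prod_b gcdn (m ^ k) (N - b)] is at least [(2 * N)`!] up to a factor [2 ^ (m ^ k)],
   whereas the product of the [R + |N - b|] is roughly [4 ^ N] times smaller. *)
Lemma window_vanishing (m rho C0 : nat) : 1 < m ->
  exists M N, 0 < M /\ forall u s w,
    m ^ s * u = (2 * N)`! * w ->
    \prod_(0 <= b < 2 * N) gcdn M ((N - b) + (b - N)) %| u ->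
    u <= C0 * \prod_(0 <= b < 2 * N) (M * rho + ((N - b) + (b - N))) ->
    u = 0.
Proof.
move=> m1; have [k [W [W0 hW hC hk]]] := exp_dominates rho C0 m1.
set M := m ^ k in hC; pose N := W * M.
have M0 : 0 < M by rewrite expn_gt0 ltnW.
exists M, N; split=> // u s w mu Gu ule.
have [//|u0] := posnP u.
have N0 : 0 < N by rewrite muln_gt0 W0.
have M_N : M %| N by apply: dvdn_mull.
have E0 : 0 < defect m k N.
  by have := fact_gt0 (2 * N); rewrite (fact_split k N m1) muln_gt0 => /andP[].
have nd : (2 * N)`! <= u * defect m k N.
  by apply: dvdn_leq; [rewrite muln_gt0 u0 | apply: fact_dvd_defect m1 M_N mu Gu].
(* [2 * N] is at most [2 ^ l] with [l] linear in [k], whereas the exponent in [defect_le] is [m]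
   times about [N / 2 ^ k]; [hk] balances the two. *)
have Ele : defect m k N <= 2 ^ M.
  apply: leq_trans (defect_le k m1 _) _; first by rewrite muln_gt0.
  set e := _ %/ _; pose l := W.+1 + k * m.
  have nl : 2 * N <= 2 ^ l.
    rewrite /l expnD expnS /N /M -mulnA leq_mul2l /= leq_mul //.
      exact/ltnW/ltn_expl.
    by rewrite mulnC expnM leq_expl // ltnW // ltn_expl.
  apply: leq_trans (leq_expl _ nl) _; rewrite -expnM leq_pexp2l //.
  have he : e * 2 ^ k <= W * M.
    have := leq_divM (2 * N) (2 ^ k.+1); rewrite -/e expnS /N; lia.
  rewrite -(leq_pmul2r (expn_gt0 2 k : 0 < 2 ^ k)).
  apply: (@leq_trans (M * (m * W * l))); last by rewrite leq_mul2l /l hk orbT.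
  have -> : l * (m * e) * 2 ^ k = l * m * (e * 2 ^ k) by lia.
  have -> : M * (m * W * l) = l * m * (W * M) by lia.
  by rewrite leq_mul2l he orbT.
set c := 'C(M * rho + N, N).
have h1 : 2 ^ N <= C0 * c ^ 2 * 2 ^ M.
  rewrite -(leq_pmul2r (_ : 0 < N`! * N`!)) ?muln_gt0 ?fact_gt0 //.
  apply: leq_trans (double_fact N) _; apply: leq_trans nd _.
  apply: leq_trans (leq_mul ule Ele) _.
  have := window_prod_le (M * rho) N; rewrite -/c expnMn => h.
  apply: (@leq_trans (C0 * (c ^ 2 * N`! ^ 2) * 2 ^ M)).
    by rewrite leq_mul // leq_mul.
  by apply: eq_leq; lia.
(* Multiply [h1] by [64 ^ N] and apply [binomial_le]: as [N = W * M], the result is bounded by an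
   [M]-th power, which [hC] and [hW] control. *)
have : 128 ^ N < 128 ^ N.
  have -> : 128 = 2 * 64 by [].
  rewrite {1}expnMn; apply: leq_ltn_trans (leq_mul h1 (leqnn _)) _.
  apply: (@leq_ltn_trans (C0 * 2 ^ M * 81 ^ (M * rho + N))).
    have -> : C0 * c ^ 2 * 2 ^ M * 64 ^ N = C0 * 2 ^ M * (c ^ 2 * 64 ^ N) by lia.
    by rewrite leq_mul2l binomial_le orbT.
  apply: (@leq_trans ((4 * 81 ^ (rho + W)) ^ M)); last by rewrite /N expnM leq_expl.
  rewrite expnMn -expnM mulnDl [rho * M]mulnC -/N.
  rewrite ltn_pmul2r ?expn_gt0 //.
  have -> : 4 = 2 * 2 by [].
  by rewrite expnMn ltn_pmul2r ?expn_gt0.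
by rewrite ltnn.
Qed.

(** * Patterns *)

(* What a map from a set [W] to a structure sees: which elements have the same image, and
   which relations hold between the images. Isomorphism classes of amalgams become patterns
   on a disjoint union, that is, elements of a finite type. *)
Record pattern (L : signature) (W : Type) := Pattern {
  peq : W -> W -> bool;
  prel : forall s : symbol L, (arity s).-tuple W -> bool
}.

HB.instance Definition _ L W := gen_eqMixin (pattern L W).
HB.instance Definition _ L W := gen_choiceMixin (pattern L W).

Section Patterns.
Variable L : signature.

Definition pull (W' W : Type) (h : W' -> W) (k : pattern L W) : pattern L W' :=
  Pattern (fun a b => peq k (h a) (h b))
    (fun s (t : (arity s).-tuple W') => prel k (map_tuple h t)).

Definition strpat (X : structure L) : pattern L X :=
  Pattern (fun a b : X => a == b) (@interp L X).

Lemma patternP W (k k' : pattern L W) :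
  (forall a b, peq k a b = peq k' a b) ->
  (forall s (t : (arity s).-tuple W), prel k t = prel k' t) -> k = k'.
Proof.
case: k k' => [e r] [e' r'] /= he hr; congr Pattern.
  by apply/funext => a; apply/funext => b.
apply: functional_extensionality_dep => s; exact/funext/hr.
Qed.

Lemma pull_comp W'' W' W (g : W'' -> W') (h : W' -> W) k :
  pull g (pull h k) = pull (h \o g) k.
Proof.
apply: patternP => //= s t; congr prel; apply: val_inj => /=.
by rewrite -map_comp.
Qed.

Lemma pull_id W (k : pattern L W) : pull id k = k.
Proof.
apply: patternP => //= s t; congr prel; apply: val_inj => /=.
by rewrite map_id.
Qed.

Lemma eq_pull W' W (g h : W' -> W) k : g =1 h -> pull g k = pull h k.
Proof. by move=> /funext ->. Qed.

Lemma embedding_pull (X Y : structure L) (f : X -> Y) :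
  is_embedding f <-> pull f (strpat Y) = strpat X.
Proof.
split=> [[fI fr] | h].
  by apply: patternP => //= a b; apply: inj_eq.
split=> [a b ab | s t].
  by have /(congr1 (fun k => peq k a b)) /= := h; rewrite ab eqxx => /esym/eqP.
have := congr1 (fun k => @prel _ _ k s t) h => /= <-; congr interp.
Qed.

(** The points of [V] are the classes of [W] under equality of images, so the pattern of a map onto
    [V] determines [V] together with that map. *)
Lemma pattern_iso (W : Type) (V V' : structure L) (q : W -> V) (q' : W -> V') :
  (forall v, exists w, q w = v) -> (forall v, exists w, q' w = v) ->
  pull q (strpat V) = pull q' (strpat V') ->
  exists f : embedding V V', bijective f /\ forall w, f (q w) = q' w.
Proof.
move=> qS q'S e.
have eqE a b : (q a == q b) = (q' a == q' b).
  exact: (congr1 (fun k => peq k a b) e).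
pose r v := projT1 (cid (qS v)); pose r' v := projT1 (cid (q'S v)).
have rK v : q (r v) = v by rewrite /r; case: cid.
have r'K v : q' (r' v) = v by rewrite /r'; case: cid.
pose f v := q' (r v); pose f' v := q (r' v).
have fq w : f (q w) = q' w by apply/eqP; rewrite -eqE rK.
have f'q w : f' (q' w) = q w by apply/eqP; rewrite eqE r'K.
have fE : is_embedding f.
  split=> [a b /eqP|s t]; first by rewrite -eqE !rK => /eqP.
  have /(congr1 (fun k => @prel _ _ k s (map_tuple r t))) /= := e.
  have -> : map_tuple q (map_tuple r t) = t.
    by apply: val_inj; rewrite /= -map_comp map_id_in // => x _ /=; rewrite rK.
  move=> ->; congr interp; apply: val_inj.
  by rewrite /= -map_comp.
exists (Embedding fE); split => //=.
exists f' => v; first by rewrite -[v]rK fq f'q.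
by rewrite -[v]r'K f'q fq.
Qed.

End Patterns.

Section RPatterns.
Variables (L : signature) (F : structure L -> Prop).

Definition realizable (W : Type) (k : pattern L W) : Prop :=
  exists (V : structure L) (q : W -> V), F V /\ pull q (strpat V) = k.

Lemma realizable_pull W' W (h : W' -> W) k : realizable k -> realizable (pull h k).
Proof.
by move=> [V [q [FV <-]]]; exists V, (q \o h); rewrite pull_comp.
Qed.

Hypothesis HF : fraisse_class F.

Lemma realizable_onto (W : finType) (k : pattern L W) : realizable k ->
  exists (V : structure L) (q : W -> V),
    [/\ F V, pull q (strpat V) = k & forall v, exists w, q w = v].
Proof.
move=> [V [q [FV <-]]].
pose A : {set V} := [set q w | w in W].
have qA w : q w \in A by apply: imset_f.
exists (induced A), (fun w => exist _ (q w) (qA w)); split.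
- exact: fraisse_hereditary HF _ _ FV (induced_val A).
- apply: patternP => //= s t; congr interp; apply: val_inj.
  by rewrite /= -map_comp.
- by move=> [v vA]; case/imsetP: (vA) => w _ e; exists w; apply: val_inj.
Qed.

(** The signature may be infinite; finiteness comes from the first axiom of [fraisse_class], since a
    realizable pattern is realized by a map onto a structure with at most [#|W|] points. *)
Lemma realizable_finite (W : finType) :
  exists s : seq (pattern L W), forall k, realizable k <-> k \in s.
Proof.
suff [s sP] : exists s : seq (pattern L W), forall k, realizable k -> k \in s.
  exists [seq k <- s | `[< realizable k >]] => k; rewrite mem_filter.
  by split=> [h|/andP[/asboolP]//]; rewrite sP // andbT; apply/asboolP.
suff [s sP] : exists s : seq (structure L), forall V, F V -> #|{: V}| <= #|W| ->
    exists2 i, i < size s & forall d, iso V (nth d s i).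
  have [[d _]|nF] := pselect (exists V, F V); last first.
    by exists [::] => k [V [q [FV _]]]; case: nF; exists V.
  exists (flatten [seq [seq pull q (strpat (nth d s i)) | q : {ffun W -> nth d s i}] |
    i <- iota 0 (size s)]) => k /realizable_onto[V [q [FV <- qS]]].
  have [|i si /(_ d)[f [g fK gK]]] := sP V FV.
    pose r v := projT1 (cid (qS v)).
    have rK : cancel r q by move=> v; rewrite /r; case: cid.
    by have := leq_card _ (can_inj rK).
  apply/flattenP; eexists; first by apply: map_f; rewrite mem_iota; exact: si.
  apply/imageP; exists [ffun w => f (q w)] => //.
  have /embedding_pull <- := embP f; rewrite pull_comp.
  by apply: eq_pull => w; rewrite ffunE.
elim: #|W| => [|n [s sP]].
  have [c [a [_ _ aP]]] := fraisse_finite HF 0.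
  exists [seq a i | i : 'I_c] => V FV; rewrite leqn0 => /eqP V0.
  have [i ai] := aP V (conj FV V0).
  exists (enum_rank i); first by rewrite size_map -cardE.
  by move=> d; rewrite (nth_map i) -?cardE // nth_enum_rank.
have [c [a [_ _ aP]]] := fraisse_finite HF n.+1.
exists (s ++ [seq a i | i : 'I_c]) => V FV; rewrite leq_eqVlt => /orP[/eqP Vn|Vn].
  have [i ai] := aP V (conj FV Vn).
  exists (size s + enum_rank i).
    by rewrite size_cat ltn_add2l size_map -cardE.
  move=> d; rewrite nth_cat ltnNge leq_addr /= addKn.
  by rewrite (nth_map i) -?cardE // nth_enum_rank.
have [i si iP] := sP V FV Vn; exists i; first by rewrite size_cat ltn_addr.
by move=> d; rewrite nth_cat si.
Qed.

Definition rpats (W : finType) := projT1 (cid (realizable_finite W)).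
Definition rpat (W : finType) : Type := seq_sub (rpats W).
HB.instance Definition _ W := Finite.on (rpat W).
HB.instance Definition _ W := SubType.on (rpat W).

Section One.
Variable W : finType.

Lemma rpatsP (k : pattern L W) : realizable k <-> k \in rpats W.
Proof. by rewrite /rpats; case: cid. Qed.

Lemma rpat_realizable (k : rpat W) : realizable (val k).
Proof. by apply/rpatsP; case: k. Qed.

Definition mkrpat (k : pattern L W) (h : realizable k) : rpat W :=
  SeqSub (proj1 (rpatsP k) h).

Definition rel_of (k : rpat W) : rel W := peq (val k).

Lemma rel_of_equiv (k : rpat W) : equivalence_rel (rel_of k).
Proof.
have [V [q [_ e]]] := rpat_realizable k; rewrite /rel_of -e /= => x y z.
by split=> // /eqP->.
Qed.

Lemma rel_ofxx (k : rpat W) x : rel_of k x x.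
Proof. by have [] := rel_of_equiv k x x x. Qed.

Lemma rel_of_sym (k : rpat W) x y : rel_of k x y = rel_of k y x.
Proof.
have [V [q [_ e]]] := rpat_realizable k.
by rewrite /rel_of -e /= eq_sym.
Qed.

Lemma rel_of_trans (k : rpat W) y x z : rel_of k x y -> rel_of k y z -> rel_of k x z.
Proof.
have [V [q [_ e]]] := rpat_realizable k.
by rewrite /rel_of -e /= => /eqP->.
Qed.

End One.

Definition pullr (W' W : finType) (h : W' -> W) (k : rpat W) : rpat W' :=
  mkrpat (realizable_pull h (rpat_realizable k)).

Lemma val_pullr (W' W : finType) (h : W' -> W) k : val (pullr h k) = pull h (val k).
Proof. by []. Qed.

Lemma rel_of_pullr (W' W : finType) (h : W' -> W) k x y :
  rel_of (pullr h k) x y = rel_of k (h x) (h y).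
Proof. by []. Qed.

Lemma pullr_comp (W'' W' W : finType) (g : W'' -> W') (h : W' -> W) k :
  pullr g (pullr h k) = pullr (h \o g) k.
Proof. by apply: val_inj; rewrite !val_pullr pull_comp. Qed.

Lemma eq_pullr_rel (W' W : finType) (g h : W' -> W) k :
  (forall w, rel_of k (g w) (h w)) -> pullr g k = pullr h k.
Proof.
have [V [q [_ e]]] := rpat_realizable k.
rewrite /rel_of => gh; apply: val_inj; rewrite !val_pullr -e !pull_comp.
by apply: eq_pull => w /=; apply/eqP; move: (gh w); rewrite -e.
Qed.

Lemma eq_pullr (W' W : finType) (g h : W' -> W) k : g =1 h -> pullr g k = pullr h k.
Proof. by move=> /funext ->. Qed.

Lemma pullr_rel_id (W : finType) (g : W -> W) k :
  (forall w, rel_of k (g w) w) -> pullr g k = k.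
Proof.
move=> gk; rewrite (@eq_pullr_rel _ _ g id) //.
by apply: val_inj; rewrite val_pullr pull_id.
Qed.

Lemma rpat_onto (W : finType) (k : rpat W) :
  exists (V : structure L) (q : W -> V),
    [/\ F V, pull q (strpat V) = val k & forall v, exists w, q w = v].
Proof. exact/realizable_onto/rpat_realizable. Qed.

Lemma realizable_strpat X : F X -> realizable (strpat X).
Proof. by move=> FX; exists X, id; rewrite pull_id. Qed.

Definition srpat X (FX : F X) : rpat X := mkrpat (realizable_strpat FX).

Lemma val_srpat X (FX : F X) : val (srpat FX) = strpat X.
Proof. by []. Qed.

Lemma pullr_embedding X Y (FX : F X) (FY : F Y) (i : embedding X Y) :
  pullr i (srpat FY) = srpat FX.
Proof. by apply: val_inj; apply/embedding_pull/embP. Qed.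

End RPatterns.

Local Open Scope ring_scope.

(** * The product of two classes as a sum over patterns *)

Section Measure.
Variables (L : signature) (F : structure L -> Prop).
Hypothesis HF : fraisse_class F.
Local Notation rpat := (rpat HF).

Lemma pclassD G (S : rterm G -> rterm G -> Prop) a b :
  pclass S (radd a b) = pclass S a + pclass S b.
Proof. by rewrite [RHS]padd_class. Qed.

Lemma pclassM G (S : rterm G -> rterm G -> Prop) a b :
  pclass S (rmul a b) = pclass S a * pclass S b.
Proof. by rewrite [RHS]pmul_class. Qed.

Lemma pclassN G (S : rterm G -> rterm G -> Prop) a :
  pclass S (ropp a) = - pclass S a.
Proof. by rewrite [RHS]popp_class. Qed.

Lemma pclass_sum G (S : rterm G -> rterm G -> Prop) (I : Type) (r : seq I)
    (f : I -> rterm G) :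
  pclass S (\big[@radd G/rzero]_(k <- r) f k) = \sum_(k <- r) pclass S (f k).
Proof.
elim: r => [|k r IH]; first by rewrite !big_nil.
by rewrite !big_cons pclassD IH.
Qed.

Definition cls (g : generator F) : Theta F := pclass (@theta_rel L F) (rgen g).

Definition bracket (X Y : structure L) (FX : F X) (FY : F Y) (i : embedding X Y) :
  Theta F := cls (Generator FX FY i).

Lemma bracket_iso (X Y : structure L) (FX : F X) (FY : F Y) (i : embedding X Y) :
  bijective i -> bracket FX FY i = 1.
Proof. by move=> bi; apply/pclassP/rc_rel/theta_iso. Qed.

Lemma bracket_comp (X Y Z : structure L) (FX : F X) (FY : F Y) (FZ : F Z)
    (i : embedding X Y) (j : embedding Y Z) :
  bracket FX FZ (emb_comp j i) = bracket FY FZ j * bracket FX FY i.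
Proof. by rewrite /bracket /cls -pclassM; apply/pclassP/rc_rel/theta_comp. Qed.

Lemma embedding_eq (X Y : structure L) (i j : embedding X Y) : i =1 j -> i = j.
Proof.
case: i j => [f hf] [g hg] /= /funext e; case: _ / e in hg *.
by congr Embedding; apply: Prop_irrelevance.
Qed.

Lemma bracket_compE (X Y Z : structure L) (FX : F X) (FY : F Y) (FZ : F Z)
    (i : embedding X Y) (j : embedding Y Z) (k : embedding X Z) :
  (forall x, k x = j (i x)) ->
  bracket FX FZ k = bracket FY FZ j * bracket FX FY i.
Proof. by move=> e; rewrite -bracket_comp; congr bracket; apply: embedding_eq. Qed.

Lemma bracket_amalgam (X Y X' : structure L) (FX : F X) (FY : F Y) (FX' : F X')
    (i : embedding X Y) (j : embedding X X') (s : nat)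
    (a : 'I_s -> amalgam F i j) :
  representatives (fun=> True) (@amalgam_iso L F X Y X' i j) a ->
  bracket FX FY i = \sum_(k < s) bracket FX' (am_objF (a k)) (am_i (a k)).
Proof.
move=> ra; rewrite /bracket /cls -pclass_sum.
exact/pclassP/rc_rel/(theta_amalgam FX FY FX' ra).
Qed.

Definition realizes (X : structure L) (W : finType) (e : X -> W) (k : rpat W)
    (V : structure L) (q : W -> V) (i : embedding X V) : Prop :=
  [/\ pull q (strpat V) = val k, (forall v, exists w, q w = v)
    & forall x, i x = q (e x)].

Lemma gen_exists (X : structure L) (FX : F X) (W : finType) (e : X -> W) (k : rpat W) :
  exists g : generator F, pullr e k = srpat HF FX ->
    exists V (FV : F V) q i, g = Generator FX FV i /\ realizes e k q i.
Proof.
have [ek|nek] := pselect (pullr e k = srpat HF FX); last first.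
  have idE : is_embedding (id : X -> X).
    by apply/embedding_pull; rewrite pull_id.
  by exists (Generator FX FX (Embedding idE)) => /nek.
have [V [q [FV qk qS]]] := rpat_onto k.
have iE : is_embedding (q \o e).
  by apply/embedding_pull; rewrite -pull_comp qk -val_pullr ek.
by exists (Generator FX FV (Embedding iE)) => _; exists V, FV, q, (Embedding iE).
Qed.

(** A generator is chosen, and not just its class, so that sums of [mu] can be lifted to the free
    ring on the generators. *)
Definition gen_at (X : structure L) (FX : F X) (W : finType) (e : X -> W)
  (k : rpat W) : generator F := projT1 (cid (gen_exists FX e k)).

(* The class of [X -> V], where the map [e] to [W] followed by a map [W -> V] onto a structure
   with pattern [k]; junk unless [e] pulls [k] back to the pattern of [X]. *)
Definition mu (X : structure L) (FX : F X) (W : finType) (e : X -> W) (k : rpat W) :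
  Theta F := cls (gen_at FX e k).

Lemma gen_atP (X : structure L) (FX : F X) (W : finType) (e : X -> W) (k : rpat W) :
  pullr e k = srpat HF FX ->
  exists V (FV : F V) q i, gen_at FX e k = Generator FX FV i /\ realizes e k q i.
Proof. by rewrite /gen_at; case: cid. Qed.

Lemma realizes_pull (X : structure L) (FX : F X) (W : finType) (e : X -> W)
    (k : rpat W) V q (i : embedding X V) :
  realizes e k q i -> pullr e k = srpat HF FX.
Proof.
move=> [qk qS iq]; apply: val_inj; rewrite val_pullr -qk pull_comp val_srpat.
have /embedding_pull <- := embP i; exact: eq_pull.
Qed.

Lemma mu_realizes (X : structure L) (FX : F X) (W : finType) (e : X -> W)
    (k : rpat W) V (FV : F V) q (i : embedding X V) :
  realizes e k q i -> mu FX e k = bracket FX FV i.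
Proof.
move=> ri; have [V' [FV' [q' [i' [g' [qk' qS' iq']]]]]] := gen_atP (realizes_pull FX ri).
rewrite /mu g'; have [qk qS iq] := ri.
have [|f [bf fq]] := @pattern_iso L W V V' q q' qS qS'; first by rewrite qk qk'.
rewrite -/(bracket FX FV' i').
rewrite (@bracket_compE X V V' FX FV FV' i f i') ?(bracket_iso FV FV' bf) ?mul1r //.
by move=> x; rewrite iq' iq fq.
Qed.

Lemma mu_exists (X : structure L) (FX : F X) (W : finType) (e : X -> W) (k : rpat W) :
  pullr e k = srpat HF FX ->
  exists V (FV : F V) q (i : embedding X V), realizes e k q i /\ mu FX e k = bracket FX FV i.
Proof.
move=> /gen_atP [V [FV [q [i [g r]]]]]; exists V, FV, q, i; split=> //.
exact: mu_realizes r.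
Qed.

Lemma mu_pull (X : structure L) (FX : F X) (W' W : finType) (h : W' -> W)
    (e : X -> W) (e' : X -> W') (k : rpat W) :
  (forall w, exists w', rel_of k w (h w')) ->
  (forall x, rel_of k (e x) (h (e' x))) ->
  pullr e k = srpat HF FX ->
  mu FX e k = mu FX e' (pullr h k).
Proof.
move=> hS hx ek; have [V [FV [q [i [[qk qS iq] ->]]]]] := mu_exists ek.
have relE w w' : rel_of k w w' = (q w == q w') by rewrite /rel_of -qk.
apply/esym/(@mu_realizes _ FX _ _ _ _ FV (q \o h)); split.
- by rewrite val_pullr -qk pull_comp.
- move=> v; have [w <-] := qS v; have [w'] := hS w; rewrite relE => /eqP ->.
  by exists w'.
- by move=> x; rewrite iq /=; apply/eqP; rewrite -relE.
Qed.

Lemma mu_srpat (X Y : structure L) (FX : F X) (FY : F Y) (i : embedding X Y) :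
  mu FX i (srpat HF FY) = bracket FX FY i.
Proof.
apply: (@mu_realizes _ _ _ _ _ _ FY id); split=> //.
  by rewrite val_srpat pull_id.
by move=> v; exists v.
Qed.

Lemma mu_comp (X Y : structure L) (FX : F X) (FY : F Y) (i : embedding X Y)
    (W : finType) (e : Y -> W) (k : rpat W) :
  pullr e k = srpat HF FY ->
  mu FX (e \o i) k = mu FY e k * bracket FX FY i.
Proof.
move=> ek; have [V [FV [q [j [[qk qS jq] ->]]]]] := mu_exists ek.
rewrite -bracket_comp; apply: (@mu_realizes _ _ _ _ _ _ _ q); split=> //= x.
Qed.

Definition glued (A : structure L) (W W2 : finType) (f : A -> W) (f2 : A -> W2)
    (k : rpat W) (b : rpat W2) (l : rpat (W + W2)%type) : bool :=
  [&& pullr inl l == k, pullr inr l == b & [forall a, rel_of l (inl (f a)) (inr (f2 a))]].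

Section Master.
Variables (A : structure L) (FA : F A) (W W2 : finType) (f : A -> W) (f2 : A -> W2).
Variables (k : rpat W) (b : rpat W2).
Variables (V V2 : structure L) (FV : F V) (FV2 : F V2) (q : W -> V) (q2 : W2 -> V2).
Variables (j : embedding A V) (j2 : embedding A V2).
Hypotheses (rj : realizes f k q j) (rj2 : realizes f2 b q2 j2).

Definition am_map (a : amalgam F j2 j) (w : W + W2) : am_obj a :=
  match w with inl w => am_i a (q w) | inr w => am_j a (q2 w) end.

Lemma am_map_onto a v : exists w, am_map a w = v.
Proof.
have [_ qS _] := rj; have [_ qS2 _] := rj2.
have [[x <-]|[x <-]] := am_cover v.
  by have [w <-] := qS x; exists (inl w).
by have [w <-] := qS2 x; exists (inr w).
Qed.

Lemma am_map_realizable a : realizable F (pull (am_map a) (strpat (am_obj a))).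
Proof. by exists (am_obj a), (am_map a); split => //; apply: am_objF. Qed.

Definition am_pat a : rpat (W + W2)%type := mkrpat HF (am_map_realizable a).

Lemma am_pat_glued a : glued f f2 k b (am_pat a).
Proof.
have [qk qS jq] := rj; have [qk2 qS2 jq2] := rj2.
apply/and3P; split.
- apply/eqP/val_inj; rewrite val_pullr /= pull_comp -qk.
  have /embedding_pull <- := embP (am_i a); rewrite pull_comp.
  exact: eq_pull.
- apply/eqP/val_inj; rewrite val_pullr /= pull_comp -qk2.
  have /embedding_pull <- := embP (am_j a); rewrite pull_comp.
  exact: eq_pull.
- apply/forallP => x; rewrite /rel_of /=; apply/eqP.
  by rewrite -jq -jq2 am_comm.
Qed.

Lemma am_pat_iso a a' : am_pat a = am_pat a' <-> amalgam_iso a a'.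
Proof.
have [qk qS jq] := rj; have [qk2 qS2 jq2] := rj2.
split=> [/(congr1 val)/= e|[g [bg gi gj]]].
  have [g [bg gq]] := pattern_iso (@am_map_onto a) (@am_map_onto a') e.
  exists g; split=> // x.
    by have [w <-] := qS x; have /= := gq (inl w).
  by have [w <-] := qS2 x; have /= := gq (inr w).
apply: val_inj => /=; have /embedding_pull <- := embP g; rewrite pull_comp.
by apply: eq_pull => -[] w /=.
Qed.

Lemma am_pat_surj l : glued f f2 k b l -> exists a, am_pat a = l.
Proof.
have [qk qS jq] := rj; have [qk2 qS2 jq2] := rj2.
case/and3P=> /eqP lk /eqP lb /forallP lf.
have [V' [Q [FV' Ql QS]]] := rpat_onto l.
have relE w w' : rel_of l w w' = (Q w == Q w') by rewrite /rel_of -Ql.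
pose r v := projT1 (cid (qS v)); pose r2 v := projT1 (cid (qS2 v)).
have rK v : q (r v) = v by rewrite /r; case: cid.
have r2K v : q2 (r2 v) = v by rewrite /r2; case: cid.
have qQ w w' : q w = q w' -> Q (inl w) = Q (inl w').
  move=> /eqP qq; apply/eqP; rewrite -relE -(rel_of_pullr inl) lk.
  by rewrite /rel_of -qk.
have qQ2 w w' : q2 w = q2 w' -> Q (inr w) = Q (inr w').
  move=> /eqP qq; apply/eqP; rewrite -relE -(rel_of_pullr inr) lb.
  by rewrite /rel_of -qk2.
have aiE : is_embedding (fun v => Q (inl (r v))).
  apply/embedding_pull.
  transitivity (pull r (val (pullr inl l))).
    by rewrite val_pullr -Ql !pull_comp.
  by rewrite lk -qk pull_comp -[RHS]pull_id; apply: eq_pull => v /=; rewrite rK.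
have ajE : is_embedding (fun v => Q (inr (r2 v))).
  apply/embedding_pull.
  transitivity (pull r2 (val (pullr inr l))).
    by rewrite val_pullr -Ql !pull_comp.
  by rewrite lb -qk2 pull_comp -[RHS]pull_id; apply: eq_pull => v /=; rewrite r2K.
have comm x : Embedding aiE (j x) = Embedding ajE (j2 x).
  have /eqP e : Q (inl (f x)) == Q (inr (f2 x)) by rewrite -relE.
  rewrite /=; transitivity (Q (inl (f x))); first by apply: qQ; rewrite rK.
  by rewrite e; apply: qQ2; rewrite r2K.
have cover z : (exists x', Embedding aiE x' = z) \/ (exists y, Embedding ajE y = z).
  have [[w|w] <-] := QS z; [left; exists (q w)|right; exists (q2 w)] => /=.
    by apply: qQ; rewrite rK.
  by apply: qQ2; rewrite r2K.
exists (Amalgam FV' comm cover); apply: val_inj => /=; rewrite -Ql.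
apply: eq_pull => -[] w /=; [apply: qQ|apply: qQ2]; by rewrite ?rK ?r2K.
Qed.

(** Relation (iii) with the amalgams indexed by their patterns; the section [r] of [q] gives the
    points of [V] names in [W]. *)
Lemma master_aux (r : V -> W) : (forall v, q (r v) = v) ->
  bracket FA FV2 j2 = \sum_(l | glued f f2 k b l) mu FV (inl \o r) l.
Proof.
move=> rK.
pose G : {set rpat (W + W2)%type} := [set l | glued f f2 k b l].
have Gl (n : 'I_#|G|) : glued f f2 k b (enum_val n).
  by have := enum_valP n; rewrite inE.
pose a (n : 'I_#|G|) := projT1 (cid (am_pat_surj (Gl n))).
have aE n : am_pat (a n) = enum_val n := projT2 (cid (am_pat_surj (Gl n))).
rewrite (@bracket_amalgam A V2 V FA FV2 FV j2 j _ a).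
  rewrite [RHS](eq_bigl (fun l => l \in G)); last by move=> l; rewrite inE.
  rewrite [RHS]big_enum_val; apply: eq_bigr => n _.
  apply/esym/(@mu_realizes _ _ _ _ _ _ _ (@am_map (a n))); split.
  - by rewrite -aE.
  - exact: am_map_onto.
  - by move=> v /=; rewrite rK.
split=> // [n n' /am_pat_iso|x _].
  by rewrite !aE; apply: enum_val_inj.
have Gx : am_pat x \in G by rewrite inE am_pat_glued.
exists (enum_rank_in Gx (am_pat x)); apply/am_pat_iso.
by rewrite aE enum_rankK_in.
Qed.

End Master.

(* Relations (ii) and (iii) combined: the amalgams of two structures over [A] are the patterns
   on the disjoint union that restrict to the two given ones and identify the copies of [A]. *)
Lemma mu_glue (X A : structure L) (FX : F X) (FA : F A) (W W2 : finType)
    (e : X -> W) (f : A -> W) (f2 : A -> W2) (k : rpat W) (b : rpat W2) :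
  pullr e k = srpat HF FX -> pullr f k = srpat HF FA -> pullr f2 b = srpat HF FA ->
  mu FX e k * mu FA f2 b = \sum_(l | glued f f2 k b l) mu FX (inl \o e) l.
Proof.
move=> ek fk f2b; have [V [FV [q [i [[qk qS iq] ->]]]]] := mu_exists ek.
have jE : is_embedding (q \o f).
  by apply/embedding_pull; rewrite -pull_comp qk -val_pullr fk.
have rj : realizes f k q (Embedding jE) by [].
have [V2 [FV2 [q2 [j2 [rj2 ->]]]]] := mu_exists f2b.
pose r v := projT1 (cid (qS v)).
have rK v : q (r v) = v by rewrite /r; case: cid.
rewrite (master_aux FA FV FV2 rj rj2 rK) mulrC mulr_suml; apply: eq_bigr => l gl.
have lk : pullr inl l = k by have [/eqP] := and3P gl.
have lr : pullr (inl \o r) l = srpat HF FV.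
  apply: val_inj; rewrite -pullr_comp lk val_pullr -qk pull_comp -[RHS]pull_id.
  exact: eq_pull.
rewrite -(mu_comp FX _ lr).
have rq x : rel_of l (inl (r (i x))) (inl (e x)).
  by rewrite -(rel_of_pullr inl) lk /rel_of -qk /= rK iq.
rewrite (@mu_pull _ FX _ _ id (inl \o r \o i) (inl \o e)) //.
- by congr mu; apply: val_inj; rewrite val_pullr pull_id.
- by move=> w; exists w; apply: rel_ofxx.
- by rewrite -pullr_comp lr pullr_embedding.
Qed.

End Measure.

(** * Sums over the orbits of a cyclic group of prime order *)

Section CyclicSums.
Variables (p : nat) (p_pr : prime p).

Definition rotates (T : finType) (rho : T -> T) : Prop := forall x, iter p rho x = x.

Definition acts_freely (T : finType) (rho : T -> T) (S : pred T) : Prop :=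
  forall x, S x -> S (rho x) /\ rho x != x.

(* A sum over one representative of each orbit of [rho] in [S]. *)
Definition osum (R : nmodType) (T : finType) (rho : T -> T) (S : pred T) (f : T -> R) : R :=
  \sum_(x | S x && (froot rho x == x)) f x.

Section OneAction.
Variables (T : finType) (rho : T -> T).
Hypothesis rhoP : rotates rho.

Lemma rotates_inj : injective rho.
Proof.
apply: (can_inj (g := iter p.-1 rho)) => x.
by rewrite -iterSr prednK ?prime_gt0.
Qed.

Lemma iter_rho_mul n x : iter (n * p) rho x = x.
Proof. by elim: n => [|n IH] //; rewrite mulSn iterD IH. Qed.

Lemma iter_rho_dvd n x : (p %| n)%N -> iter n rho x = x.
Proof. by case/dvdnP=> k ->; apply: iter_rho_mul. Qed.

(** If [n] were prime to [p], Bezout would make [rho] a power of [iter n rho], so that it would fix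
    [x]. *)
Lemma free_dvd n x : rho x != x -> iter n rho x = x -> (p %| n)%N.
Proof.
move=> nx ix; apply: contraR nx => np.
have /eqP g1 : coprime n p by rewrite coprime_sym prime_coprime.
have n0 : (0 < n)%N by case: n np {ix g1} => //; rewrite dvdn0.
have [u v e _] := egcdnP p n0.
have -> : rho x = iter (u * n) rho x.
  by rewrite e g1 addn1 /= iter_rho_mul.
by rewrite iterM; apply/eqP; elim: u {e} => //= u ->.
Qed.

Lemma order_free x : rho x != x -> fingraph.order rho x = p.
Proof.
move=> nx; apply/eqP; rewrite eqn_dvd (free_dvd nx (iter_order rotates_inj x)) andbT.
have := rhoP x; set o := fingraph.order rho x => ipx.
rewrite /dvdn; apply/negPn/negP => r0.
have o0 : (0 < o)%N := fingraph.order_gt0 rho x.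
have ir : iter (p %% o) rho x = x.
  rewrite {1}(divn_eq p o) addnC iterD in ipx.
  suff e : iter (p %/ o * o) rho x = x by rewrite e in ipx.
  rewrite iterM; elim: (p %/ o)%N => //= d ->; exact: (iter_order rotates_inj).
have lt : (p %% o < o)%N by rewrite ltn_mod.
have := findex_iter lt; rewrite ir findex0 => /esym e.
by rewrite e in r0.
Qed.

Variable S : pred T.
Hypothesis S_free : acts_freely rho S.

Lemma S_iter n x : S x -> S (iter n rho x).
Proof. by move=> Sx; elim: n => //= n /S_free[]. Qed.

Lemma S_root x : S (froot rho x) = S x.
Proof.
apply/idP/idP => Sx.
  have : fconnect rho (froot rho x) x.
    by rewrite fconnect_sym ?connect_root //; apply: rotates_inj.
  by move=> /iter_findex <-; apply: S_iter.
by rewrite -(iter_findex (connect_root _ x)) S_iter.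
Qed.

Lemma sum_osum (R : nmodType) (f : T -> R) :
  (forall x, S x -> f (rho x) = f x) -> \sum_(x | S x) f x = osum rho S f *+ p.
Proof.
move=> fr; have fri n x : S x -> f (iter n rho x) = f x.
  by move=> Sx; elim: n => //= n IH; rewrite fr ?S_iter.
rewrite (partition_big (froot rho) (fun x => S x && (froot rho x == x))); last first.
  by move=> x Sx; rewrite S_root Sx (root_root (fconnect_sym rotates_inj)) /=.
rewrite /osum -sumrMnl; apply: eq_bigr => x /andP[Sx /eqP rx].
rewrite (eq_bigr (fun=> f x)); last first.
  move=> y /andP[Sy /eqP <-].
  by rewrite -(iter_findex (connect_root _ y)) fri.
rewrite sumr_const; congr (_ *+ _).
have [_ nx] := S_free Sx; rewrite -[RHS](order_free nx).
apply: eq_card => y; rewrite !inE.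
rewrite unfold_in -(root_connect (fconnect_sym rotates_inj)) rx [_ == x]eq_sym.
by case: eqP => [e|]; rewrite ?andbF // andbT -S_root -e.
Qed.

(** The sum does not depend on the representatives that [froot] happens to pick: [Q] is any other
    transversal of the orbits. *)
Lemma osum_transversal (R : nmodType) (f : T -> R) (Q : pred T) :
  (forall x, S x -> f (rho x) = f x) ->
  (forall x, Q x -> S x) ->
  (forall x, S x -> exists n, Q (iter n rho x)) ->
  (forall x n, Q x -> Q (iter n rho x) -> iter n rho x = x) ->
  osum rho S f = \sum_(x | Q x) f x.
Proof.
move=> fr QS Qex Quniq; have fri n x : S x -> f (iter n rho x) = f x.
  by move=> Sx; elim: n => //= n IH; rewrite fr ?S_iter.
have sym := fconnect_sym rotates_inj.
pose g x := if pselect (S x) is left Sx then iter (projT1 (cid (Qex x Sx))) rho x else x.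
have gQ x : S x -> Q (g x) /\ exists n, g x = iter n rho x.
  rewrite /g => Sx; case: pselect => // Sx'; case: cid => n Qn /=.
  by split=> //; exists n.
rewrite /osum (reindex_onto (froot rho) g) /=; last first.
  move=> x /andP[Sx /eqP rx]; have [_ [n ->]] := gQ x Sx.
  by rewrite -[RHS]rx; apply/esym/eqP; rewrite root_connect // fconnect_iter.
apply: eq_big => [x|x /andP[/andP[Sx _] _]]; last first.
  by rewrite -(iter_findex (connect_root _ x)) fri // -S_root.
rewrite (root_root sym) eqxx andbT S_root.
apply/andP/idP => [[Sx /eqP <-]|Qx]; first by case: (gQ _ (etrans (S_root x) Sx)).
have Sx := QS x Qx; have [Qg [n gn]] := gQ _ (etrans (S_root x) Sx).
split=> //; apply/eqP; move: Qg; rewrite gn.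
rewrite -(iter_findex (connect_root (frel rho) x)) -iterD; exact: Quniq.
Qed.

End OneAction.

Lemma osum_split (R : nmodType) (T : finType) (rho : T -> T) (S Q : pred T) (f : T -> R) :
  osum rho S f = osum rho [pred x | S x && Q x] f + osum rho [pred x | S x && ~~ Q x] f.
Proof.
by rewrite /osum (bigID Q) /=; congr (_ + _); apply: eq_bigl => x; rewrite /= andbAC.
Qed.

Lemma osum_eq (R : nmodType) (T : finType) (rho : T -> T) (S S' : pred T) (f f' : T -> R) :
  (forall x, S x = S' x) -> (forall x, S x -> f x = f' x) -> osum rho S f = osum rho S' f'.
Proof.
by move=> e ef; apply: eq_big => [x|x /andP[Sx _]]; rewrite ?e ?ef.
Qed.

Section TwoActions.
Variables (T T' : finType) (rho : T -> T) (rho' : T' -> T').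
Hypotheses (rhoP : rotates rho) (rhoP' : rotates rho').
Variables (S : pred T) (S' : pred T') (pi : T -> T').
Hypothesis S'_free : acts_freely rho' S'.
Hypothesis piS : forall x, S x -> S' (pi x).
Hypothesis pi_rho : forall x, S x -> pi (rho x) = rho' (pi x).
Hypothesis S_stable : forall x, S x -> S (rho x).

Lemma free_fiber : acts_freely rho S.
Proof.
move=> x Sx; split; first exact: S_stable.
apply: contraNneq (proj2 (S'_free (piS Sx))) => e.
by rewrite -pi_rho // e.
Qed.

(** The points of [S] above the representatives of the orbits of [S'] form a transversal, because
    the action on [S'] is free. *)
Lemma osum_fiber (R : nmodType) (f : T -> R) :
  (forall x, S x -> f (rho x) = f x) ->
  osum rho S f = osum rho' S' (fun y => \sum_(x | S x && (pi x == y)) f x).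
Proof.
move=> fr.
have Sit n x : S x -> S (iter n rho x) by move=> Sx; elim: n => //= n; apply: S_stable.
have pit n x : S x -> pi (iter n rho x) = iter n rho' (pi x).
  by move=> Sx; elim: n => //= n <-; rewrite pi_rho ?Sit.
pose Q x := S x && (S' (pi x) && (froot rho' (pi x) == pi x)).
rewrite (@osum_transversal T rho rhoP S free_fiber R f Q) //.
- rewrite /osum (partition_big pi (fun y => S' y && (froot rho' y == y))).
    apply: eq_bigr => y Sy; apply: eq_bigl => x.
    by rewrite /Q; case: (pi x =P y) => [->|_]; rewrite ?Sy ?andbT ?andbF.
  by move=> x /andP[].
- by move=> x /andP[].
- move=> x Sx; exists (findex rho' (pi x) (froot rho' (pi x))).
  rewrite /Q Sit // pit // iter_findex ?connect_root // S_root ?piS //=.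
  by rewrite (root_root (fconnect_sym (rotates_inj rhoP'))).
- move=> x n /and3P[Sx S'x /eqP rx] /and3P[Snx _ /eqP rnx].
  apply: (iter_rho_dvd rhoP); apply: (free_dvd rhoP' (proj2 (S'_free S'x))).
  rewrite -pit // -rnx -[RHS]rx pit //; apply/esym/eqP.
  by rewrite (root_connect (fconnect_sym (rotates_inj rhoP'))) fconnect_iter.
Qed.

End TwoActions.

Lemma osum_bij (R : nmodType) (T T' : finType) (rho : T -> T) (rho' : T' -> T')
    (S : pred T) (S' : pred T') (g : T -> T') (g' : T' -> T) (f : T -> R) (f' : T' -> R) :
  rotates rho -> rotates rho' -> acts_freely rho' S' ->
  (forall x, S x -> [/\ S' (g x), g' (g x) = x, g (rho x) = rho' (g x), f x = f' (g x) & S (rho x)]) ->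
  (forall y, S' y -> S (g' y) /\ g (g' y) = y) ->
  (forall x, S x -> f (rho x) = f x) ->
  osum rho S f = osum rho' S' f'.
Proof.
move=> rP rP' fr' gP gP' fr.
rewrite (@osum_fiber T T' rho rho' rP rP' S S' g) //; try by move=> x /gP[].
apply: osum_eq => // y Sy; have [Sg gg] := gP' y Sy.
rewrite (big_pred1 (g' y)) => [|x /=].
  by have [_ _ _ -> _] := gP _ Sg; rewrite gg.
apply/andP/eqP => [[Sx /eqP <-]|->]; last by rewrite gg.
by have [_ ->] := gP _ Sx.
Qed.

End CyclicSums.

(** * Products of several classes as sums over patterns *)

Section Pow.
Variables (L : signature) (F : structure L -> Prop).
Hypothesis HF : fraisse_class F.
Local Notation rpat := (rpat HF).

(** [h] and [h'] are inverse only up to [rel_of], that is, after mapping to the structure. Index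
    sets with redundant points can thus be exchanged. *)
Lemma sum_mu_transfer (X : structure L) (FX : F X) (W W' : finType)
    (h : W' -> W) (h' : W -> W') (e : X -> W) (e' : X -> W')
    (P : pred (rpat W)) (P' : pred (rpat W')) :
  (forall l, P l -> [/\ P' (pullr h l), forall w, rel_of l (h (h' w)) w,
      forall x, rel_of l (e x) (h (e' x)) & pullr e l = srpat HF FX]) ->
  (forall l, P' l -> P (pullr h' l) /\ forall w, rel_of l (h' (h w)) w) ->
  \sum_(l | P l) mu FX e l = \sum_(l | P' l) mu FX e' l.
Proof.
move=> PP PP'; rewrite (reindex_onto (pullr h') (pullr h)) /=; last first.
  move=> l /PP[_ hw _ _]; rewrite pullr_comp; exact: pullr_rel_id.
apply: eq_big => [l|l /andP[Pl /eqP el]].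
  apply/andP/idP => [[/PP[Pl _ _ _] /eqP el]|Pl].
    by rewrite el in Pl.
  have [Pl' hw] := PP' l Pl; split=> //; apply/eqP.
  rewrite pullr_comp; exact: pullr_rel_id.
have [P'l hw he ex] := PP _ Pl.
rewrite -[in RHS]el; apply: mu_pull => // w.
by exists (h' w); rewrite rel_of_sym hw.
Qed.

Definition powglued (A : structure L) (n : nat) (W W2 : finType) (f : 'I_n -> A -> W)
    (f2 : A -> W2) (k : rpat W) (b : 'I_n -> rpat W2)
    (l : rpat (W + 'I_n * W2)%type) : bool :=
  [&& pullr inl l == k, [forall i, pullr (fun y => inr (i, y)) l == b i]
    & [forall i, forall a, rel_of l (inl (f i a)) (inr (i, f2 a))]].

Lemma powgluedP (A : structure L) (n : nat) (W W2 : finType) (f : 'I_n -> A -> W)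
    (f2 : A -> W2) (k : rpat W) (b : 'I_n -> rpat W2) (l : rpat (W + 'I_n * W2)%type) :
  reflect [/\ pullr inl l = k, forall i, pullr (fun y => inr (i, y)) l = b i
    & forall i a, rel_of l (inl (f i a)) (inr (i, f2 a))] (powglued f f2 k b l).
Proof.
apply: (iffP and3P) => [[/eqP-> /forallP hb /forallP hf]|[-> hb hf]]; split=> //.
- by move=> i; apply/eqP.
- by move=> i a; have /forallP := hf i.
- by apply/forallP => i; rewrite hb.
- by apply/forallP => i; apply/forallP => a.
Qed.

Lemma gluedP (A : structure L) (W W2 : finType) (f : A -> W)
    (f2 : A -> W2) (k : rpat W) (b : rpat W2) (l : rpat (W + W2)%type) :
  reflect [/\ pullr inl l = k, pullr inr l = b
    & forall a, rel_of l (inl (f a)) (inr (f2 a))] (glued f f2 k b l).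
Proof.
by apply: (iffP and3P) => [[/eqP-> /eqP -> /forallP hf]|[-> -> /forallP hf]]; split.
Qed.

Lemma mu_glue_pow (X A : structure L) (FX : F X) (FA : F A) (n : nat) (W W2 : finType)
    (e : X -> W) (f : 'I_n -> A -> W) (f2 : A -> W2) (k : rpat W) (b : 'I_n -> rpat W2) :
  pullr e k = srpat HF FX -> (forall i, pullr (f i) k = srpat HF FA) ->
  (forall i, pullr f2 (b i) = srpat HF FA) ->
  mu FX e k * \prod_(i < n) mu FA f2 (b i) =
    \sum_(l | powglued f f2 k b l) mu FX (inl \o e) l.
Proof.
move=> ek; elim: n f b => [|n IH] f b fk f2b.
  have -> : mu FX e k = \sum_(l | l == k) mu FX e l by rewrite (big_pred1 k).
  rewrite big_ord0 mulr1.
  pose h (w : W + 'I_0 * W2) : W := match w with inl w => w | inr (i, _) =>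
      match i with Ordinal _ lt => False_rect W (notF lt) end end.
  apply: (@sum_mu_transfer _ FX _ _ h inl) => l /=.
    move=> /eqP ->; split=> //; try by move=> w; apply: rel_ofxx.
    apply/powgluedP; split; try by case.
    by rewrite pullr_comp; apply: pullr_rel_id => w; apply: rel_ofxx.
  move=> /powgluedP[<- _ _]; split=> // -[w|[[]]] //; exact: rel_ofxx.
rewrite big_ord_recr /= mulrA (IH (f \o widen_ord (leqnSn n)) (b \o widen_ord (leqnSn n))) //;
  try by move=> i /=.
rewrite mulr_suml.
pose fm a : W + 'I_n * W2 := inl (f ord_max a).
transitivity (\sum_(l | powglued (f \o widen_ord (leqnSn n)) f2 k (b \o widen_ord (leqnSn n)) l)
    \sum_(l' | glued fm f2 l (b ord_max) l') mu FX (inl \o (inl \o e)) l').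
  apply: eq_bigr => l /powgluedP[lk lb lf]; apply: mu_glue => //.
    by rewrite -ek -lk pullr_comp.
  by rewrite -(fk ord_max) -lk pullr_comp.
rewrite (exchange_big_dep (fun l' => powglued (f \o widen_ord (leqnSn n)) f2 k
  (b \o widen_ord (leqnSn n)) (pullr inl l') && glued fm f2 (pullr inl l') (b ord_max) l')) /=;
  last first.
  by move=> l l' Pl gl; have /gluedP[e1 _ _] := gl; rewrite e1 Pl gl.
transitivity (\sum_(l' | powglued (f \o widen_ord (leqnSn n)) f2 k
  (b \o widen_ord (leqnSn n)) (pullr inl l') && glued fm f2 (pullr inl l') (b ord_max) l')
   mu FX (inl \o (inl \o e)) l').
  apply: eq_bigr => l' /andP[Pl gl]; rewrite (big_pred1 (pullr inl l')) // => l /=.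
  apply/andP/eqP => [[_ /gluedP[]] //|->]; by [].
(* The two index sets are matched by setting the last copy of [W2] apart. *)
pose h (w : W + 'I_n.+1 * W2) : (W + 'I_n * W2) + W2 :=
  match w with inl w => inl (inl w) | inr (i, w) =>
    if unlift ord_max i is Some i' then inl (inr (i', w)) else inr w end.
pose h' (w : (W + 'I_n * W2) + W2) : W + 'I_n.+1 * W2 :=
  match w with inl (inl w) => inl w | inl (inr (i, w)) => inr (lift ord_max i, w)
    | inr w => inr (ord_max, w) end.
have hK : cancel h h'.
  by case=> [w|[i w]] //=; case: unliftP => [i'|] -> /=.
have h'K : cancel h' h.
  by case=> [[w|[i w]]|w] //=; rewrite ?liftK ?unlift_none.
have wl i : widen_ord (leqnSn n) i = lift ord_max i.
  by apply: val_inj; rewrite /= /bump leqNgt ltn_ord.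
apply: (@sum_mu_transfer _ FX _ _ h h').
  move=> l /andP[/powgluedP[lk lb lf] /gluedP[_ lm fl]]; split.
  - apply/powgluedP; split.
    + by rewrite -lk !pullr_comp.
    + move=> i; rewrite pullr_comp; case: (unliftP ord_max i) => [j|] e1.
        rewrite e1 -wl -[RHS]lb !pullr_comp; apply: eq_pullr => y /=.
        by rewrite wl liftK.
      by rewrite e1 -lm; apply: eq_pullr => y /=; rewrite unlift_none.
    + move=> i a; rewrite rel_of_pullr /=; case: (unliftP ord_max i) => [j|] e1.
        by rewrite e1 -wl; apply: lf.
      by rewrite e1; apply: fl.
  - by move=> w; rewrite h'K; apply: rel_ofxx.
  - by move=> x; apply: rel_ofxx.
  - by rewrite -ek -lk !pullr_comp.
move=> l /powgluedP[lk lb lf]; split; last by move=> w; rewrite hK; apply: rel_ofxx.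
apply/andP; split.
  apply/powgluedP; split.
  - by rewrite !pullr_comp -lk.
  - by move=> i; rewrite !pullr_comp /= -lb; apply: eq_pullr => y /=; rewrite wl.
  - by move=> i a; rewrite !rel_of_pullr /= wl; have := lf (lift ord_max i) a; rewrite /= -wl.
apply/gluedP; split=> //.
- by rewrite pullr_comp -lb.
- by move=> a; rewrite rel_of_pullr; apply: lf.
Qed.

End Pow.

(** * Automorphisms of prime order *)

Section Automorphisms.
Variable L : signature.

Lemma automorphisms_group_set (X : structure L) : group_set (automorphisms X).
Proof.
apply/group_setP; split.
  rewrite inE; apply/asboolP/embedding_pull; rewrite -[RHS]pull_id.
  by apply: eq_pull => x; rewrite perm1.
move=> s t; rewrite !inE => /asboolP hs /asboolP ht; apply/asboolP/embedding_pull.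
rewrite (eq_pull _ (permM s t)) -(pull_comp s t).
by have /embedding_pull -> := ht; apply/embedding_pull.
Qed.

Lemma prime_dvd_automorphisms (X : structure L) (p : nat) (f : X -> X) :
  prime p -> is_embedding f -> (forall x, iter p f x = x) -> ~ (forall x, f x = x) ->
  (p %| #|automorphisms X|)%N.
Proof.
move=> p_pr ef fp nf; have [fI _] := ef.
pose s := perm fI; have sE x : s x = f x by rewrite permE.
pose G := Group (automorphisms_group_set X).
have sG : s \in G.
  rewrite inE; apply/asboolP/embedding_pull; rewrite (eq_pull _ sE).
  exact/embedding_pull.
have -> : p = #[s]%g.
  apply/esym/nt_prime_order => //.
    apply/permP => x; rewrite permX perm1 -[RHS]fp.
    by elim: (p) => //= n ->; rewrite sE.
  by apply/eqP => s1; apply: nf => x; rewrite -sE s1 perm1.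
exact: order_dvdG sG.
Qed.

End Automorphisms.

(** * Rotation of tuples and the power of a sum *)

Section Rotation.
Variables (p : nat) (p_pr : prime p).

Lemma iter_ordS n (i : 'I_p) : iter n (@ordS p) i = ((i + n) %% p)%N :> nat.
Proof.
elim: n => [|n IH]; first by rewrite addn0 modn_small.
by rewrite iterS /= IH addnS -addn1 modnDml addn1.
Qed.

Lemma iter_ordS_p (i : 'I_p) : iter p (@ordS p) i = i.
Proof. by apply: val_inj; rewrite /= iter_ordS modnDr modn_small. Qed.

Lemma iter_ordS_onto (i j : 'I_p) : exists n, j = iter n (@ordS p) i.
Proof.
exists (p - i + j)%N; apply: val_inj; rewrite /= iter_ordS addnA subnKC ?modnDl ?modn_small //.
exact: ltnW.
Qed.

Definition rotf (T : finType) (t : {ffun 'I_p -> T}) : {ffun 'I_p -> T} :=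
  [ffun k => t (ordS k)].

Definition nonconst (T : finType) (t : {ffun 'I_p -> T}) : bool :=
  ~~ [forall k, forall k', t k == t k'].

Lemma nonconstPn (T : finType) (t : {ffun 'I_p -> T}) :
  reflect (forall k k', t k = t k') (~~ nonconst t).
Proof.
rewrite negbK; apply: (iffP forallP) => h k; last by apply/forallP => k'; apply/eqP.
by move=> k'; apply/eqP; have /forallP := h k.
Qed.

Lemma iter_rotf (T : finType) n (t : {ffun 'I_p -> T}) k : iter n (@rotf T) t k = t (iter n (@ordS p) k).
Proof. by elim: n k => //= n IH k; rewrite ffunE IH -iterSr. Qed.

Lemma rotf_rotates (T : finType) : rotates p (@rotf T).
Proof. by move=> t; apply/ffunP => k; rewrite iter_rotf iter_ordS_p. Qed.

Lemma nonconst_rotf (T : finType) (t : {ffun 'I_p -> T}) : nonconst (rotf t) = nonconst t.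
Proof.
apply/negb_inj; apply/nonconstPn/nonconstPn => h k k'; last by rewrite !ffunE.
have := h (iter p.-1 (@ordS p) k) (iter p.-1 (@ordS p) k').
by rewrite !ffunE -!iterS prednK ?prime_gt0 // !iter_ordS_p.
Qed.

Lemma rotf_free (T : finType) : acts_freely (@rotf T) (@nonconst T).
Proof.
move=> t nt; split; first by rewrite nonconst_rotf.
apply: contraTneq nt => e; apply/nonconstPn => k k'.
have [n ->] := iter_ordS_onto k k'; rewrite -iter_rotf.
suff -> : iter n (@rotf T) t = t by [].
by elim: n => //= n ->.
Qed.

(** The power is expanded over functions ['I_p -> I]: constant ones give the [p]-th powers, and the
    others fall into rotation orbits of size [p]. *)
Lemma sum_pow_prime (R : comPzRingType) (I : finType) (x : I -> R) :
  (\sum_i x i) ^+ p = \sum_i x i ^+ p +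
    osum (@rotf I) (@nonconst I) (fun t => \prod_k x (t k)) *+ p.
Proof.
have -> : (\sum_i x i) ^+ p = \prod_(k < p) \sum_i x i by rewrite prodr_const card_ord.
rewrite bigA_distr_bigA (bigID (@nonconst I)) /= addrC; congr (_ + _); last first.
  rewrite -(sum_osum p_pr (@rotf_rotates I) (@rotf_free I)) // => t _.
  rewrite [RHS](reindex_inj (@ordS_inj p)) /=; apply: eq_bigr => k _.
  by rewrite ffunE.
pose o := Ordinal (prime_gt0 p_pr).
rewrite (reindex_onto (fun i => [ffun=> i]) (fun t : {ffun 'I_p -> I} => t o)) /=; last first.
  by move=> t /nonconstPn h; apply/ffunP => k; rewrite ffunE.
apply: eq_big => [i|i _].
  by rewrite ffunE eqxx andbT; apply/nonconstPn => k k'; rewrite !ffunE.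
rewrite -[X in _ = _ ^+ X]card_ord -prodr_const; apply: eq_bigr => k _.
by rewrite ffunE.
Qed.

End Rotation.

(** * The derivation [i] |-> ([i] ^+ p - [i]) / p *)

Section Derivation.
Variables (L : signature) (F : structure L -> Prop).
Hypothesis HF : fraisse_class F.
Variables (p : nat) (p_pr : prime p).
Hypothesis autF : forall X, F X -> ~~ (p %| #|automorphisms X|)%N.
Local Notation rpat := (rpat HF).

Let o : 'I_p := Ordinal (prime_gt0 p_pr).

Section Rot.
Variables W W2 : finType.
Local Notation U := (W + 'I_p * W2)%type.

Definition rotw (w : U) : U :=
  match w with inl w => inl w | inr (i, y) => inr (ordS i, y) end.

Definition rot (l : rpat U) : rpat U := pullr rotw l.

Lemma iter_rotw_inl n w : iter n rotw (inl w) = inl w.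
Proof. by elim: n => //= n ->. Qed.

Lemma iter_rotw_inr n i y : iter n rotw (inr (i, y)) = inr (iter n (@ordS p) i, y).
Proof. by elim: n => //= n ->. Qed.

Lemma iter_rot n l : iter n rot l = pullr (iter n rotw) l.
Proof.
elim: n => [|n IH] /=; first by rewrite pullr_rel_id // => w; apply: rel_ofxx.
rewrite IH /rot pullr_comp; apply: eq_pullr => w /=.
by rewrite -iterSr.
Qed.

Lemma iter_rotw_p w : iter p rotw w = w.
Proof.
by case: w => [w|[i y]]; rewrite ?iter_rotw_inl ?iter_rotw_inr ?iter_ordS_p.
Qed.

Lemma rot_rotates : rotates p rot.
Proof.
move=> l; rewrite iter_rot pullr_rel_id // => w.
by rewrite iter_rotw_p; apply: rel_ofxx.
Qed.

Lemma rotw_onto w : exists w', rotw w' = w.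
Proof.
exists (iter p.-1 rotw w); rewrite -[RHS]iter_rotw_p.
by rewrite -iterS prednK ?prime_gt0.
Qed.

Definition constp (l : rpat U) : bool :=
  [forall y, forall k, forall k', rel_of l (inr (k, y)) (inr (k', y))].

Lemma constpP l :
  reflect (forall y k k', rel_of l (inr (k, y)) (inr (k', y))) (constp l).
Proof.
apply: (iffP forallP) => h y; first by move=> k k'; have /forallP/(_ k)/forallP := h y.
by apply/forallP => k; apply/forallP => k'.
Qed.

Lemma constp_ordS l :
  (forall y k, rel_of l (inr (k, y)) (inr (ordS k, y))) -> constp l.
Proof.
move=> h; apply/constpP => y k k'; have [n ->] := iter_ordS_onto k k'.
elim: n => [|n IH]; first exact: rel_ofxx.
exact: rel_of_trans IH (h _ _).
Qed.

(* A pattern fixed by the rotation carries an automorphism whose [p]-th power is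
   the identity; as [p] does not divide the number of automorphisms, it is trivial. *)
Lemma rot_fixed_constp l : rot l = l -> constp l.
Proof.
move=> rl; have [V [q [FV ql qS]]] := rpat_onto l.
have [||f [_ fq]] := @pattern_iso L U V V q (q \o rotw) qS.
- move=> v; have [w <-] := qS v; have [w' <-] := rotw_onto w.
  by exists w'.
- by rewrite -pull_comp ql -val_pullr -/(rot l) rl.
have fqn n w : iter n f (q w) = q (iter n rotw w) by elim: n => //= n ->; rewrite fq.
have [fid|nfid] := pselect (forall v, f v = v).
  apply: constp_ordS => y k.
  by rewrite /rel_of -ql /=; apply/eqP; rewrite -[LHS]fid fq.
have /negP[] := autF FV; apply: prime_dvd_automorphisms p_pr (embP f) _ nfid.
by move=> v; have [w <-] := qS v; rewrite fqn iter_rotw_p.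
Qed.

Lemma constp_rot l : constp (rot l) = constp l.
Proof.
apply/constpP/constpP => h y k k'; last by rewrite rel_of_pullr; apply: h.
have := h y (iter p.-1 (@ordS p) k) (iter p.-1 (@ordS p) k').
by rewrite rel_of_pullr /= -!iterS prednK ?prime_gt0 // !iter_ordS_p.
Qed.

Lemma mu_rot (X : structure L) (FX : F X) (e : X -> W) (l : rpat U) :
  pullr (inl \o e) l = srpat HF FX -> mu FX (inl \o e) (rot l) = mu FX (inl \o e) l.
Proof.
move=> el; apply/esym/mu_pull => // [w|x]; last exact: rel_ofxx.
by have [w' <-] := rotw_onto w; exists w'; apply: rel_ofxx.
Qed.

Variables (A : structure L) (f : A -> W) (f2 : A -> W2) (k : rpat W) (b : rpat W2).

Definition ncp (l : rpat U) : bool :=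
  powglued (fun=> f) f2 k (fun=> b) l && ~~ constp l.

Lemma powglued_rot l :
  powglued (fun=> f) f2 k (fun=> b) l -> powglued (fun=> f) f2 k (fun=> b) (rot l).
Proof.
move=> /powgluedP[lk lb lf]; apply/powgluedP; split=> [|i|i a].
- by rewrite /rot pullr_comp -lk.
- by rewrite /rot pullr_comp -(lb (ordS i)).
- by rewrite rel_of_pullr; apply: lf.
Qed.

Lemma ncp_rot l : ncp l -> ncp (rot l).
Proof. by move=> /andP[gl cl]; rewrite /ncp powglued_rot // constp_rot. Qed.

Lemma ncp_free : acts_freely rot ncp.
Proof.
move=> l nl; split; first exact: ncp_rot.
case/andP: nl => _ ncl; apply/eqP => e; case/negP: ncl.
exact: (rot_fixed_constp e).
Qed.

End Rot.

Lemma osum_mu_transfer (X : structure L) (FX : F X) (W W2 W' W2' : finType)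
    (h : W' + 'I_p * W2' -> W + 'I_p * W2) (h' : W + 'I_p * W2 -> W' + 'I_p * W2')
    (e : X -> W) (e' : X -> W')
    (P : pred (rpat (W + 'I_p * W2)%type)) (P' : pred (rpat (W' + 'I_p * W2')%type)) :
  acts_freely (@rot W' W2') P' -> (forall l, P l -> P (rot l)) ->
  (forall l, P l -> [/\ P' (pullr h l), forall w, rel_of l (h (h' w)) w,
      forall x, rel_of l (inl (e x)) (h (inl (e' x))), pullr (inl \o e) l = srpat HF FX
      & forall w, rel_of l (h (rotw w)) (rotw (h w))]) ->
  (forall l, P' l -> P (pullr h' l) /\ forall w, rel_of l (h' (h w)) w) ->
  osum (@rot W W2) P (mu FX (inl \o e)) = osum (@rot W' W2') P' (mu FX (inl \o e')).
Proof.
move=> fr st PP PP'.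
apply: (@osum_bij p p_pr _ _ _ _ _ _ _ (pullr h) (pullr h')) => //.
- exact: rot_rotates.
- exact: rot_rotates.
- move=> l Pl; have [P'l hw he ex hr] := PP l Pl; split=> //.
  + by rewrite pullr_comp; apply: pullr_rel_id.
  + rewrite /rot !pullr_comp; apply/esym/eq_pullr_rel => w /=; exact: hr.
  + apply: mu_pull => // w; exists (h' w); by rewrite rel_of_sym.
  + exact: st.
- move=> l P'l; have [Pl hw] := PP' l P'l; split=> //.
  by rewrite pullr_comp; apply: pullr_rel_id.
- by move=> l /PP[_ _ _ ex _]; apply: mu_rot.
Qed.

(* By [mu_glue_pow], the power [mu FA f2 b ^+ p] is a sum over the patterns of [p] copies of
   [W2] glued along [A]. The cyclic group permutes the copies, freely on the patterns that do
   not identify all of them; [pderiv] sums over these orbits. *)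
Definition pderiv (A : structure L) (FA : F A) (W2 : finType) (f2 : A -> W2) (b : rpat W2) :
    Theta F :=
  osum (@rot A W2) (ncp id f2 (srpat HF FA) b) (mu FA inl).

Lemma ncp_base (A : structure L) (FA : F A) (W2 : finType) (B : structure L) (f : B -> A)
    (f2 : B -> W2) (b : rpat W2) l : ncp f f2 (srpat HF FA) b l -> pullr inl l = srpat HF FA.
Proof. by move=> /andP[/powgluedP[]]. Qed.

Lemma mu_inl_rot (A : structure L) (FA : F A) (W2 : finType) (l : rpat (A + 'I_p * W2)%type) :
  pullr inl l = srpat HF FA -> mu FA inl (rot l) = mu FA inl l.
Proof. exact: (@mu_rot A W2 A FA id). Qed.

Lemma mu_id (A : structure L) (FA : F A) : mu FA id (srpat HF FA) = 1.
Proof.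
have idE : is_embedding (id : A -> A).
  by apply/embedding_pull; rewrite pull_id.
rewrite (_ : id = Embedding idE) // mu_srpat bracket_iso //.
by exists id.
Qed.

Lemma pullr_id (W : finType) (k : rpat W) : pullr id k = k.
Proof. by apply: pullr_rel_id => w; apply: rel_ofxx. Qed.

(** In the expansion by [mu_glue_pow], the patterns that identify all copies are those of a single
    copy and give [mu FA f2 b]; the others form free orbits. *)
Lemma pderiv_pow (A : structure L) (FA : F A) (W2 : finType) (f2 : A -> W2) (b : rpat W2) :
  pullr f2 b = srpat HF FA ->
  mu FA f2 b ^+ p = mu FA f2 b + pderiv FA f2 b *+ p.
Proof.
move=> f2b.
have := @mu_glue_pow L F HF A A FA FA p A W2 id (fun=> id) f2 (srpat HF FA) (fun=> b).
rewrite mu_id mul1r prodr_const card_ord => -> //; try by rewrite ?pullr_id // => _; rewrite pullr_id.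
rewrite (bigID (@constp A W2)) /=; congr (_ + _); last first.
  rewrite -(sum_osum p_pr (@rot_rotates _ _) (@ncp_free _ _ _ _ _ _ _)); first exact: eq_bigr.
  by move=> l nl; apply: mu_inl_rot (ncp_base nl).
have -> : mu FA f2 b = \sum_(l | l == b) mu FA f2 l by rewrite (big_pred1 b).
apply: (@sum_mu_transfer L F HF A FA _ _ (fun y => inr (o, y))
  (fun w => match w with inl a => f2 a | inr (_, y) => y end)).
  move=> l /andP[/powgluedP[lk lb lf] /constpP lc]; split.
  - exact/eqP/lb.
  - case=> [a|[i y]]; last exact: lc.
    by rewrite rel_of_sym; apply: lf.
  - by move=> x; apply: lf.
  - exact: lk.
move=> l /eqP ->; split; last by move=> w; apply: rel_ofxx.
apply/andP; split; last by apply/constpP => y k k'; apply: rel_ofxx.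
apply/powgluedP; split.
- by rewrite pullr_comp -f2b.
- by move=> i; rewrite pullr_comp pullr_id.
- by move=> i a; apply: rel_ofxx.
Qed.

Lemma pderiv_iso (X Y : structure L) (FX : F X) (FY : F Y) (i : embedding X Y) :
  bijective i -> pderiv FX i (srpat HF FY) = 0.
Proof.
move=> [i' iK i'K]; rewrite /pderiv /osum big_pred0 // => l.
apply/negP => /andP[/andP[/powgluedP[_ _ lf] /negP ncl] _]; apply: ncl.
apply/constpP => y k k'; rewrite -[y]i'K.
by apply: (rel_of_trans (y := inl (i' y))); first rewrite rel_of_sym; apply: lf.
Qed.

(** Patterns of [p] copies of [Z] over [X] are sorted by whether the copies of [Y] inside them all
    coincide. *)
Lemma pderiv_comp (X Y Z : structure L) (FX : F X) (FY : F Y) (FZ : F Z)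
    (i : embedding X Y) (j : embedding Y Z) :
  pderiv FX (emb_comp j i) (srpat HF FZ) =
    pderiv FY j (srpat HF FZ) * bracket FX FY i +
    bracket FY FZ j ^+ p * pderiv FX i (srpat HF FY).
Proof.
pose hY (w : X + 'I_p * Y) : X + 'I_p * Z :=
  match w with inl x => inl x | inr (k, y) => inr (k, j y) end.
have hY_rot l : pullr hY (rot l) = rot (pullr hY l).
  by rewrite /rot !pullr_comp; apply: eq_pullr => -[x|[k y]].
rewrite /pderiv (osum_split _ _ (fun l => constp (pullr hY l))); congr (_ + _).
  (* If the copies of [Y] coincide, they form a single [Y], which becomes the new base. *)
  pose h (w : Y + 'I_p * Z) : X + 'I_p * Z :=
    match w with inl y => inr (o, j y) | inr (k, z) => inr (k, z) end.
  pose h' (w : X + 'I_p * Z) : Y + 'I_p * Z :=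
    match w with inl x => inl (i x) | inr (k, z) => inr (k, z) end.
  rewrite mulrC /osum mulr_sumr -/(osum _ _ _).
  transitivity (osum (@rot Y Z) (ncp id j (srpat HF FY) (srpat HF FZ)) (mu FX (inl \o i))).
    apply: (@osum_mu_transfer X FX X Z Y Z h h' id i).
    - exact: ncp_free.
    - by move=> l /andP[nl cl]; rewrite /= ncp_rot // hY_rot constp_rot.
    - move=> l /andP[/andP[/powgluedP[lk lb lf] ncl] /constpP cl].
      have lc y k k' : rel_of l (inr (k, j y)) (inr (k', j y)) := cl y k k'.
      split.
      + apply/andP; split; last first.
          apply: contra ncl => /constpP hc; apply/constpP => z k k'.
          by have := hc z k k'.
        apply/powgluedP; split.
        * by rewrite pullr_comp -(pullr_embedding HF FY FZ j) -(lb o) pullr_comp.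
        * by move=> k; rewrite pullr_comp -(lb k).
        * by move=> k y; apply: lc.
      + move=> [x|[k z]] /=; last exact: rel_ofxx.
        by rewrite rel_of_sym; apply: lf.
      + by move=> x; apply: lf.
      + exact: lk.
      + by move=> [y|[k z]] /=; [apply: lc | apply: rel_ofxx].
    - move=> l /andP[/powgluedP[lk lb lf] ncl]; split; last first.
        move=> [y|[k z]] /=; last exact: rel_ofxx.
        by rewrite rel_of_sym; apply: lf.
      apply/andP; split; first (apply/andP; split).
      + apply/powgluedP; split.
        * by rewrite pullr_comp -(pullr_embedding HF FX FY i) -lk pullr_comp.
        * by move=> k; rewrite pullr_comp -(lb k).
        * by move=> k x; apply: lf.
      + apply: contra ncl => /constpP hc; apply/constpP => z k k'.
        by have := hc z k k'.
      + apply/constpP => y k k'; rewrite !rel_of_pullr /=.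
        by apply: (rel_of_trans (y := inl y)); first rewrite rel_of_sym; apply: lf.
  apply: eq_bigr => l /andP[nl _]; rewrite mulrC; apply: mu_comp.
  exact: ncp_base nl.
(* If they do not, the pattern lies over a free orbit of patterns of [p] copies of [Y]; gluing one
   [Z] to each copy contributes the factor [[j] ^ p]. *)
rewrite (@osum_fiber p p_pr _ _ _ _ (@rot_rotates _ _) (@rot_rotates _ _) _
  (ncp id i (srpat HF FX) (srpat HF FY)) (pullr hY) (@ncp_free _ _ _ _ _ _ _)).
- rewrite /osum mulr_sumr; apply: eq_bigr => k /andP[/andP[/powgluedP[kX kY kf] nck] _].
  rewrite mulrC.
  have kYj : pullr j (srpat HF FZ) = srpat HF FY by rewrite (pullr_embedding HF FY FZ).
  have := @mu_glue_pow L F HF X Y FX FY p (X + 'I_p * Y)%type Z inl (fun k y => inr (k, y))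
    j k (fun=> srpat HF FZ) kX kY (fun=> kYj).
  rewrite prodr_const card_ord mu_srpat => ->; apply/esym.
  pose h (w : X + 'I_p * Z) : (X + 'I_p * Y) + 'I_p * Z :=
    match w with inl x => inl (inl x) | inr z => inr z end.
  pose h' (w : (X + 'I_p * Y) + 'I_p * Z) : X + 'I_p * Z :=
    match w with inl w => hY w | inr z => inr z end.
  apply: (@sum_mu_transfer L F HF X FX _ _ h h').
    move=> l /powgluedP[lk lb lf].
    have hh' w : rel_of l (h (h' w)) w.
      case: w => [[x|[n y]]|w] /=; try exact: rel_ofxx.
      by rewrite rel_of_sym; apply: lf.
    split=> //.
    + have e : pullr hY (pullr h l) = k.
        rewrite -lk pullr_comp; apply: eq_pullr_rel => w.
        exact: (hh' (inl w)).
      rewrite /= e eqxx nck !andbT; apply/andP; split; last first.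
        apply: contra nck => /constpP hc; rewrite -e; apply/constpP => y n n'.
        exact: (hc (j y) n n').
      apply/powgluedP; split.
      * by rewrite -kX -lk !pullr_comp.
      * by move=> n; rewrite pullr_comp -(lb n).
      * move=> n x; rewrite rel_of_pullr /=.
        apply: (rel_of_trans (y := inl (inr (n, i x)))); last exact: lf.
        by rewrite -(rel_of_pullr inl) lk; apply: kf.
    + by move=> x; apply: rel_ofxx.
    + by rewrite -pullr_comp lk.
  move=> l /andP[/andP[/andP[/powgluedP[lk lb lf] ncl] cl] /eqP lk'].
  split; last by move=> [x|[n z]]; apply: rel_ofxx.
  apply/powgluedP; split.
  + by rewrite pullr_comp -lk'.
  + by move=> n; rewrite pullr_comp -(lb n).
  + by move=> n y; apply: rel_ofxx.
- move=> l /andP[/andP[/powgluedP[lk lb lf] ncl] cl]; apply/andP; split=> //.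
  apply/powgluedP; split.
  + by rewrite pullr_comp -lk.
  + by move=> n; rewrite pullr_comp -(pullr_embedding HF FY FZ j) -(lb n) pullr_comp.
  + by move=> n x; apply: lf.
- by move=> l _.
- by move=> l /andP[nl cl]; rewrite /= ncp_rot // hY_rot constp_rot.
- by move=> l /andP[nl _]; apply: mu_inl_rot (ncp_base nl).
Qed.

End Derivation.

(** * The derivation and the amalgamation relation *)

Section Amalgam.
Variables (L : signature) (F : structure L -> Prop).
Hypothesis HF : fraisse_class F.
Variables (p : nat) (p_pr : prime p).
Hypothesis autF : forall X, F X -> ~~ (p %| #|automorphisms X|)%N.
Local Notation rpat := (rpat HF).
Local Notation ncp := (@ncp L F HF p _ _ _).

Variables (X Y X' : structure L) (FX : F X) (FY : F Y) (FX' : F X').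
Variables (i : embedding X Y) (j : embedding X X').
Variables (s : nat) (a : 'I_s -> amalgam F i j).
Hypothesis aP : representatives (fun=> True) (@amalgam_iso L F X Y X' i j) a.

Let o : 'I_p := Ordinal (prime_gt0 p_pr).
Local Notation U := (X' + 'I_p * Y)%type.
Local Notation S := (ncp j i (srpat HF FX') (srpat HF FY)).

(** [mu_glue] replaces each pattern over [X] by its amalgams with [X']. These are patterns over
    [X'], and whether the copies of [Y] all coincide is not affected. *)
Lemma pderiv_base_change :
  pderiv p FX i (srpat HF FY) = osum (@rot _ _ HF p _ _) S (mu FX' inl).
Proof.
pose hX (w : X + 'I_p * Y) : U := match w with inl x => inl (j x) | inr w => inr w end.
have hX_rot l : pullr hX (rot l) = rot (pullr hX l).
  by rewrite /rot !pullr_comp; apply: eq_pullr => -[x|[k y]].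
rewrite (@osum_fiber p p_pr _ _ _ _ (@rot_rotates L F HF p _ _) (@rot_rotates L F HF p _ _) _
  (ncp id i (srpat HF FX) (srpat HF FY)) (pullr hX) (@ncp_free L F HF p p_pr autF _ _ _ _ _ _ _)).
- apply: eq_bigr => k /andP[/andP[/powgluedP[kX kY kf] nck] _].
  have jX : pullr j (srpat HF FX') = srpat HF FX by rewrite (pullr_embedding HF FX FX').
  have := @mu_glue L F HF X' X FX' FX X' (X + 'I_p * Y)%type id j inl (srpat HF FX') k
    (pullr_id _) jX kX.
  rewrite mu_id mul1r => ->.
  pose h (w : U) : X' + (X + 'I_p * Y) :=
    match w with inl x => inl x | inr w => inr (inr w) end.
  pose h' (w : X' + (X + 'I_p * Y)) : U :=
    match w with inl x => inl x | inr w => hX w end.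
  apply: (@sum_mu_transfer L F HF X' FX' _ _ h h').
    move=> l /gluedP[lX lk lf].
    have hh' w : rel_of l (h (h' w)) w.
      by case: w => [x|[x|w]] /=; rewrite ?rel_ofxx //; apply: lf.
    have e : pullr hX (pullr h l) = k.
      rewrite -lk pullr_comp; apply: eq_pullr_rel => w; exact: (hh' (inr w)).
    split=> //; last by move=> x; apply: rel_ofxx.
    rewrite /= e eqxx andbT; apply/andP; split; last first.
      apply: contra nck => /constpP hc; rewrite -e; apply/constpP => y n n'.
      exact: (hc y n n').
    apply/powgluedP; split.
    - by rewrite pullr_comp.
    - by move=> n; rewrite -(kY n) -lk !pullr_comp.
    - move=> n x; rewrite rel_of_pullr /=.
      apply: rel_of_trans (lf x) _.
      by rewrite -(rel_of_pullr inr) lk; apply: kf.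
  move=> l /andP[/andP[/powgluedP[lX lY lf] ncl] /eqP lk]; split; last first.
    by move=> [x|w]; apply: rel_ofxx.
  apply/gluedP; split.
  + by rewrite pullr_comp.
  + by rewrite pullr_comp -lk.
  + by move=> x; apply: rel_ofxx.
- move=> l /andP[/powgluedP[lX lY lf] ncl]; apply/andP; split; last first.
    apply: contra ncl => /constpP hc; apply/constpP => y n n'; exact: (hc y n n').
  apply/powgluedP; split.
  + by rewrite -(pullr_embedding HF FX FX' j) -lX !pullr_comp.
  + by move=> n; rewrite pullr_comp -(lY n).
  + by move=> n x; apply: lf.
- by move=> l _; apply: hX_rot.
- exact: ncp_rot.
- by move=> l nl; apply: mu_inl_rot (ncp_base nl).
Qed.

Let rj : realizes j (srpat HF FX') id j.
Proof. by split=> [|v|//]; [rewrite val_srpat pull_id | exists v]. Qed.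

Let rj2 : realizes i (srpat HF FY) id i.
Proof. by split=> [|v|//]; [rewrite val_srpat pull_id | exists v]. Qed.

Let amap n := @am_map L F X X' Y X' Y id id j i (a n).
Let alpha n := @am_pat L F HF X X' Y X' Y id id j i (a n).

Lemma rel_alpha n w w' : rel_of (alpha n) w w' = (amap n w == amap n w').
Proof. by []. Qed.

Lemma alpha_inj : injective alpha.
Proof. by move=> n n' /(am_pat_iso rj rj2); case: aP => _ h _; apply: h. Qed.

Lemma alpha_glued n : glued j i (srpat HF FX') (srpat HF FY) (alpha n).
Proof. exact: am_pat_glued rj rj2 _. Qed.

Lemma alpha_onto l : glued j i (srpat HF FX') (srpat HF FY) l -> exists n, alpha n = l.
Proof.
move=> /(am_pat_surj rj rj2)[b <-]; have [_ _ h] := aP.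
by have [n bn] := h b I; exists n; apply/esym/(am_pat_iso rj rj2).
Qed.

Lemma mu_alpha n : mu FX' inl (alpha n) = bracket FX' (am_objF (a n)) (am_i (a n)).
Proof.
apply: (@mu_realizes _ _ _ _ _ _ _ _ _ _ (amap n)); split=> //.
exact: am_map_onto rj rj2 _.
Qed.

Let tau (n : 'I_p) (w : X' + Y) : U := match w with inl x => inl x | inr y => inr (n, y) end.
(** Records which amalgam with [X'] each of the [p] copies of [Y] forms. *)
Let ty (l : rpat U) : {ffun 'I_p -> rpat (X' + Y)%type} := [ffun n => pullr (tau n) l].

Lemma rotw_tau n w : rotw (tau n w) = tau (ordS n) w.
Proof. by case: w. Qed.

Lemma ty_rot l : ty (rot l) = rotf (ty l).
Proof.
apply/ffunP => n; rewrite !ffunE /rot pullr_comp; apply: eq_pullr => w.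
exact: rotw_tau.
Qed.

Lemma ty_constp l : constp l -> ~~ nonconst (ty l).
Proof.
move=> /constpP cl; apply/nonconstPn => n n'; rewrite !ffunE.
by apply: eq_pullr_rel => -[x|y] /=; [apply: rel_ofxx | apply: cl].
Qed.

Lemma ty_glued l n : powglued (fun=> j : X -> X') i (srpat HF FX') (fun=> srpat HF FY) l ->
  glued j i (srpat HF FX') (srpat HF FY) (ty l n).
Proof.
move=> /powgluedP[lX lY lf]; rewrite ffunE; apply/gluedP; split.
- by rewrite pullr_comp -lX.
- by rewrite pullr_comp -(lY n).
- by move=> x; apply: lf.
Qed.

Let Sm (m : 'I_s) : pred (rpat U) := fun l => S l && [forall n, ty l n == alpha m].

(** When every copy of [Y] forms the amalgam [a m] with [X'], gluing [p] copies of [Y] amounts to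
    gluing [p] copies of that amalgam along [X']. *)
Lemma osum_Sm m : osum (@rot _ _ HF p _ _) (Sm m) (mu FX' inl) =
  pderiv p FX' (am_i (a m)) (srpat HF (am_objF (a m))).
Proof.
set V := am_obj (a m); set FV := am_objF (a m).
have aS v : exists w, amap m w = v := am_map_onto rj rj2 v.
pose r v := projT1 (cid (aS v)).
have rK v : amap m (r v) = v by rewrite /r; case: cid.
pose h (w : X' + 'I_p * V) : U := match w with inl x => inl x | inr (n, v) => tau n (r v) end.
pose h' (w : U) : X' + 'I_p * V :=
  match w with inl x => inl x | inr (n, y) => inr (n, amap m (inr y)) end.
apply: (@osum_mu_transfer _ _ HF p p_pr X' FX' X' Y X' V h h' id id).
- exact: ncp_free.
- move=> l /andP[nl /forallP tl]; rewrite /Sm ncp_rot //=; apply/forallP => n.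
  by rewrite ty_rot ffunE.
- move=> l /andP[/andP[/powgluedP[lX lY lf] ncl] /forallP tl].
  have tE n : pullr (tau n) l = alpha m by have /eqP <- := tl n; rewrite ffunE.
  have ta n w : rel_of l (tau n (r (amap m w))) (tau n w).
    by rewrite -(rel_of_pullr (tau n)) tE rel_alpha rK.
  split.
  + apply/andP; split; last first.
      apply: contra ncl => /constpP hc; apply/constpP => y n n'.
      have := hc (amap m (inr y)) n n'; rewrite rel_of_pullr /= => hr.
      apply: rel_of_trans (rel_of_trans _ hr) (ta n' (inr y)).
      by rewrite rel_of_sym; apply: (ta n (inr y)).
    apply/powgluedP; split.
    * by rewrite pullr_comp.
    * move=> n; rewrite pullr_comp.
      transitivity (pullr r (alpha m)); first by rewrite -(tE n) pullr_comp.
      apply: val_inj; rewrite val_pullr /= pull_comp -[RHS]pull_id.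
      exact: eq_pull.
    * move=> n x; rewrite rel_of_pullr /= rel_of_sym; exact: (ta n (inl x)).
  + by move=> [x|[n y]] /=; [apply: rel_ofxx | apply: (ta n (inr y))].
  + by move=> x; apply: rel_ofxx.
  + exact: lX.
  + by move=> [x|[n v]] /=; rewrite ?rotw_tau rel_ofxx.
- move=> l /andP[/powgluedP[lX lV lf] ncl].
  have tl n w : rel_of l (h' (tau n w)) (inr (n, amap m w)).
    by case: w => [x|y] /=; [apply: lf | apply: rel_ofxx].
  split; last first.
    by move=> [x|[n v]] /=; [apply: rel_ofxx | rewrite -{2}(rK v); apply: tl].
  apply/andP; split; first (apply/andP; split).
  + apply/powgluedP; split.
    * by rewrite pullr_comp.
    * move=> n; rewrite pullr_comp -(pullr_embedding HF FY FV (am_j (a m))) -(lV n).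
      by rewrite pullr_comp.
    * move=> n x; rewrite rel_of_pullr /= -am_comm; exact: lf.
  + apply: contra ncl => /constpP hc; apply/constpP => v n n'.
    have [[x|y] <-] := aS v; last exact: (hc y n n').
    by apply: (rel_of_trans (y := inl x)); first rewrite rel_of_sym; apply: lf.
  + apply/forallP => n; rewrite ffunE pullr_comp; apply/eqP.
    transitivity (pullr (amap m) (srpat HF FV)).
      by rewrite -(lV n) pullr_comp; apply: eq_pullr_rel => w; apply: tl.
    exact: val_inj.
Qed.

Let S' (t : {ffun 'I_p -> rpat (X' + Y)%type}) : bool :=
  nonconst t && [forall n, glued j i (srpat HF FX') (srpat HF FY) (t n)].

Lemma S'_free : acts_freely (@rotf p _) S'.
Proof.
move=> t /andP[nt /forallP gt]; have [nt' ft] := rotf_free p_pr nt; split=> //.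
by rewrite /S' nt' /=; apply/forallP => n; rewrite ffunE.
Qed.

Lemma sum_ty_fiber t : S' t ->
  \sum_(l | S l && nonconst (ty l) && (ty l == t)) mu FX' inl l =
  \prod_n mu FX' inl (t n).
Proof.
move=> /andP[nt /forallP gt].
have tX n : pullr inl (t n) = srpat HF FX' by have /gluedP[] := gt n.
have := @mu_glue_pow L F HF X' X' FX' FX' p X' (X' + Y)%type id (fun=> id) inl
  (srpat HF FX') t (pullr_id _) (fun=> pullr_id _) tX.
rewrite mu_id mul1r => ->; apply/esym.
pose h (w : U) : X' + 'I_p * (X' + Y) :=
  match w with inl x => inl x | inr (n, y) => inr (n, inr y) end.
pose h' (w : X' + 'I_p * (X' + Y)) : U :=
  match w with inl x => inl x | inr (n, w) => tau n w end.
apply: (@sum_mu_transfer L F HF X' FX' _ _ h h').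
  move=> l /powgluedP[lX lt lf].
  have hh' w : rel_of l (h (h' w)) w.
    by case: w => [x|[n [x|y]]] /=; rewrite ?rel_ofxx //; apply: lf.
  have e : ty (pullr h l) = t.
    apply/ffunP => n; rewrite ffunE pullr_comp -lt; apply: eq_pullr_rel => w.
    exact: (hh' (inr (n, w))).
  split=> //; last by move=> x; apply: rel_ofxx.
  rewrite e eqxx nt !andbT; apply/andP; split; last first.
    by apply: contraL nt; rewrite -e; apply: ty_constp.
  apply/powgluedP; split.
  - by rewrite pullr_comp.
  - move=> n; have /gluedP[_ <- _] := gt n.
    by rewrite -lt !pullr_comp.
  - move=> n x; rewrite rel_of_pullr /=; apply: rel_of_trans (lf n (j x)) _.
    rewrite -(rel_of_pullr (fun y => inr (n, y))) lt.
    by have /gluedP[_ _ tf] := gt n; apply: tf.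
move=> l /andP[/andP[/andP[/powgluedP[lX lY lf] ncl] _] /eqP tl].
split; last by move=> [x|[n y]]; apply: rel_ofxx.
apply/powgluedP; split.
- by rewrite pullr_comp.
- by move=> n; rewrite pullr_comp -tl ffunE.
- by move=> n x; apply: rel_ofxx.
Qed.

(** Patterns are sorted by [ty]: constant types reassemble into [pderiv] of one amalgam, nonconstant
    ones give the cross terms in the [p]-th power of a sum. *)
Lemma pderiv_amalgam :
  pderiv p FX i (srpat HF FY) =
  \sum_(n < s) pderiv p FX' (am_i (a n)) (srpat HF (am_objF (a n))) +
  osum (@rotf p 'I_s) (@nonconst p 'I_s)
    (fun t => \prod_n bracket FX' (am_objF (a (t n))) (am_i (a (t n)))).
Proof.
rewrite pderiv_base_change (osum_split _ _ (fun l => nonconst (ty l))) addrC.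
congr (_ + _).
  transitivity (\sum_(n < s) osum (@rot _ _ HF p _ _) (Sm n) (mu FX' inl)); last first.
    by apply: eq_bigr => n _; rewrite osum_Sm.
  rewrite /osum (exchange_big_dep (fun l => S l && ~~ nonconst (ty l) && (froot (@rot _ _ HF p _ _) l == l))) /=.
    apply: eq_bigr => l /andP[/andP[/andP[gl ncl] /nonconstPn tl] rl].
    have [m ml] := alpha_onto (ty_glued o gl).
    rewrite (big_pred1 m) // => m' /=; rewrite rl andbT /Sm /ncp gl ncl /=.
    apply/forallP/eqP => [h|-> n]; last by rewrite ml (tl n o).
    by apply: alpha_inj; rewrite ml; have /eqP -> := h o.
  move=> m l _ /andP[/andP[nl /forallP tl] ->]; rewrite nl andbT /=.
  by apply/nonconstPn => n n'; have /eqP -> := tl n; have /eqP -> := tl n'.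
rewrite (@osum_fiber p p_pr _ _ _ _ (@rot_rotates L F HF p _ _) (@rotf_rotates p _) _ S' ty S'_free).
- transitivity (osum (@rotf p _) S' (fun t => \prod_n mu FX' inl (t n))).
    by apply: osum_eq => // t; apply: sum_ty_fiber.
  apply/esym.
  pose g (t : {ffun 'I_p -> 'I_s}) : {ffun 'I_p -> rpat (X' + Y)%type} := [ffun n => alpha (t n)].
  rewrite (@osum_fiber p p_pr _ _ _ _ (@rotf_rotates p _) (@rotf_rotates p _) _ S' g S'_free).
  + apply: osum_eq => // t /andP[nt /forallP gt].
    have [u uE] := fin_all_exists (fun n => alpha_onto (gt n)).
    have gE : g [ffun n => u n] = t by apply/ffunP => n; rewrite !ffunE uE.
    rewrite (big_pred1 [ffun n => u n]) => [|v /=].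
      by apply: eq_bigr => n _; rewrite -uE mu_alpha ffunE.
    apply/andP/eqP => [[_ /eqP gv]|->].
      apply/ffunP => n; apply: alpha_inj.
      by rewrite -[LHS](ffunE (fun n => alpha (v n))) -/(g v) gv ffunE uE.
    split; last by rewrite gE.
    apply: contraLR nt => /nonconstPn cu; rewrite -gE; apply/nonconstPn => n n'.
    by rewrite !ffunE; have := cu n n'; rewrite !ffunE => ->.
  + move=> t nt; apply/andP; split.
      apply: contraLR nt => /nonconstPn ct; apply/nonconstPn => n n'.
      by apply: alpha_inj; have := ct n n'; rewrite !ffunE.
    by apply/forallP => n; rewrite ffunE; apply: alpha_glued.
  + by move=> t _; apply/ffunP => n; rewrite !ffunE.
  + by move=> t nt; rewrite nonconst_rotf.
  + move=> t _; rewrite [RHS](reindex_inj (@ordS_inj p)) /=.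
    by apply: eq_bigr => n _; rewrite ffunE.
- move=> l /andP[/andP[gl ncl] nt]; rewrite /S' nt /=; apply/forallP => n.
  exact: ty_glued.
- by move=> l _; apply: ty_rot.
- by move=> l /andP[nl nt]; apply/andP; split; [exact: ncp_rot | rewrite ty_rot nonconst_rotf].
- by move=> l /andP[nl _]; apply: mu_inl_rot (ncp_base nl).
Qed.

End Amalgam.

(** * A ring tactic *)

Section Normalization.
Import BinNums BinInt Ring_theory Ring_polynom InitialRing.
Variable R : comPzRingType.

Lemma cring_theory :
  @ring_theory R 0 1 +%R *%R (fun x y => x - y) -%R eq.
Proof.
split=> //; [exact: add0r | exact: addrC | exact: addrA | exact: mul1r | exact: mulrC
  | exact: mulrA | exact: mulrDl | exact: subrr].
Qed.

Definition cring_eval (l : seq R) (e : PExpr Z) : R :=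
  PEeval 0 1 +%R *%R (fun x y => x - y) -%R (gen_phiZ 0 1 +%R *%R -%R)
    id_phi_N (pow_N 1 *%R) l e.

Definition cring_check (e1 e2 : PExpr Z) : bool :=
  let norm := norm_subst Z0 (Zpos xH) Z.add Z.mul Z.sub Z.opp Z.eqb
    (triv_div Z0 (Zpos xH) Z.eqb) O nil in
  Peq Z.eqb (norm e1) (norm e2).

Lemma cring_correct (l : seq R) (e1 e2 : PExpr Z) :
  cring_check e1 e2 -> cring_eval l e1 = cring_eval l e2.
Proof.
have ext := Eq_ext +%R *%R -%R : ring_eq_ext _ _ _ (@eq R).
have art := Rth_ARth (Eqsth R) ext cring_theory.
have mor := gen_phiZ_morph (Eqsth R) ext cring_theory.
exact: (ring_correct (Eqsth R) ext art mor (pow_N_th _ _ (Eqsth R))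
  (triv_div_th (Eqsth R) ext art mor) O l nil e1 e2 I).
Qed.

(** Hides [n%:R], which is itself [1 *+ n], so that rewriting with [cring_mulrn] terminates and
    numerals become atoms. *)
Definition cring_nat (n : nat) : R := n%:R.

Lemma cring_mulrn (x : R) n : x *+ n = x * cring_nat n.
Proof. by rewrite /cring_nat mulr_natr. Qed.
End Normalization.

(* The library's [ring] is no option here: its universe constraints on the type of rings
   contradict those of [Defs]. *)
Ltac cring_index x l n :=
  match l with
  | cons ?y _ => let _ := match goal with _ => unify x y end in n
  | cons _ ?l => let n := eval cbv in (BinPos.Pos.succ n) in cring_index x l n
  end.

Ltac cring_atoms t l :=
  lazymatch t with
  | @Algebra.add _ ?a ?b => let l := cring_atoms a l in cring_atoms b l
  | @GRing.mul _ ?a ?b => let l := cring_atoms a l in cring_atoms b l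
  | @Algebra.opp _ ?a => cring_atoms a l
  | @GRing.one _ => l
  | @Algebra.zero _ => l
  | _ => match goal with
         | _ => let _ := cring_index t l constr:(BinNums.xH) in l
         | _ => constr:(cons t l)
         end
  end.

Ltac cring_reify t l :=
  lazymatch t with
  | @Algebra.add _ ?a ?b =>
    let a := cring_reify a l in let b := cring_reify b l in
    constr:(@Ring_polynom.PEadd BinNums.Z a b)
  | @GRing.mul _ ?a ?b =>
    let a := cring_reify a l in let b := cring_reify b l in
    constr:(@Ring_polynom.PEmul BinNums.Z a b)
  | @Algebra.opp _ ?a => let a := cring_reify a l in constr:(@Ring_polynom.PEopp BinNums.Z a)
  | @GRing.one _ => constr:(@Ring_polynom.PEI BinNums.Z)
  | @Algebra.zero _ => constr:(@Ring_polynom.PEO BinNums.Z)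
  | _ => let n := cring_index t l constr:(BinNums.xH) in
         constr:(@Ring_polynom.PEX BinNums.Z n)
  end.

Ltac cring R :=
  rewrite ?(@cring_mulrn R) ?expr2;
  lazymatch goal with |- @eq _ ?a ?b =>
    let l := cring_atoms a constr:(@nil R) in
    let l := cring_atoms b l in
    let ea := cring_reify a l in
    let eb := cring_reify b l in
    change (@cring_eval R l ea = @cring_eval R l eb);
    apply: cring_correct; vm_compute; reflexivity
  end.

(** * Torsion in Theta *)

HB.instance Definition _ L (F : structure L -> Prop) := gen_eqMixin (generator F).
HB.instance Definition _ L (F : structure L -> Prop) := gen_choiceMixin (generator F).

Section FreeRing.
Variable I : choiceType.
Local Notation P := {malg int[{cmonom I}]}.

Definition fvar (i : I) : P := << ucm i >>.

Lemma free_torsion (n : nat) (x : P) : (0 < n)%N -> x *+ n = 0 -> x = 0.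
Proof.
move=> n0 xn; apply/malgP => k; rewrite mcoeff0.
have := congr1 (mcoeff k) xn; rewrite mcoeffMn mcoeff0 => /eqP.
by rewrite mulrn_eq0 (gtn_eqF n0) => /eqP.
Qed.

Section Eval.
Variables (S : comNzRingType) (v : I -> S).

Definition eval_monom (m : {cmonom I}) : S := \prod_(i <- finsupp m) v i ^+ m i.

Lemma eval_monomEw (m : {cmonom I}) (d : {fset I}) : (finsupp m `<=` d)%fset ->
  eval_monom m = \prod_(i <- d) v i ^+ m i.
Proof.
move=> le; rewrite /eval_monom (big_fset_incl _ le) // => i _.
by rewrite -cmE_neq0 negbK => /eqP ->.
Qed.

Lemma eval_monom_morphism : mmorphism eval_monom.
Proof.
split; last by rewrite /eval_monom mdom1 big_seq_fset0.
move=> m1 m2; rewrite {1}/eval_monom mdomD.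
rewrite (eval_monomEw (fsubsetUl (finsupp m1) (finsupp m2))).
rewrite (eval_monomEw (fsubsetUr (finsupp m1) (finsupp m2))).
rewrite -big_split /=; apply: eq_bigr => i _.
by rewrite cmM exprD.
Qed.

HB.instance Definition _ := isMultiplicative.Build _ _ eval_monom eval_monom_morphism.

Lemma free_eval : exists f : {rmorphism P -> S}, forall i, f (fvar i) = v i.
Proof.
exists (mmap (intmul 1) eval_monom) => i /=.
rewrite /fvar mmapU mul1r /eval_monom mdomU big_seq_fset1 cmUU.
by rewrite expr1.
Qed.

End Eval.
End FreeRing.

Section TorsionFree.
Variables (L : signature) (F : structure L -> Prop).
Hypothesis HF : fraisse_class F.
Variables (p : nat) (p_pr : prime p).
Hypothesis autF : forall X, F X -> ~~ (p %| #|automorphisms X|)%N.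
Variables (P : comNzRingType) (fvar : generator F -> P).
Hypothesis P_torsion_free : forall (n : nat) (x : P), (0 < n)%N -> x *+ n = 0 -> x = 0.

(** [pderiv] lifted term by term to the variables of the free ring. *)
Definition free_pderiv (g : generator F) : P :=
  osum (@rot L F HF p _ _) (ncp id (gen_emb g) (srpat HF (gen_srcF g)) (srpat HF (gen_dstF g)))
    (fun l => fvar (gen_at (gen_srcF g) inl l)).

Fixpoint free_term (t : rterm (generator F)) : P :=
  match t with
  | rgen g => fvar g
  | rzero => 0
  | rone => 1
  | ropp a => - free_term a
  | radd a b => free_term a + free_term b
  | rmul a b => free_term a * free_term b
  end.

Variables (T : comNzRingType) (c : {rmorphism Theta F -> T}).
Hypothesis c_inj : injective c.
Variables (pi : {rmorphism P -> T}) (phi : {rmorphism P -> P}).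
Hypothesis piE : forall g, pi (fvar g) = c (cls g).
Hypothesis phiE : forall g, phi (fvar g) = fvar g ^+ p - free_pderiv g *+ p.

Lemma pi_term t : pi (free_term t) = c (pclass _ t).
Proof.
elim: t => /= [g|||a IH|a IHa b IHb|a IHa b IHb].
- exact: piE.
- by rewrite rmorph0; apply/esym/(rmorph0 c).
- by rewrite rmorph1; apply/esym/(rmorph1 c).
- by rewrite rmorphN IH -rmorphN pclassN.
- by rewrite rmorphD IHa IHb -rmorphD pclassD.
- by rewrite rmorphM IHa IHb -rmorphM pclassM.
Qed.

Lemma pi_pderiv g : pi (free_pderiv g) =
  c (pderiv p (gen_srcF g) (gen_emb g) (srpat HF (gen_dstF g))).
Proof.
rewrite /free_pderiv /pderiv /osum !rmorph_sum; apply: eq_bigr => l _.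
exact: piE.
Qed.

Lemma cls_bracket (g : generator F) : cls g = bracket (gen_srcF g) (gen_dstF g) (gen_emb g).
Proof. by case: g. Qed.

Lemma pi_phi t : pi (phi (free_term t)) = pi (free_term t).
Proof.
elim: t => /= [g|||a IH|a IHa b IHb|a IHa b IHb].
- rewrite phiE rmorphB rmorphXn rmorphMn /= pi_pderiv piE -rmorphXn -rmorphMn -rmorphB.
  congr (c _); rewrite cls_bracket -(mu_srpat HF) pderiv_pow ?addrK //.
  exact: pullr_embedding.
- by rewrite !rmorph0.
- by rewrite !rmorph1.
- by rewrite !rmorphN IH.
- by rewrite !rmorphD IHa IHb.
- by rewrite !rmorphM IHa IHb.
Qed.

(** [((x + y) ^+ p - x ^+ p - y ^+ p) / p], written without a division. *)
Definition crossterm (x y : P) : P :=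
  osum (@rotf p bool) (@nonconst p bool) (fun t => \prod_k (if t k then x else y)).

Lemma exprD_prime (x y : P) : (x + y) ^+ p = x ^+ p + y ^+ p + crossterm x y *+ p.
Proof.
have := @sum_pow_prime p p_pr P bool (fun b : bool => if b then x else y).
by rewrite !big_bool.
Qed.

Lemma pi_crossterm x y : pi x = 0 -> pi (crossterm x y) = 0.
Proof.
move=> x0; rewrite /crossterm /osum rmorph_sum big1 // => t /andP[nt _].
rewrite rmorph_prod; have [k tk|nk] := pickP (fun k => t k).
  by rewrite (bigD1 k) //= tk x0 mul0r.
by case/negP: nt; apply/forallP => k; apply/forallP => k'; rewrite !nk.
Qed.

Lemma phi_frob t : exists z, phi (free_term t) = free_term t ^+ p + z *+ p.
Proof.
elim: t => /= [g|||a [u IH]|a [u IHa] b [v IHb]|a [u IHa] b [v IHb]].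
- by exists (- free_pderiv g); rewrite phiE mulNrn.
- by exists 0; rewrite rmorph0 expr0n gtn_eqF ?prime_gt0 // mul0rn addr0.
- by exists 0; rewrite rmorph1 expr1n mul0rn addr0.
- exists (crossterm (- free_term a) (free_term a) - u).
  have := exprD_prime (- free_term a) (free_term a).
  rewrite addNr expr0n gtn_eqF ?prime_gt0 //= => e.
  by rewrite rmorphN IH -[LHS]add0r [X in X + _]e; cring P.
- exists (u + v - crossterm (free_term a) (free_term b)).
  by rewrite rmorphD IHa IHb exprD_prime; cring P.
- exists (u * free_term b ^+ p + free_term a ^+ p * v + u * v *+ p).
  by rewrite rmorphM IHa IHb exprMn; cring P.
Qed.

(* The relations between generators that are compatible with the Frobenius lift [phi]. *)
Definition frob_kernel (x : P) : Prop :=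
  pi x = 0 /\ exists z, pi z = 0 /\ phi x = x ^+ p + z *+ p.

(** [(l - r) ^+ p] and [l ^+ p - r ^+ p] differ by [p] times a cross term divisible by [l - r],
    which [pi] kills. *)
Lemma frob_kernel_sub l r A B :
  phi l = l ^+ p + A *+ p -> phi r = r ^+ p + B *+ p -> pi l = pi r -> pi A = pi B ->
  frob_kernel (l - r).
Proof.
move=> hl hr lr AB; have lr0 : pi (l - r) = 0 by rewrite rmorphB lr subrr.
split=> //; exists (A - B + crossterm (l - r) r); split.
  by rewrite rmorphD pi_crossterm // rmorphB AB subrr addr0.
have := exprD_prime (l - r) r; rewrite subrK => e.
by rewrite rmorphB hl hr e; cring P.
Qed.

Lemma frob_kernelD x y : frob_kernel x -> frob_kernel y -> frob_kernel (x + y).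
Proof.
move=> [x0 [z [z0 hx]]] [y0 [w [w0 hy]]]; split; first by rewrite rmorphD x0 y0 addr0.
exists (z + w - crossterm x y); split.
  by rewrite rmorphB rmorphD z0 w0 pi_crossterm // subr0 addr0.
by rewrite rmorphD hx hy exprD_prime; cring P.
Qed.

Lemma frob_kernelM t x : frob_kernel x -> frob_kernel (free_term t * x).
Proof.
move=> [x0 [z [z0 hx]]]; split; first by rewrite rmorphM x0 mulr0.
have [w hw] := phi_frob t.
exists (w * x ^+ p + free_term t ^+ p * z + w * z *+ p); split.
  rewrite !rmorphD rmorphMn !rmorphM z0 [pi (x ^+ p)]rmorphXn x0 expr0n.
  by rewrite gtn_eqF ?prime_gt0 // !mulr0 mul0rn !addr0.
by rewrite rmorphM hw hx exprMn; cring P.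
Qed.

Lemma frob_kernelN x : frob_kernel x -> frob_kernel (- x).
Proof. by move=> /(frob_kernelM (ropp rone)) /=; rewrite mulN1r. Qed.

Lemma frob_kernel0 : frob_kernel 0.
Proof.
split; first exact: rmorph0.
exists 0; rewrite !rmorph0 expr0n gtn_eqF ?prime_gt0 //.
by rewrite mul0rn addr0.
Qed.

Lemma free_term_sum (J : Type) (r : seq J) (f : J -> rterm (generator F)) :
  free_term (\big[@radd _/rzero]_(k <- r) f k) = \sum_(k <- r) free_term (f k).
Proof. by elim: r => [|k r IH]; rewrite ?big_nil // !big_cons /= IH. Qed.

(** Each rule for [pderiv] handles one kind of relation: it says that the derivatives of the two
    sides, taken in the free ring, agree under [pi]. *)
Lemma frob_kernel_rel a b : theta_rel a b -> frob_kernel (free_term a - free_term b).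
Proof.
move=> ab; have pab : pi (free_term a) = pi (free_term b).
  by rewrite !pi_term; congr (c _); apply/pclassP/rc_rel.
case: ab pab => {a b} [X Y FX FY i bi|X Y Z FX FY FZ i j|X Y X' FX FY FX' i j s a aP] /= pab.
- apply: (@frob_kernel_sub _ _ (- free_pderiv (Generator FX FY i)) 0) => //.
  + by rewrite phiE mulNrn.
  + by rewrite rmorph1 expr1n mul0rn addr0.
  + by rewrite rmorphN pi_pderiv pderiv_iso // !rmorph0 oppr0.
- set gi := Generator FX FY i; set gj := Generator FY FZ j.
  apply: (@frob_kernel_sub _ _ (- free_pderiv (Generator FX FZ (emb_comp j i)))
    (free_pderiv gj * free_pderiv gi *+ p
      - free_pderiv gj * fvar gi ^+ p - fvar gj ^+ p * free_pderiv gi)) => //.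
  + by rewrite phiE mulNrn.
  + by rewrite rmorphM !phiE exprMn; cring P.
  (* The product rule in the free ring has [[i] ^ p - p D(i)] where [pderiv_comp] has [[i]]; by
     [pi_phi] the two agree under [pi]. *)
  + transitivity (- (pi (free_pderiv gj) * (pi (fvar gi ^+ p - free_pderiv gi *+ p)) +
      pi (fvar gj) ^+ p * pi (free_pderiv gi))).
      rewrite -(phiE gi) -[fvar gi]/(free_term (rgen gi)) pi_phi /= !piE !pi_pderiv.
      rewrite rmorphN pi_pderiv -rmorphXn -!rmorphM -rmorphD; congr (- c _).
      exact: pderiv_comp.
    by rewrite -rmorphXn -!rmorphM -rmorphD -rmorphN; congr (pi _); cring P.
- rewrite free_term_sum /=.
  pose g k := Generator FX' (am_objF (a k)) (am_i (a k)).
  apply: (@frob_kernel_sub _ _ (- free_pderiv (Generator FX FY i))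
    (- \sum_k free_pderiv (g k)
     - osum (@rotf p 'I_s) (@nonconst p 'I_s) (fun t => \prod_k fvar (g (t k))))).
  + by rewrite phiE mulNrn.
  + rewrite rmorph_sum sum_pow_prime //.
    rewrite (eq_bigr (fun k => fvar (g k) ^+ p - free_pderiv (g k) *+ p)); last first.
      by move=> k _; apply: phiE.
    by rewrite big_split /= sumrN sumrMnl; cring P.
  + by move: pab; rewrite free_term_sum.
  + rewrite rmorphB !rmorphN pi_pderiv -opprD; congr (- _).
    rewrite (pderiv_amalgam HF p_pr autF FX FY FX' aP) rmorphD; congr (_ + _).
      by rewrite !rmorph_sum; apply: eq_bigr => k _; rewrite pi_pderiv.
    rewrite /osum !rmorph_sum; apply: eq_bigr => t _.
    by rewrite !rmorph_prod; apply: eq_bigr => k _; rewrite piE.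
Qed.

Lemma frob_kernel_rcong a b : rcong (@theta_rel L F) a b -> frob_kernel (free_term a - free_term b).
Proof.
have id0 x y : x = y -> frob_kernel (x - y).
  by move=> ->; rewrite subrr; apply: frob_kernel0.
elim=> {a b} /=; try by move=> *; apply: id0; cring P.
- exact: frob_kernel_rel.
- by move=> a b _ /frob_kernelN; rewrite opprB.
- by move=> a b d _ h1 _ h2; have := frob_kernelD h1 h2; rewrite addrA subrK.
- by move=> a b _ /frob_kernelN; rewrite opprB opprK addrC.
- move=> a b d e _ h1 _ h2; have := frob_kernelD h1 h2.
  by congr frob_kernel; cring P.
- move=> a b d e _ h1 _ h2.
  have := frob_kernelD (frob_kernelM d h1) (frob_kernelM b h2).
  by congr frob_kernel; cring P.
Qed.

(* Dividing [phi (p t) = (p t) ^+ p + p z] by [p] in the free ring and mapping to the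
   quotient, where [phi] induces the identity, gives [x = p ^ (p - 1) x ^+ p = 0]. *)
Lemma torsion_aux (x : Theta F) : x *+ p = 0 -> x = 0.
Proof.
elim/pclass_ind: x => t; set x := pclass _ t => px.
pose np := iter p (radd (@rone (generator F))) rzero.
have npE : free_term np = p%:R by rewrite /np; elim: (p) => //= n ->; rewrite -mulrS.
have npE' : pclass (@theta_rel L F) np = p%:R.
  by rewrite /np; elim: (p) => //= n IH; rewrite pclassD IH -mulrS.
have rc : rcong (@theta_rel L F) (rmul np t) rzero.
  by apply/pclassP; rewrite pclassM npE' mulr_natl; exact: px.
have [_ [z [z0 hz]]] := frob_kernel_rcong rc; rewrite /= subr0 npE in hz.
have e : phi (free_term t) = free_term t ^+ p *+ (p ^ p.-1) + z.
  apply/eqP; rewrite -subr_eq0; apply/eqP/(P_torsion_free (prime_gt0 p_pr)).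
  apply/eqP; rewrite mulrnBl mulrnDl -mulrnA -expnSr prednK ?prime_gt0 //.
  rewrite subr_eq0 -mulr_natl -[_ *+ (p ^ p)]mulr_natl natrX -exprMn -hz.
  by rewrite rmorphM rmorph_nat.
apply: c_inj; rewrite rmorph0 -pi_term -pi_phi e rmorphD z0 addr0 rmorphMn rmorphXn /= pi_term.
rewrite -/x -rmorphXn -rmorphMn; suff -> : x ^+ p *+ (p ^ p.-1) = 0 by rewrite rmorph0.
have -> : (p ^ p.-1 = p * p ^ p.-2)%N.
  by rewrite -expnS prednK // -ltnS prednK ?prime_gt1 ?prime_gt0.
rewrite mulrnA -[p in x ^+ p]prednK ?prime_gt0 //.
by rewrite exprS -mulrnAl px mul0r mul0rn.
Qed.

End TorsionFree.

Lemma theta_torsion_free (L : signature) (F : structure L -> Prop) (p : nat) :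
  fraisse_class F -> prime p ->
  (forall X, F X -> ~~ (p %| #|automorphisms X|)%N) ->
  forall x : Theta F, x *+ p = 0 -> x = 0.
Proof.
move=> HF p_pr autF.
have [e|/eqP nz] := eqVneq (1 : Theta F) 0.
  by move=> x _; rewrite -[x]mulr1 e mulr0.
have nz' : (1 : Theta F) != 0 by apply/eqP.
(* Evaluation of the free ring is available for nonzero rings, so [Theta] is repackaged as [T], with
   the identity for [c]. *)
pose T : comNzRingType := HB.pack (GRing.ComPzRing.sort (Theta F)) (GRing.PzSemiRing_isNonZero.Build (Theta F) nz').
pose c : {rmorphism Theta F -> T} := idfun.
have [pi piE] := @free_eval (generator F) T (fun g => c (cls g)).
have [phi phiE] := @free_eval (generator F) {malg int[{cmonom (generator F)}]}
  (fun g => fvar g ^+ p - free_pderiv HF p (@fvar _) g *+ p).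
exact: (@torsion_aux L F HF p p_pr autF _ _ (@free_torsion _) T c (fun x y => id) pi phi piE phiE).
Qed.

(** * Generation by minimal marked structures *)

Section Generation.
Variables (L : signature) (F : structure L -> Prop).
Hypothesis HF : fraisse_class F.

Lemma induced_in (X : structure L) (FX : F X) (A : {set X}) : F (induced A).
Proof. exact: fraisse_hereditary HF _ _ FX (induced_val A). Qed.

Definition marked_class (M : marked F) : Theta F :=
  bracket (induced_in (mk_objF M) (~: [set mk_pt M])) (mk_objF M)
    (induced_val (~: [set mk_pt M])).

Lemma bracket_marked (X Y : structure L) (FX : F X) (FY : F Y) (i : embedding X Y) (y : Y) :
  (forall w, w != y <-> exists x, i x = w) -> bracket FX FY i = marked_class (Marked FY y).
Proof.
move=> iy; have iA x : i x \in ~: [set y] by rewrite !inE; apply/iy; exists x.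
pose f x : induced (~: [set y]) := exist _ (i x) (iA x).
have fE : is_embedding f.
  have [iI iR] := embP i; split=> [a b /(congr1 val)/iI //|s t].
  rewrite -iR /=; congr (@interp L Y s _).
  by apply: val_inj; rewrite /= -map_comp.
have fb : bijective (Embedding fE).
  have g w : {x | f x = w}.
    apply/cid; have /iy[x xw] : val w != y by have := valP w; rewrite !inE.
    by exists x; apply: val_inj.
  exists (fun w => projT1 (g w)) => w; last by case: (g w).
  by apply: (proj1 fE); case: (g _).
rewrite (@bracket_compE L F X _ Y FX (induced_in FY (~: [set y])) FY (Embedding fE)
  (induced_val (~: [set y]))) // (bracket_iso _ _ fb).
exact: mulr1.
Qed.

Lemma marked_class_iso (M N : marked F) : marked_iso M N -> marked_class M = marked_class N.
Proof.
move=> [f [fb fM]].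
transitivity (bracket (induced_in (mk_objF M) (~: [set mk_pt M])) (mk_objF N)
  (emb_comp f (induced_val (~: [set mk_pt M])))).
  by rewrite (bracket_comp _ (mk_objF M)) (bracket_iso _ _ fb) mul1r.
rewrite (@bracket_marked _ _ _ _ _ (mk_pt N)); first by case: (N).
have [g fK gK] := fb; move=> w; split=> [wN|[x <-]] /=.
  have gw : g w \in ~: [set mk_pt M].
    by rewrite !inE; apply: contra wN => /eqP e; rewrite -fM -e gK.
  by exists (exist _ (g w) gw); apply: gK.
by rewrite -fM (can_eq fK); have := valP x; rewrite !inE.
Qed.

Lemma extraneous_class (M : marked F) (z : mk_obj M) : extraneous z ->
  exists M' : marked F, (#|{: mk_obj M'}| < #|{: mk_obj M}|)%N /\
    marked_class M = marked_class M'.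
Proof.
move=> [zx [FX [dAB sep]]].
have xz : mk_pt M \in ~: [set z] by rewrite !inE eq_sym.
pose x : induced (~: [set z]) := exist _ (mk_pt M) xz.
exists (Marked (induced_in (mk_objF M) (~: [set z])) x); split.
  by rewrite /= card_sig cardsC1 prednK //; apply/card_gt0P; exists z.
have := @bracket_amalgam L F _ _ _ (induced_in FX (~: ([set z] :|: [set mk_pt M])))
  (induced_in FX (~: [set z])) (induced_in FX (~: [set mk_pt M]))
  (incl (subset_compl_Ul [set z] [set mk_pt M]))
  (incl (subset_compl_Ur [set z] [set mk_pt M])) 1 (fun=> ambient_amalgam FX dAB).
rewrite big_ord1 => e; transitivity (bracket (induced_in FX (~: [set mk_pt M])) FX
  (induced_val (~: [set mk_pt M]))).
  by congr bracket; apply: Prop_irrelevance.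
rewrite -[LHS]e.
  rewrite (@bracket_marked _ _ _ _ _ x).
    by congr (marked_class (Marked _ _)); apply: Prop_irrelevance.
  move=> w; split=> [wx|[[v vA] <-]].
    have wA : val w \in ~: ([set z] :|: [set mk_pt M]).
      by have := valP w; rewrite !inE negb_or => ->; apply: contra wx => /eqP h; apply/eqP/val_inj.
    by exists (exist _ (val w) wA); apply: val_inj.
  have vx : v != mk_pt M by have := vA; rewrite !inE negb_or => /andP[].
  by apply: contra vx => /eqP /(congr1 val) /= ->.
by split=> // [n n' _|v _]; [rewrite !ord1 | exists ord0].
Qed.

Variables (r : nat) (a : 'I_r -> marked F).
Hypothesis aP : representatives (@minimal L F) (@marked_iso L F) a.

Definition min_gen (n : 'I_r) : Theta F := marked_class (a n).

Lemma marked_class_min (M : marked F) : exists n, marked_class M = min_gen n.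
Proof.
have [k] := ubnP #|{: mk_obj M}|; elim: k M => // k IH M Mk.
have [mM|nM] := pselect (minimal M).
  by have [_ _ /(_ M mM)[n /marked_class_iso ->]] := aP; exists n.
have [z zM] : exists z, extraneous (M := M) z by apply: contrapT => nz; apply: nM => z hz; apply: nz; exists z.
have [M' [M'M ->]] := extraneous_class zM; apply: IH.
exact: leq_trans M'M Mk.
Qed.

Definition monom (R : comPzRingType) (g : 'I_r -> R) (js : seq 'I_r) : R := \prod_(j <- js) g j.

(** The points of [Y] outside the image are added one at a time, each step being the class of a
    marked structure. The count of points becomes a degree bound in [min_gen_frobenius]. *)
Lemma bracket_monom (X Y : structure L) (FX : F X) (FY : F Y) (i : embedding X Y) :
  exists js, (#|{: X}| + size js = #|{: Y}|)%N /\ bracket FX FY i = monom min_gen js.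
Proof.
have [k] := ubnP #|{: Y}|; elim: k Y FY i => // k IH Y FY i Yk.
have [iI _] := embP i.
have XY : (#|{: X}| <= #|{: Y}|)%N := leq_card i iI.
have [YX|YX] := leqP #|{: Y}| #|{: X}|.
  exists [::]; split; first by rewrite addn0; apply/eqP; rewrite eqn_leq XY.
  rewrite /monom big_nil; apply: bracket_iso.
  exact: inj_card_bij.
have [y yi] : exists y, forall x, i x != y.
  apply: contrapT => nh; suff : (#|{: Y}| <= #|{: X}|)%N by rewrite leqNgt YX.
  have h y : exists x, i x = y.
    apply: contrapT => ny; apply: nh; exists y => x; apply/eqP => e.
    by apply: ny; exists x.
  have [g gK] := choice h; exact: (leq_card g (can_inj gK)).
have iA x : i x \in ~: [set y] by rewrite !inE.
pose f x : induced (~: [set y]) := exist _ (i x) (iA x).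
have fE : is_embedding f.
  have [_ iR] := embP i; split=> [x x' /(congr1 val)/iI //|s t].
  rewrite -iR /=; congr (@interp L Y s _).
  by apply: val_inj; rewrite /= -map_comp.
have cY : (#|{: induced (~: [set y])}|.+1 = #|{: Y}|)%N.
  by rewrite card_sig cardsC1 prednK //; apply/card_gt0P; exists y.
have [|js [sjs e2]] := IH _ (induced_in FY (~: [set y])) (Embedding fE).
  by rewrite -ltnS cY.
have [n nE] := marked_class_min (Marked FY y).
exists (n :: js); split; first by rewrite /= addnS sjs.
rewrite /monom big_cons -nE mulrC.
rewrite (@bracket_compE L F X _ Y FX (induced_in FY (~: [set y])) FY (Embedding fE)
  (induced_val (~: [set y]))) // mulrC.
by congr (_ * _); rewrite e2.
Qed.

Lemma theta_generated (x : Theta F) :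
  exists s : seq (int * seq 'I_r), x = \sum_(c <- s) monom min_gen c.2 *~ c.1.
Proof.
elim/pclass_ind: x; elim=> [[X FX Y FY i]|||t [s IH]|t [s IHs] u [v IHv]|t [s IHs] u [v IHv]].
- have [js [_ e]] := bracket_monom FX FY i.
  by exists [:: (1, js)]; rewrite big_seq1 /= -e.
- by exists [::]; rewrite big_nil.
- by exists [:: (1, [::])]; rewrite big_seq1 /monom big_nil.
- exists [seq (- c.1, c.2) | c <- s]; rewrite pclassN IH big_map -sumrN.
  by apply: eq_bigr => c _; rewrite mulrNz.
- by exists (s ++ v); rewrite pclassD IHs IHv big_cat.
- exists [seq (c.1 * d.1, c.2 ++ d.2) | c <- s, d <- v].
  rewrite pclassM IHs IHv big_allpairs_dep mulr_suml; apply: eq_bigr => c _.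
  rewrite mulr_sumr; apply: eq_bigr => d _ /=.
  by rewrite /monom big_cat /= mulrzAr mulrzAl mulrzA mulrC.
Qed.

Variables (p : nat) (p_pr : prime p).
Hypothesis autF : forall X, F X -> ~~ (p %| #|automorphisms X|)%N.

(** A gluing of [p] copies of [X] along [X] minus a point has at most [p] points beyond the base,
    hence the degree is at most [p]. *)
Lemma min_gen_frobenius (n : 'I_r) :
  exists s : seq (seq 'I_r), all (fun js => size js <= p)%N s /\
    min_gen n ^+ p = min_gen n + (\sum_(js <- s) monom min_gen js) *+ p.
Proof.
rewrite /min_gen /marked_class.
case: (a n) => X FX x /=; set A := ~: [set x].
set i := induced_val A; set FA := induced_in FX A.
rewrite -(mu_srpat HF) (pderiv_pow p_pr autF); last exact: pullr_embedding.
suff [s [sp ->]] : exists s : seq (seq 'I_r), all (fun js => size js <= p)%N s /\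
  pderiv p FA i (srpat HF FX) = \sum_(js <- s) monom min_gen js by exists s.
rewrite /pderiv /osum.
have h (l : rpat HF (induced A + 'I_p * X)%type) : exists js, (size js <= p)%N /\
    (ncp id i (srpat HF FA) (srpat HF FX) l -> mu FA inl l = monom min_gen js).
  have [nl|] := boolP (ncp _ _ _ _ l); last by exists [::].
  have [V [FV [q [e [[ql qS eq] ->]]]]] := mu_exists (ncp_base nl).
  have [js [sjs ->]] := bracket_monom FA FV e; exists js; split=> //.
  have /andP[/powgluedP[lA lX lf] _] := nl.
  rewrite -(leq_add2l #|{: induced A}|) sjs.
  have -> : (#|{: induced A}| + p = #|{: induced A + 'I_p}|)%N.
    by rewrite card_sum card_ord.
  pose g (w : induced A + 'I_p) : V := match w with inl w => q (inl w) | inr k => q (inr (k, x)) end.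
  have gS v : exists w, g w = v.
    have [[w|[k w]] <-] := qS v; first by exists (inl w).
    have [->|wx] := eqVneq w x; first by exists (inr k).
    have wA : w \in A by rewrite !inE.
    exists (inl (exist _ w wA)) => /=; apply/eqP.
    by have := lf k (exist _ w wA); rewrite /rel_of -ql.
  have [g' g'K] := choice gS; exact: (leq_card g' (can_inj g'K)).
have [js jsP] := choice h.
exists [seq js l | l <- index_enum _ & ncp id i (srpat HF FA) (srpat HF FX) l && (froot (@rot _ _ HF p _ _) l == l)].
split; first by apply/allP => _ /mapP[l _ ->]; case: (jsP l).
rewrite big_map big_filter; apply: eq_bigr => l /andP[nl _].
by case: (jsP l) => _ ->.
Qed.

End Generation.

(** * Divisibility of binomial products *)

Definition torsion_free (V : nmodType) : Prop :=
  forall n (x : V), (0 < n)%N -> x *+ n = 0 -> x = 0.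

Section Generators.
Variables (B : comPzRingType) (r : nat) (g : 'I_r -> B).

Definition generates : Prop :=
  forall x, exists s : seq (int * seq 'I_r), x = \sum_(c <- s) monom g c.2 *~ c.1.

Definition loc_generates (m : nat) : Prop :=
  forall x, exists k (s : seq (int * seq 'I_r)),
    x *+ m ^ k = \sum_(c <- s) monom g c.2 *~ c.1.

(** The degree bound [p] keeps [monom_reduce] from raising degrees and lets [clear_prime] clear
    denominators with a [p]-th power. *)
Definition frobenius_mod (m : nat) : Prop :=
  forall p, prime p -> ~~ (p %| m)%N -> forall j,
  exists s : seq (seq 'I_r), all (fun js => size js <= p)%N s /\
    g j ^+ p = g j + (\sum_(js <- s) monom g js) *+ p.

End Generators.

Definition divisible (B : nmodType) (d : nat) (x : B) : Prop := exists y, x = y *+ d.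

Section Divisible.
Variable B : comPzRingType.
Implicit Types x y : B.

Lemma divisibleD d x y : divisible d x -> divisible d y -> divisible d (x + y).
Proof. by move=> [a ->] [b ->]; exists (a + b); rewrite mulrnDl. Qed.

Lemma divisibleN d x : divisible d x -> divisible d (- x).
Proof. by move=> [a ->]; exists (- a); rewrite mulNrn. Qed.

Lemma divisibleMl d x y : divisible d x -> divisible d (y * x).
Proof. by move=> [a ->]; exists (y * a); rewrite mulrnAr. Qed.

Lemma divisibleMr d x y : divisible d x -> divisible d (x * y).
Proof. by rewrite mulrC; apply: divisibleMl. Qed.

Lemma divisible0 d : divisible d (0 : B).
Proof. by exists 0; rewrite mul0rn. Qed.

Lemma divisibleX d n x : divisible d x -> divisible (d ^ n) (x ^+ n).
Proof. by move=> [a ->]; exists (a ^+ n); rewrite exprMn_n. Qed.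

Lemma divisible_coprime d e x :
  coprime d e -> divisible d x -> divisible e x -> divisible (d * e) x.
Proof.
have [->|d0] := posnP d.
  by rewrite /coprime gcd0n => /eqP -> [y ->] _; exists y; rewrite mul0n mulr0n.
move=> de [a xa] [b xb]; have [u v uv _] := egcdnP e d0.
have {uv}uv : (u * d = v * e + 1)%N by rewrite uv (eqP de).
exists (b *+ u - a *+ v); rewrite mulrnBl -!mulrnA.
have -> : (u * (d * e) = e * (u * d))%N by lia.
have -> : (v * (d * e) = d * (v * e))%N by lia.
by rewrite !mulrnA -xb -xa -!mulrnA uv mulrnDr mulr1n addrAC subrr add0r.
Qed.

End Divisible.

(** A form of Lagrange interpolation: the products that omit one factor generate everything up to
    the differences [a i - a j], which [Q] is assumed to tolerate. The induction strips the head of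
    [s] by pairing it with each remaining factor. *)
Lemma prod_pair_elim (B : comPzRingType) (T : eqType) (a : T -> B) (Q : B -> Prop) (s : seq T) :
  uniq s -> s != [::] ->
  (forall i j b, i \in s -> j \in s -> i != j -> Q (b * a i) -> Q (b * a j) -> Q b) ->
  forall b, (forall i, i \in s -> Q (b * \prod_(j <- rem i s) a j)) -> Q b.
Proof.
elim: s => // c s IH /= /andP[cs us] _ hQ b hb.
have [e|s0] := eqVneq s [::].
  have := hb c; rewrite e /= ?inE ?eqxx /= big_nil mulr1 => h; exact: h.
apply: (IH us s0) => [i j b' si sj ij|i si].
  by apply: hQ => //; rewrite inE ?si ?sj orbT.
have ci : c != i by apply: contraNneq cs => ->.
apply: (hQ i c) => //; first by rewrite inE si orbT.
- by rewrite inE eqxx.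
- by rewrite eq_sym.
- have := hb c; rewrite /= ?inE ?eqxx /= (big_rem i) //= mulrA mulrAC => h; exact: h.
- have := hb i; rewrite /= ?inE si orbT (negPf ci) big_cons mulrCA mulrC => h; exact: h.
Qed.

Lemma expr_sum_split (B : comPzRingType) (u v : B) k l :
  exists s t, (u + v) ^+ (k + l) = u ^+ k * s + v ^+ l * t.
Proof.
have [n] := ubnP (k + l); elim: n k l => // n IH [|k] [|l] kl.
- by exists 1, 0; rewrite !mulr1 mulr0 addr0.
- by exists ((u + v) ^+ l.+1), 0; rewrite mul1r mulr0 addr0.
- by exists 0, ((u + v) ^+ k.+1); rewrite addn0 mul1r mulr0 add0r.
have [|s [t st]] := IH k l.+1; first lia.
have [|s' [t' st']] := IH k.+1 l; first lia.
exists (s + s' * v), (t * u + t').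
have e1 : (k.+1 + l.+1 = (k + l.+1).+1)%N by lia.
have e2 : (k + l.+1 = k.+1 + l)%N by lia.
rewrite e1 exprSr mulrDr {2}e2 st st' !exprSr.
by cring B.
Qed.

Section Frobenius.
Variables (B : comNzRingType) (m : nat).
Hypothesis m_unit : exists u : B, m%:R * u = 1.
Variables (r : nat) (g : 'I_r -> B).
Hypothesis g_gen : loc_generates g m.
Hypothesis g_frob : frobenius_mod g m.

Lemma mX_unit k : exists u : B, (m ^ k)%:R * u = 1.
Proof.
have [u mu] := m_unit; exists (u ^+ k).
by rewrite natrX -exprMn mu expr1n.
Qed.

Lemma divisible_unit n (x : B) : (exists u : B, n%:R * u = 1) -> divisible n x.
Proof. by move=> [u nu]; exists (x * u); rewrite -mulr_natr -mulrA [u * _]mulrC nu mulr1. Qed.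

(** The elements with this property form a subring, since the [p]-th power is additive modulo [p];
    it contains the generators and the inverse of [m]. *)
Lemma frobenius p (x : B) : prime p -> ~~ (p %| m)%N -> divisible p (x ^+ p - x).
Proof.
move=> p_pr pm.
pose Q (x : B) := divisible p (x ^+ p - x).
have p0 : (p == 0)%N = false by apply: gtn_eqF; rewrite prime_gt0.
have Q0 : Q 0 by rewrite /Q expr0n p0 subr0; apply: divisible0.
have Q1 : Q 1 by rewrite /Q expr1n subrr; apply: divisible0.
have QD x1 x2 : Q x1 -> Q x2 -> Q (x1 + x2).
  rewrite /Q => h1 h2; have := @sum_pow_prime p p_pr B bool (fun b : bool => if b then x1 else x2).
  rewrite !big_bool /=; set o := osum _ _ _ => ->.
  have h3 : divisible p (o *+ p) by exists o.
  by have := divisibleD (divisibleD h1 h2) h3; congr divisible; cring B.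
have QM x1 x2 : Q x1 -> Q x2 -> Q (x1 * x2).
  move=> h1 h2; have := divisibleD (divisibleMr (x2 ^+ p) h1) (divisibleMl x1 h2).
  by rewrite /Q exprMn; congr divisible; cring B.
have QN x1 : Q x1 -> Q (- x1).
  move=> h1; rewrite -mulN1r; apply: QM => //.
  (* The case of [-1]: the difference is [1 + 1] for [p = 2] and 0 for odd [p]. *)
  rewrite /Q; have [->|podd] := even_prime p_pr; first by rewrite sqrrN expr1n opprK; exists 1.
  by rewrite -signr_odd podd expr1 subrr; apply: divisible0.
have Qnat n : Q n%:R by elim: n => // n IH; rewrite -[n.+1]addn1 natrD; apply: QD.
have Qz (x1 : B) (z : int) : Q x1 -> Q (x1 *~ z).
  move=> h1; case: z => n; rewrite ?NegzE ?mulrNz -?pmulrn -mulr_natr; first exact: QM.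
  exact/QN/QM.
have Qsum T (s : seq T) (f : T -> B) : (forall c, Q (f c)) -> Q (\sum_(c <- s) f c).
  by move=> h; elim: s => [|c s IH]; rewrite ?big_nil // big_cons; apply: QD.
have Qg j : Q (g j).
  rewrite /Q; have [s [_ ->]] := g_frob p_pr pm j; rewrite addrAC subrr add0r.
  by eexists.
have Qmon js : Q (monom g js).
  by rewrite /monom; elim: js => [|j js IH]; rewrite ?big_nil // big_cons; apply: QM.
have [k [s e]] := g_gen x.
have : Q (x *+ m ^ k) by rewrite e; apply: Qsum => c; apply: Qz.
have [u mu] := mX_unit k; rewrite /Q -mulr_natr => h.
have Qu : Q u.
  have [v hv] := Qnat (m ^ k)%N; exists (- (v * u ^+ p * u)).
  have e2 : (m ^ k)%:R ^+ p * u ^+ p = 1 by rewrite -exprMn mu expr1n.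
  have -> : u ^+ p - u = - (((m ^ k)%:R ^+ p - (m ^ k)%:R) * u ^+ p * u).
    transitivity (u ^+ p * ((m ^ k)%:R * u) - ((m ^ k)%:R ^+ p * u ^+ p) * u).
      by rewrite mu e2 mulr1 mul1r.
    by cring B.
  by rewrite hv; cring B.
have := QM _ _ h Qu; rewrite -mulrA mu mulr1; exact.
Qed.

End Frobenius.

(** * Integer-valued polynomials at elements of a ring with Frobenius congruences *)

Definition evalz (B : nzRingType) (f : {poly int}) (x : B) : B := (map_poly intr f).[x].

Section EvalZ.
Variable B : comNzRingType.
Implicit Types (f h : {poly int}) (x y : B).

Lemma evalzD f h x : evalz (f + h) x = evalz f x + evalz h x.
Proof. by rewrite /evalz rmorphD hornerD. Qed.

Lemma evalzM f h x : evalz (f * h) x = evalz f x * evalz h x.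
Proof. by rewrite /evalz rmorphM hornerM. Qed.

Lemma evalzC (c : int) x : evalz c%:P x = c%:~R.
Proof. by rewrite /evalz map_polyC hornerC. Qed.

Lemma evalzX x : evalz 'X x = x.
Proof. by rewrite /evalz map_polyX hornerX. Qed.

Lemma evalzMn f n x : evalz (f *+ n) x = evalz f x *+ n.
Proof. by rewrite /evalz rmorphMn /= hornerMn. Qed.

Lemma evalz_prod (s : seq nat) x :
  evalz (\prod_(i <- s) ('X - (i%:Z)%:P)) x = \prod_(i <- s) (x - i%:R).
Proof.
elim: s => [|i s IH]; first by rewrite !big_nil -[1]/(1%:P) evalzC.
by rewrite !big_cons evalzM IH /evalz rmorphB /= map_polyX map_polyC hornerXsubC.
Qed.

Lemma evalz_sub f x y : exists s, evalz f x - evalz f y = (x - y) * s.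
Proof.
elim/poly_ind: f => [|f c [s IH]].
  by exists 0; rewrite /evalz rmorph0 !horner0 subrr mulr0.
exists (s * x + evalz f y); rewrite !evalzD !evalzM !evalzC !evalzX.
have -> : evalz f x = evalz f y + (x - y) * s by rewrite -IH addrC subrK.
by cring B.
Qed.

End EvalZ.

(* Taylor expansion of [f] at [i] along multiples of [p]. *)
Lemma evalz_shift (f : {poly int}) (i p : nat) : exists h : {poly int},
  forall (C : comNzRingType) (y : C),
    evalz f (i%:R + y *+ p) = (f.[i%:Z])%:~R + evalz h y *+ p.
Proof.
elim/poly_ind: f => [|f c [h IH]].
  by exists 0 => C y; rewrite /evalz rmorph0 !horner0 mul0rn addr0.
exists (h * ((i%:Z)%:P + 'X *+ p) + (f.[i%:Z])%:P * 'X) => C y.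
rewrite !(evalzD, evalzM, evalzMn, evalzC, evalzX) IH !hornerE !rmorphD rmorphM /=.
rewrite -pmulrn.
by cring C.
Qed.

Lemma evalz_int f (a : int) : evalz f a = f.[a].
Proof.
rewrite /evalz; congr (_.[_]); apply/polyP => i.
by rewrite coef_map /= intz.
Qed.

Section IntegerValued.
Variables (B : comNzRingType) (p : nat) (p_pr : prime p).
Hypothesis frob : forall x : B, divisible p (x ^+ p - x).

Lemma frob_iter k (x : B) : divisible p (x - x ^+ (p ^ k)).
Proof.
elim: k => [|k IH]; first by rewrite expr1 subrr; apply: divisible0.
have := divisibleD IH (divisibleN (frob (x ^+ (p ^ k)))).
by rewrite -exprM -expnSr; congr divisible; cring B.
Qed.

(** Modulo [p] the polynomial is ['X^p - 'X], since by Fermat every residue is a root of the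
    latter. *)
Lemma prod_residues (x : B) : divisible p (\prod_(i <- iota 0 p) (x - i%:R)).
Proof.
suff [h hE] : exists h : {poly int},
    \prod_(i <- iota 0 p) ('X - (i%:Z)%:P) = 'X^p - 'X + h *+ p.
  rewrite -evalz_prod hE evalzD evalzMn; apply: divisibleD; last by eexists.
  by rewrite /evalz rmorphB /= map_polyXn map_polyX !hornerE.
set q := \prod_(i <- _) _; set d := q - ('X^p - 'X).
have dp i : (d`_i)%:~R = 0 :> 'F_p.
  suff d0 : map_poly (intr : int -> 'F_p) d = 0 by rewrite -coef_map /= d0 coef0.
  rewrite rmorphB !rmorphB /= map_polyXn map_polyX.
  pose rs : seq 'F_p := [seq i%:R | i <- iota 0 p].
  have -> : map_poly (intr : int -> 'F_p) q = \prod_(a <- rs) ('X - a%:P).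
    rewrite big_map rmorph_prod; apply: eq_bigr => j _.
    by rewrite rmorphB /= map_polyX map_polyC.
  have p1 : (1 < p)%N := prime_gt1 p_pr.
  have rsu : uniq rs.
    rewrite map_inj_in_uniq ?iota_uniq // => u v; rewrite !mem_iota /= !add0n => up vp.
    move=> /(congr1 val); rewrite /= !val_Fp_nat // !modn_small //.
  have rsr : all (root ('X^p - 'X)) rs.
    apply/allP => a _; rewrite rootE !hornerE.
    rewrite -[a]natr_Zp -(pFrobenius_autE (pchar_Fp p_pr)).
    by rewrite pFrobenius_aut_nat subrr.
  have sz : size ('X^p - 'X : {poly 'F_p}) = p.+1.
    by rewrite size_polyDl ?size_polyXn // size_polyN size_polyX ltnS.
  have lc : lead_coef ('X^p - 'X : {poly 'F_p}) = 1.
    by rewrite lead_coefDl ?lead_coefXn // size_polyN size_polyX size_polyXn ltnS.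
  rewrite [X in _ - X](all_roots_prod_XsubC _ rsr) ?lc ?scale1r ?subrr ?uniq_rootsE //.
  by rewrite sz size_map size_iota.
have hz (c : int) : c%:~R = 0 :> 'F_p -> exists c' : int, c = c' *+ p.
  move=> c0; have : (p %| `|c|)%N.
    have : (`|c|%N)%:R = 0 :> 'F_p.
      case: c c0 => n; first by [].
      by rewrite NegzE rmorphN /= => /eqP; rewrite oppr_eq0 => /eqP.
    by move=> /(congr1 val); rewrite /= val_Fp_nat // => /eqP.
  case/dvdnP => k kE; exists (sgz c * k%:Z).
  by rewrite {1}[c]intEsg kE; lia.
have hd i : exists c : int, d`_i = c *+ p := hz _ (dp i).
have [c cE] := choice hd.
exists (\poly_(i < size d) c i).
rewrite -[q](subrK ('X^p - 'X)) addrC; congr (_ + _).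
apply/polyP => i; rewrite coefMn coef_poly -/d; case: ltnP => ih; first exact: cE.
by rewrite nth_default // mul0rn.
Qed.

(** Induction on [e]. Near a residue [i], Taylor expansion writes [f] at [i + p y] as
    [p (c + h(y))], and [c + h] satisfies the hypothesis with one power of [p] less. An element [x]
    belongs to no single residue class, so the local statements must be combined. *)
Lemma integer_valued e (f : {poly int}) (x : B) :
  (forall a : nat, ((p ^ e)%:Z %| f.[a%:Z])%Z) -> divisible (p ^ e) (evalz f x).
Proof.
elim: e f x => [|e IH] f x hf.
  by exists (evalz f x); rewrite expn0 mulr1n.
set K := e.+1.
have step1 (i : nat) (y : B) : divisible (p ^ K) (evalz f (i%:R + y *+ p)).
  have [h hE] := evalz_shift f i p.
  have /dvdzP[c cE] : (p%:Z %| f.[i%:Z])%Z.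
    by apply: dvdz_trans (hf i); rewrite expnS PoszM dvdz_mulr.
  have := IH (c%:P + h) y; rewrite evalzD evalzC => /(_ _)[].
    move=> a; have := hf (i + a * p)%N; rewrite -evalz_int.
    have -> : (i + a * p)%N%:Z = (i%:R : int) + a%:Z *+ p
      by rewrite PoszD PoszM -[a%:Z *+ p]mulr_natr !natz.
    rewrite hE cE intz -[evalz h _]evalz_int /= !evalz_int hornerD hornerC.
    rewrite expnS PoszM => hd.
    rewrite -(@dvdz_mul2l p%:Z) ?eqz_nat ?gtn_eqF ?prime_gt0 //.
    apply: etrans hd; congr dvdz; rewrite -[(map_poly intr h).[_]]/(evalz h _) evalz_int.
    by rewrite mulrDr -[h.[_] *+ p]mulr_natl natz mulrC.
  move=> w wE; exists w; rewrite hE cE rmorphM /= expnS mulnC mulrnA -wE mulrnDl.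
  by rewrite mulr_natr.
(* Frobenius provides [w] with [(x - i) ^ (p ^ K) = x - (i + p w)], so [f] at [x] and at [i + p w]
   differ by a multiple of that power; [p ^ K] exceeds [K]. *)
have step2 (i : nat) : exists u s, evalz f x = u *+ p ^ K + (x - i%:R) ^+ K * s.
  have [w wE] := frob_iter K (x - i%:R).
  have [u uE] := step1 i w.
  have [s sE] := evalz_sub f x (i%:R + w *+ p).
  exists u, ((x - i%:R) ^+ (p ^ K - K) * s); rewrite -uE mulrA -exprD subnKC; last first.
    exact/ltnW/ltn_expl/prime_gt1.
  have -> : (x - i%:R) ^+ (p ^ K) = x - (i%:R + w *+ p) by rewrite -wE; cring B.
  by rewrite -sE; cring B.
(* For two residues [i] and [j], the ideal of [(x - i) ^ K] and [(x - j) ^ K] contains a power of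
   [j - i], prime to [p], while the product of all these powers is divisible by [p ^ K]. *)
pose Q (b : B) := divisible (p ^ K) (b * evalz f x).
rewrite -[evalz f x]mul1r -/(Q 1).
apply: (@prod_pair_elim B _ (fun i : nat => (x - i%:R) ^+ K) Q (iota 0 p) (iota_uniq _ _)).
- by case: (p) p_pr.
- move=> i j b; rewrite !mem_iota /= !add0n => ip jp ij.
  wlog ltij : i j ip jp ij / (i < j)%N.
    move=> h; have [l|l|e1] := ltngtP i j; [exact: h| |by rewrite e1 eqxx in ij].
    by move=> h1 h2; apply: (h j i) => //; rewrite eq_sym.
  rewrite /Q => hi hj.
  have [s [t st]] := expr_sum_split (x - i%:R) (- (x - j%:R)) K K.
  have dE : x - i%:R + - (x - j%:R) = (j - i)%:R :> B by rewrite natrB ?(ltnW ltij) //; cring B.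
  have hd : divisible (p ^ K) (b * evalz f x *+ (j - i) ^ (K + K)).
    rewrite -mulr_natr natrX -dE st exprNn.
    have := divisibleD (divisibleMr s hi) (divisibleMr ((-1) ^+ K * t) hj).
    by congr divisible; cring B.
  have cp : coprime (p ^ K) ((j - i) ^ (K + K)).
    rewrite coprimeXl // coprimeXr // prime_coprime //.
    by apply/negP => /dvdn_leq; rewrite subn_gt0 ltij => /(_ isT); lia.
  have N0 : (0 < (j - i) ^ (K + K))%N by rewrite expn_gt0 subn_gt0 ltij.
  have [u v uv _] := egcdnP (p ^ K) N0.
  move: uv; rewrite gcdnC (eqP cp) => uv; have [w wE] := hd.
  exists (w *+ u - b * evalz f x *+ v).
  rewrite mulrnBl -!mulrnA ![(_ * p ^ K)%N]mulnC mulrnA -wE -mulrnA [(_ * u)%N]mulnC uv.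
  by rewrite mulnC mulrnDr mulr1n addrAC subrr add0r.
- move=> i; rewrite mem_iota /= add0n => ip; rewrite /Q mul1r.
  have [u [s ->]] := step2 i; rewrite mulrDr; apply: divisibleD.
    by exists (\prod_(j <- rem i (iota 0 p)) (x - j%:R) ^+ K * u); rewrite mulrnAr.
  rewrite mulrA; apply: divisibleMr; rewrite mulrC.
  have iin : i \in iota 0 p by rewrite mem_iota add0n.
  have -> : (x - i%:R) ^+ K * \prod_(j <- rem i (iota 0 p)) (x - j%:R) ^+ K =
      \prod_(j <- iota 0 p) (x - j%:R) ^+ K.
    by rewrite [RHS](perm_big _ (perm_to_rem iin)) big_cons.
  by rewrite prodrXl; apply/divisibleX/prod_residues.
Qed.

End IntegerValued.

Lemma prod_ffact (N a : nat) :
  (\prod_(i <- iota 0 N) ('X - (i%:Z)%:P) : {poly int}).[a%:Z] = (a ^_ N)%:Z.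
Proof.
elim: N => [|N IH]; first by rewrite big_nil hornerC ffactn0.
rewrite -addn1 iotaD big_cat big_seq1 /= add0n hornerM IH hornerXsubC addn1 ffactnSr.
have [Na|aN] := leqP N a; first by rewrite PoszM subzn.
by rewrite ffact_small // mul0r mul0n.
Qed.

Section Binomial.
Variables (B : comNzRingType) (m : nat).
Hypothesis m_unit : exists u : B, m%:R * u = 1.
Hypothesis frob : forall p (x : B), prime p -> ~~ (p %| m)%N -> divisible p (x ^+ p - x).

Lemma divisible_local n (x : B) : (0 < n)%N ->
  (forall p, prime p -> ~~ (p %| m)%N -> divisible (p ^ logn p n) x) -> divisible n x.
Proof.
have [k] := ubnP n; elim: k n => // k IH n nk n0 hx.
have [n1|n1] := leqP n 1.
  have -> : n = 1%N by lia.
  by exists x; rewrite mulr1n.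
pose p := pdiv n; have p_pr : prime p by rewrite pdiv_prime.
have pn : (p %| n)%N := pdiv_dvd n.
have e0 : (0 < logn p n)%N by rewrite logn_gt0 mem_primes p_pr n0.
have [n' pn' nE] := pfactor_coprime p_pr n0.
have n'0 : (0 < n')%N by move: n0; rewrite nE muln_gt0 => /andP[].
rewrite nE; apply: divisible_coprime.
- by rewrite coprime_sym coprimeXl.
- apply: IH => //.
    suff : (n' < n)%N by lia.
    by rewrite nE ltn_Pmulr // -[X in (X < _)%N](expn0 p) ltn_exp2l ?prime_gt1.
  move=> q q_pr qm; have [->|qp] := eqVneq q p.
    by rewrite (_ : logn p n' = 0%N) ?expn0; [exists x; rewrite mulr1n | apply/eqP; rewrite logn_coprime].
  suff -> : logn q n' = logn q n by apply: hx.
  rewrite nE lognM // ?expn_gt0 ?prime_gt0 // lognX (logn_prime q p_pr).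
  by rewrite (negPf qp) muln0 addn0.
- have [pm|] := boolP (p %| m)%N; last exact: hx.
  have [u mu] := m_unit; apply: divisible_unit.
  have /dvdnP[t mE] := pm.
  exists ((t%:R * u) ^+ logn p n).
  by rewrite natrX -exprMn mulrA -natrM mulnC -mE mu expr1n.
Qed.

(** At a natural number [a] the product is ['C(a, N) * N!], so [integer_valued] applies at each
    prime not dividing [m]; the other primes are invertible. *)
Lemma binomial_divisible (N : nat) (x : B) :
  divisible N`! (\prod_(i <- iota 0 N) (x - i%:R)).
Proof.
apply: divisible_local => [|p p_pr pm]; first exact: fact_gt0.
rewrite -evalz_prod; apply: integer_valued => // [y|a]; first exact: frob.
rewrite prod_ffact; apply: (@dvdz_trans (N`!)%:Z).
  exact: pfactor_dvdnn.
suff : (N`! %| a ^_ N)%N by [].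
by rewrite -bin_ffact dvdn_mull.
Qed.

End Binomial.

(** * Finite rank *)

Section Span.
Variable B : comPzRingType.

Definition spanz (J : finType) (v : J -> B) (x : B) : Prop :=
  exists w : J -> int, x = \sum_j v j *~ w j.

Definition freez (J : finType) (v : J -> B) : Prop :=
  forall w : J -> int, \sum_j v j *~ w j = 0 -> forall j, w j = 0.

Section OneFamily.
Variables (J : finType) (v : J -> B).

Lemma spanz0 : spanz v 0.
Proof. by exists (fun=> 0); rewrite big1. Qed.

Lemma spanzD x y : spanz v x -> spanz v y -> spanz v (x + y).
Proof.
move=> [a ->] [b ->]; exists (fun j => a j + b j); rewrite -big_split /=.
by apply: eq_bigr => j _; rewrite mulrzDr.
Qed.

Lemma spanzZ x (c : int) : spanz v x -> spanz v (x *~ c).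
Proof.
move=> [a ->]; exists (fun j => a j * c); rewrite mulrz_suml.
by apply: eq_bigr => j _; rewrite mulrzA.
Qed.

Lemma spanzMn x n : spanz v x -> spanz v (x *+ n).
Proof. by rewrite pmulrn; apply: spanzZ. Qed.

Lemma spanz_sum (I : Type) (s : seq I) (P : pred I) (f : I -> B) :
  (forall i, P i -> spanz v (f i)) -> spanz v (\sum_(i <- s | P i) f i).
Proof. by move=> h; apply: big_ind h; [apply: spanz0 | apply: spanzD]. Qed.

Lemma spanz_mem j : spanz v (v j).
Proof.
exists (fun i => (i == j)%:Z); rewrite (bigD1 j) //= eqxx big1 ?addr0 // => i /negPf ->.
exact: mulr0z.
Qed.

Lemma spanz_absz x (c : int) : spanz v (x *~ c) -> spanz v (x *+ `|c|%N).
Proof.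
rewrite pmulrn => /(spanzZ (sgz c)); rewrite -mulrzA.
suff -> : c * sgz c = `|c|%N by [].
by lia.
Qed.

End OneFamily.

Lemma spanz_trans (J K : finType) (v : J -> B) (e : K -> B) x :
  (forall j, spanz e (v j)) -> spanz v x -> spanz e x.
Proof. by move=> h [a ->]; apply: spanz_sum => j _; apply/spanzZ/h. Qed.

(* Cramer's rule for [1 - p Q], whose determinant is 1 modulo [p]. *)
Lemma nakayama (J K : finType) (v : J -> B) (e : K -> B) (p : nat) : prime p ->
  (forall j, exists c : J -> int, spanz e (v j - (\sum_b v b *~ c b) *+ p)) ->
  exists D : int, D != 0 /\ forall j, spanz e (v j *~ D).
Proof.
move=> p_pr /choice[c hc].
pose A : 'M[int]_#|J| := 1%:M - \matrix_(i, k) (c (enum_val i) (enum_val k) *+ p).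
have AE i k : A i k = (i == k)%:R - c (enum_val i) (enum_val k) *+ p.
  by rewrite !mxE.
have spA i : spanz e (\sum_k v (enum_val k) *~ A i k).
  have := hc (enum_val i); congr spanz.
  under [in RHS]eq_bigr => k _ do rewrite AE mulrzBr.
  rewrite sumrB; congr (_ - _).
    rewrite (bigD1 i) //= eqxx big1 ?addr0 // => k /negPf ki.
    by rewrite eq_sym ki.
  rewrite (reindex_onto (@enum_val J _) enum_rank) /=; last by move=> j _; rewrite enum_rankK.
  rewrite -sumrMnl; apply: eq_big => k; first by rewrite enum_valK eqxx.
  by move=> _; rewrite -[c _ _ *+ p]mulr_natr mulrzA natz -pmulrn.
exists (\det A); split.
  apply/eqP => d0; have : \det (map_mx (intr : int -> 'F_p) A) = 0 by rewrite det_map_mx d0.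
  suff -> : map_mx (intr : int -> 'F_p) A = 1%:M by rewrite det1 => /eqP; rewrite oner_eq0.
  apply/matrixP => i k; rewrite !mxE rmorphB /= rmorph_nat rmorphMn /=.
  by rewrite -[_ *+ p]mulr_natr (pcharf0 (pchar_Fp p_pr)) mulr0 subr0.
move=> j; pose i := enum_rank j.
have -> : v j *~ \det A = \sum_l (\sum_k v (enum_val k) *~ A l k) *~ (\adj A) i l.
  under eq_bigr => l _ do rewrite mulrz_suml.
  rewrite exchange_big /=.
  transitivity (\sum_k v (enum_val k) *~ (\adj A *m A) i k); last first.
    apply: eq_bigr => k _; rewrite mxE mulrz_sumr; apply: eq_bigr => l _.
    by rewrite -mulrzA mulrC.
  rewrite mul_adj_mx (bigD1 i) //= mxE eqxx /i enum_rankK big1 ?addr0 // => k /negPf ki.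
  by rewrite mxE eq_sym ki.
by apply: spanz_sum => l _; apply: spanzZ.
Qed.

Lemma spanz_free_sub (s : seq B) : exists n (e : 'I_n -> B), freez e /\
  forall x, x \in s -> exists c : int, c != 0 /\ spanz e (x *~ c).
Proof.
elim: s => [|x s [n [e [fe he]]]].
  exists 0%N, (fun=> 0); split=> // w _ [] //.
have [[c [c0 cx]]|nx] := pselect (exists c : int, c != 0 /\ spanz e (x *~ c)).
  exists n, e; split=> // y; rewrite inE => /orP[/eqP ->|]; last exact: he.
  by exists c.
pose e' (i : 'I_n.+1) := if unlift ord0 i is Some j then e j else x.
have e'E w : \sum_i e' i *~ w i = x *~ w ord0 + \sum_i e i *~ w (lift ord0 i).
  rewrite big_ord_recl /e' unlift_none; congr (_ + _).
  by apply: eq_bigr => i _; rewrite liftK.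
have ee' y : spanz e y -> spanz e' y.
  apply: spanz_trans => j; have := spanz_mem e' (lift ord0 j).
  by rewrite {2}/e' liftK.
exists n.+1, e'; split.
  move=> w; rewrite e'E => h.
  have w0 : w ord0 = 0.
    apply/eqP/negPn/negP => w0; apply: nx; exists (w ord0); split=> //.
    exists (fun i => - w (lift ord0 i)); apply/eqP.
    under [X in _ == X]eq_bigr => i _ do rewrite mulrNz.
    by rewrite sumrN -addr_eq0; apply/eqP.
  move=> j; case: (unliftP ord0 j) => [i|] -> //.
  by apply: (fe (fun i => w (lift ord0 i))); rewrite w0 mulr0z add0r in h.
move=> y; rewrite inE => /orP[/eqP ->|/he[c [c0 cy]]].
  exists 1; split=> //; rewrite mulr1z; have := spanz_mem e' ord0.
  by rewrite {2}/e' unlift_none.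
by exists c; split=> //; apply: ee'.
Qed.

End Span.

Section Rank.
Variables (B : comNzRingType) (m : nat).
Hypothesis m0 : (0 < m)%N.
Variables (r : nat) (g : 'I_r -> B).
Hypothesis g_gen : loc_generates g m.
Hypothesis g_frob : frobenius_mod g m.

Lemma size_count_mem (js : seq 'I_r) : size js = (\sum_(j < r) count_mem j js)%N.
Proof.
elim: js => [|j js IH] /=; first by rewrite big1.
by rewrite big_split /= -IH (bigD1 j) //= eqxx big1 // => i /negPf; rewrite eq_sym => ->.
Qed.

Lemma monom_cat js js' : monom g (js ++ js') = monom g js * monom g js'.
Proof. by rewrite /monom big_cat. Qed.

(** A monomial with more than [r * p.-1] factors contains some [g j ^+ p]. Replacing it by [g j]
    plus [p] times terms of degree at most [p] shortens the leading term and never raises the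
    degree. *)
Lemma monom_reduce p d (js : seq 'I_r) : prime p -> ~~ (p %| m)%N -> (size js <= d)%N ->
  exists c : {bseq d of 'I_r} -> int,
    spanz (fun b : {bseq (r * p.-1) of 'I_r} => monom g b)
      (monom g js - (\sum_(b : {bseq d of 'I_r}) monom g b *~ c b) *+ p).
Proof.
move=> p_pr pm; have [k] := ubnP (size js); elim: k js => // k IH js jsk jsd.
have [small|big] := leqP (size js) (r * p.-1).
  exists (fun=> 0); rewrite big1 // mul0rn subr0.
  exact: (spanz_mem (fun b : {bseq (r * p.-1) of 'I_r} => monom g b) (Bseq small)).
have [j pj] : exists j, (p <= count_mem j js)%N.
  apply: contrapT => nj; move: big; rewrite ltnNge => /negP; apply.
  rewrite size_count_mem -[X in (_ <= X * _)%N](card_ord r) -sum_nat_const.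
  apply: leq_sum => j _; rewrite -ltnS prednK ?prime_gt0 // ltnNge.
  by apply/negP => h; apply: nj; exists j.
pose js' : seq 'I_r := nseq (count_mem j js - p) j ++ [seq i <- js | i != j].
have jsE : perm_eq js (nseq p j ++ js').
  rewrite /js' catA -nseqD subnKC // perm_sym.
  have -> : nseq (count_mem j js) j = [seq i <- js | i == j].
    by have /all_pred1P fE := filter_all (pred1 j) js; rewrite [RHS]fE size_filter.
  exact: (permEl (perm_filterC _ _)).
have szE : size js = (p + @size 'I_r js')%N by rewrite (perm_size jsE) size_cat size_nseq.
clearbody js'.
have [s [sp gE]] := g_frob p_pr pm j.
have mE : monom g js = monom g (j :: js') + (\sum_(t <- s) monom g (t ++ js')) *+ p.
  have -> : monom g js = g j ^+ p * monom g js'.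
    rewrite /monom (perm_big _ jsE) big_cat; congr (_ * _).
    by elim: (p) => [|n IHn]; rewrite ?big_nil // big_cons exprS IHn.
  rewrite gE mulrDl; congr (_ + _); first by rewrite /monom big_cons.
  rewrite mulrnAl mulr_suml; congr (_ *+ _); apply: eq_bigr => t _.
  by rewrite monom_cat.
have [||c hc] := IH (j :: js').
- by have := prime_gt1 p_pr; rewrite /=; lia.
- by have := prime_gt1 p_pr; rewrite /=; lia.
have [w wE] : spanz (fun b : {bseq d of 'I_r} => monom g b) (\sum_(t <- s) monom g (t ++ js')).
  rewrite big_seq; apply: spanz_sum => t ts.
  have td : (size (t ++ js') <= d)%N by rewrite size_cat; apply: leq_trans (leq_add (allP sp t ts) (leqnn _)) _; rewrite -szE.
  exact: (spanz_mem (fun b : {bseq d of 'I_r} => monom g b) (Bseq td)).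
exists (fun b => c b + w b); move: hc; congr (spanz _).
under [in RHS]eq_bigr => b _ do rewrite mulrzDr.
by rewrite big_split /= -wE mE; cring B.
Qed.

(** Nakayama is applied to the monomials of each degree bound separately. The multiplier depends on
    the bound, but the target, spanned by the monomials of degree at most [r * p.-1], does not:
    hence finite rank without finite generation. *)
Lemma finite_rank : exists n (e : 'I_n -> B), freez e /\
  forall x : B, exists c : int, c != 0 /\ spanz e (x *~ c).
Proof.
have [p pm p_pr] := prime_above m.
have {}pm : ~~ (p %| m)%N by apply/negP => /(dvdn_leq m0); rewrite leqNgt pm.
pose red (b : {bseq (r * p.-1) of 'I_r}) := monom g b.
have [n [e [fe he]]] := spanz_free_sub [seq red b | b : {bseq (r * p.-1) of 'I_r}].
exists n, e; split=> // x.
have {}he : exists c : int, c != 0 /\ forall b, spanz e (red b *~ c).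
  have /choice[c hc] : forall b, exists c : int, c != 0 /\ spanz e (red b *~ c).
    by move=> b; apply: he; apply/mapP; exists b; rewrite ?mem_enum.
  exists (\prod_b c b); split; first by apply/prodf_neq0 => b _; case: (hc b).
  by move=> b; rewrite (bigD1 b) //= mulrzA; apply/spanzZ; case: (hc b).
have [c [c0 hc]] := he.
have mon js : exists D : int, D != 0 /\ spanz e (monom g js *~ D).
  have [D [D0 hD]] := nakayama p_pr (fun b : {bseq (size js) of 'I_r} =>
    @monom_reduce p (size js) b p_pr pm (size_bseq b)).
  exists (D * c); split; first by rewrite mulf_neq0.
  rewrite mulrzA; have [w wE] := hD (Bseq (leqnn (size js))).
  rewrite /= in wE; rewrite wE mulrz_suml; apply: spanz_sum => b _.
  by rewrite -mulrzA mulrC mulrzA; apply/spanzZ/hc.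
have [k [s sE]] := g_gen x.
have [D [D0 hD]] : exists D : int, D != 0 /\ spanz e (x *+ m ^ k *~ D).
  rewrite sE; elim: (s) => [|a s' [D [D0 hD]]].
    by exists 1; split=> //; rewrite big_nil mul0rz; apply: spanz0.
  have [D' [D'0 hD']] := mon a.2.
  exists (D * D'); split; first by rewrite mulf_neq0.
  rewrite big_cons mulrzDl; apply: spanzD; last by rewrite mulrzA; apply: spanzZ.
  by rewrite -mulrzA mulrA [_ * D']mulrC mulrzA; apply: spanzZ.
exists ((m ^ k)%:Z * D); split; last by rewrite mulrzA -pmulrn.
by rewrite mulf_neq0 // eqz_nat -lt0n expn_gt0 m0.
Qed.

End Rank.

(** * A lattice and the vanishing of products of linear factors *)

Section Lattice.
Variables (B : comNzRingType) (m : nat).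
Hypothesis m0 : (0 < m)%N.
Hypothesis m_unit : exists u : B, m%:R * u = 1.
Hypothesis B_torsion_free : torsion_free B.
Variables (r : nat) (g : 'I_r -> B).
Hypothesis g_gen : loc_generates g m.
Hypothesis g_frob : frobenius_mod g m.

(** The scaled generators [g j *+ c] act on the span of [e] by integer matrices, and elements of [B]
    have denominators dividing powers of [m * c] relative to it. *)
Lemma lattice : exists n (e : 'I_n -> B) (c : nat), [/\ freez e, (0 < c)%N,
  spanz e (1 *+ c), (forall j i, spanz e (e i * (g j *+ c)))
  & forall y : B, exists k, spanz e (y *+ (m * c) ^ k)].
Proof.
have [n [e [fe he]]] := finite_rank m0 g_gen g_frob.
have [c [c0 hc]] : exists c : int, c != 0 /\ (spanz e (1 *~ c) /\
    forall u : 'I_r * 'I_n, spanz e (e u.2 * g u.1 *~ c)).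
  have [c1 [c10 h1]] := he 1.
  have /choice[c hc] : forall u : 'I_r * 'I_n, exists c : int, c != 0 /\ spanz e (e u.2 * g u.1 *~ c).
    by move=> u; apply: he.
  have C0 : \prod_u c u != 0 by apply/prodf_neq0 => u _; case: (hc u).
  exists (c1 * \prod_u c u); split; first by rewrite mulf_neq0.
  split; first by rewrite mulrzA; apply: spanzZ.
  move=> u; rewrite (bigD1 u) //= mulrCA mulrzA; apply: spanzZ.
  by case: (hc u).
have {}hc : (0 < `|c|)%N /\ spanz e (1 *+ `|c|%N) /\ forall j i, spanz e (e i * (g j *+ `|c|%N)).
  split; first by rewrite absz_gt0.
  by case: hc => h1 h2; split=> [|j i]; rewrite ?mulrnAr; apply: spanz_absz => //; apply: (h2 (j, i)).
move: (`|c|%N) hc => {c c0} c [c0 [h1 hg]]; exists n, e, c; split=> // y.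
have stable j x : spanz e x -> spanz e (x * (g j *+ c)).
  move=> [w ->]; rewrite mulr_suml; apply: spanz_sum => i _.
  by rewrite mulrzAl; apply: spanzZ.
have mon (js : seq 'I_r) d : (size js < d)%N -> spanz e (monom g js *+ c ^ d).
  move=> /subnK <-; rewrite expnD mulnC mulrnA; apply: spanzMn.
  elim: js => [|j js IH]; first by rewrite /monom big_nil expn1.
  rewrite /monom big_cons expnS mulnC mulrnA mulrC -mulrnAl -mulrnAr; exact: stable.
have [k [s sE]] := g_gen y.
pose d := (\max_(a <- s) (size a.2).+1)%N.
have hd : spanz e (y *+ m ^ k *+ c ^ d).
  rewrite sE -sumrMnl big_seq; apply: spanz_sum => a sa.
  rewrite pmulrn -mulrzA mulrC mulrzA -pmulrn; apply/spanzZ/mon.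
  by rewrite /d (big_rem a) //= leq_maxl.
exists (maxn k d); rewrite expnMn.
have -> : (m ^ maxn k d = m ^ k * m ^ (maxn k d - k))%N by rewrite -expnD subnKC // leq_maxl.
have -> : (c ^ maxn k d = c ^ d * c ^ (maxn k d - d))%N by rewrite -expnD subnKC // leq_maxr.
by rewrite mulnACA mulrnA; apply: spanzMn; rewrite mulrnA.
Qed.

(* The integer coordinates of [c * \prod_b (x *+ M + N - b)] grow too slowly compared with
   their divisors: binomial coefficients account for the primes not dividing [m * c], and
   the divisors common to [M] and [N - b] for the others. *)
Lemma linear_factors j : exists M N, (0 < M)%N /\
  \prod_(b <- iota 0 (2 * N)) (g j *+ M + N%:R - b%:R) = 0.
Proof.
have [n [e [c [fe c0 h1 hg hy]]]] := lattice.
(* Coordinates are out of control at the primes of [c] as well as those of [m]; the factor 2 makes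
   [m'] exceed 1. *)
pose m' := (2 * (m * c))%N.
have m'1 : (1 < m')%N by rewrite /m'; nia.
have /choice[X hX] : forall i, exists w : 'I_n -> int, e i * (g j *+ c) = \sum_l e l *~ w l by move=> i; apply: hg.
have [u0 hu0] := h1.
pose rho := (\sum_i \sum_l `|X i l|)%N.
pose C0 := (\sum_l `|u0 l|)%N.
have [M [N [M0 hMN]]] := window_vanishing rho C0 m'1.
pose z b : B := g j *+ (M * c) + N%:R - b%:R.
have rhoX i : (\sum_l `|X i l| <= rho)%N.
  by rewrite /rho [X in (_ <= X)%N](bigD1 i) //= leq_addr.
(* Multiplication by [z t] sends the coordinates [u] to [M * (u X) + (N - t) * u]. They gain the
   divisor [gcdn M] of [N - t], and the sum of their absolute values grows at most by the factor
   [M * rho] plus the distance from [t] to [N]. *)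
have coord t : exists u : 'I_n -> int, [/\ 1 *+ c * \prod_(b <- iota 0 t) z b = \sum_l e l *~ u l,
    forall l, (\prod_(0 <= b < t) gcdn M ((N - b) + (b - N)) %| `|u l|)%N
  & (\sum_l `|u l| <= C0 * \prod_(0 <= b < t) (M * rho + ((N - b) + (b - N))))%N].
  elim: t => [|t [u [uE ud ub]]].
    by exists u0; split=> [|l|]; rewrite ?big_nil ?mulr1 // ?big_geq ?muln1.
  pose a : int := N%:Z - t%:Z.
  have aE : `|a|%N = ((N - t) + (t - N))%N by rewrite /a; lia.
  pose u' l := (\sum_i u i * X i l) * M%:Z + u l * a.
  exists u'; split.
  - rewrite -[X in iota 0 X]addn1 iotaD big_cat big_seq1 /= add0n mulrA uE.
    rewrite /z -addrA mulrDr; under [in RHS]eq_bigr => l _ do rewrite /u' mulrzDr.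
    rewrite big_split /=; congr (_ + _).
      rewrite mulnC mulrnA mulrnAr mulr_suml.
      under [in LHS]eq_bigr => i _ do rewrite mulrzAl hX mulrz_suml.
      rewrite exchange_big /= -sumrMnl; apply: eq_bigr => l _.
      rewrite mulrzA -pmulrn mulrz_sumr; congr (_ *+ _); apply: eq_bigr => i _.
      by rewrite -mulrzA mulrC.
    rewrite mulr_suml; apply: eq_bigr => l _.
    by rewrite mulrzA -[RHS]mulrzr /a rmorphB.
  - move=> l; rewrite big_nat_recr //= -aE.
    have [q qE] : exists q : int, u' l = q * (\prod_(0 <= b < t) gcdn M (N - b + (b - N)) * gcdn M `|a|)%:Z.
      have /choice[v hv] : forall i, exists v : int, u i = v * (\prod_(0 <= b < t) gcdn M (N - b + (b - N)))%:Z.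
        by move=> i; apply/dvdzP; apply: ud.
      have [M' hM'] : exists M' : int, M%:Z = M' * (gcdn M `|a|)%:Z.
        by apply/dvdzP; apply: dvdn_gcdl.
      have [a' ha'] : exists a' : int, a = a' * (gcdn M `|a|)%:Z.
        by apply/dvdzP; apply: dvdn_gcdr.
      move: (\prod_(0 <= b < t) _)%N (gcdn M `|a|) hv hM' ha' => P G hv hM' ha'.
      exists ((\sum_i v i * X i l) * M' + v l * a').
      rewrite /u' PoszM hM' ha' hv.
      have -> : \sum_i u i * X i l = (\sum_i v i * X i l) * P%:Z.
        by rewrite mulr_suml; apply: eq_bigr => i _; rewrite hv -!mulrA [P%:Z * _]mulrC.
      by lia.
    by rewrite qE abszM dvdn_mull.
  - rewrite big_nat_recr //= mulnA -aE.
    apply: leq_trans (leq_mul ub (leqnn (M * rho + `|a|))).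
    apply: (@leq_trans (\sum_l (\sum_i `|u i| * `|X i l|) * M + \sum_l `|u l| * `|a|)%N).
      rewrite -big_split /=; apply: leq_sum => l _; rewrite /u'.
      apply: (@leq_trans (absz ((\sum_i u i * X i l)%R * M%:Z)%R + absz (u l * a)%R)%N); first by lia.
      rewrite !abszM absz_nat leq_add2r leq_mul2r; apply/orP; right.
      elim/big_ind2: _ => // [x1 y1 x2 y2 hx1 hx2|i _]; last by rewrite abszM.
      by apply: (@leq_trans (absz x1 + absz x2)%N); [lia | apply: leq_add].
    rewrite -!big_distrl /= mulnDr leq_add2r exchange_big /= [(M * rho)%N]mulnC mulnA.
    rewrite leq_mul2r; apply/orP; right; rewrite big_distrl /=; apply: leq_sum => i _.
    by rewrite -big_distrr leq_mul.
have [u [uE ud ub]] := coord (2 * N)%N.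
have fr p (x : B) : prime p -> ~~ (p %| m)%N -> divisible p (x ^+ p - x).
  exact: frobenius m_unit _ _ g_gen g_frob _ _.
have [y yE] := binomial_divisible m_unit fr (2 * N) (g j *+ (M * c) + N%:R).
have [k kE] := hy (1 *+ c * y).
have {kE}[w wE] : spanz e (1 *+ c * y *+ m' ^ k).
  by rewrite /m' expnMn mulnC mulrnA; apply: spanzMn.
(* [m' ^ k] brings the quotient [y] into the lattice, so freeness turns divisibility by [(2 * N)!]
   in [B] into a relation between coordinates. *)
have uw l : u l * (m' ^ k)%:Z = w l * (2 * N)`!%:Z.
  apply/eqP; rewrite -subr_eq0; apply/eqP.
  apply: (fe (fun l => u l * (m' ^ k)%:Z - w l * (2 * N)`!%:Z)).
  under eq_bigr => i _ do rewrite mulrzBr.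
  rewrite sumrB; apply/eqP; rewrite subr_eq0; apply/eqP.
  transitivity (1 *+ c * \prod_(b <- iota 0 (2 * N)) z b *+ (m' ^ k)).
    by rewrite uE -sumrMnl; apply: eq_bigr => i _; rewrite mulrzA -pmulrn.
  rewrite /z yE mulrnAr mulrnAC wE -sumrMnl; apply: eq_bigr => i _.
  by rewrite mulrzA -pmulrn.
have u0' l : u l = 0.
  apply/eqP; rewrite -absz_eq0; apply/eqP; apply: (hMN _ k `|w l|%N) => //.
    by have := congr1 absz (uw l); rewrite !abszM !absz_nat mulnC => ->; rewrite mulnC.
  by apply: leq_trans ub; rewrite (bigD1 l) //= leq_addr.
exists (M * c)%N, N; split; first by rewrite muln_gt0 M0.
apply: (B_torsion_free c0).
transitivity (1 *+ c * \prod_(b <- iota 0 (2 * N)) z b); first by rewrite mulr_natl.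
rewrite uE big1 // => l _.
by rewrite u0' mulr0z.
Qed.

End Lattice.

(** * Characters and splitting *)

Section BuildMorphism.
Variables (R S : pzRingType) (f : R -> S).
Hypotheses (fB : zmod_morphism f) (fM : monoid_morphism f).
HB.instance Definition _ := GRing.isZmodMorphism.Build R S f fB.
HB.instance Definition _ := GRing.isMonoidMorphism.Build R S f fM.
Lemma rmorphism_exists : exists h : {rmorphism R -> S}, h =1 f.
Proof. by exists f. Qed.
End BuildMorphism.

Lemma dvdn_exp_primes (d m : nat) : (0 < d)%N ->
  (forall p, prime p -> (p %| d)%N -> (p %| m)%N) -> exists k, (d %| m ^ k)%N.
Proof.
have [n] := ubnP d; elim: n d => // n IH d dn d0 hd.
have [d1|d1] := leqP d 1; first by exists 0%N; have -> : d = 1%N by lia.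
have p_pr := pdiv_prime d1; have /dvdnP[d' dE] := pdiv_dvd d.
have d'0 : (0 < d')%N by move: d0; rewrite dE muln_gt0 => /andP[].
have d'n : (d' < n)%N by have := prime_gt1 p_pr; move: dn; rewrite {1}dE; nia.
have [q q_pr qd|k hk] := IH d' d'n d'0.
  by apply: hd => //; rewrite dE dvdn_mulr.
exists k.+1; rewrite dE expnS mulnC dvdn_mul //.
by apply: hd => //; apply: pdiv_dvd.
Qed.

Section Characters.
Variables (B : comNzRingType) (m : nat).
Hypothesis m0 : (0 < m)%N.
Hypothesis B_torsion_free : torsion_free B.
Variables (r : nat) (g : 'I_r -> B).
Hypothesis g_gen : loc_generates g m.
Hypothesis g_frob : frobenius_mod g m.
Local Notation Zm := (loc (m%:R : int)).

Lemma intr_torsion_free (x : B) (c : int) : c != 0 -> c%:~R * x = 0 -> x = 0.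
Proof using B_torsion_free.
clear m0 => c0 xc; apply: (B_torsion_free (n := `|c|%N)); first by rewrite absz_gt0.
rewrite pmulrn; have -> : (`|c|%N : int) = c * sgz c by lia.
by rewrite mulrzA -[x *~ c]mulrzl xc mul0rz.
Qed.

Lemma natr_cancel n (x y : B) : (0 < n)%N -> n%:R * x = n%:R * y -> x = y.
Proof using B_torsion_free.
move=> n0 /eqP; rewrite -subr_eq0 -mulrBr => /eqP h; apply/eqP; rewrite -subr_eq0; apply/eqP.
by apply: (B_torsion_free n0); rewrite -mulr_natl.
Qed.

Section OneCharacter.
Variables (E : B) (E0 : E != 0).

Lemma intr_E_inj (a b : int) : a%:~R * E = b%:~R * E -> a = b.
Proof.
move=> /eqP; rewrite -subr_eq0 -mulrBl -rmorphB => /eqP h.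
apply/eqP; rewrite -subr_eq0; apply/negP => /negP ab.
by case/eqP: E0; apply: intr_torsion_free h.
Qed.

(* [y] acts on [E] as [a / m ^+ k]. *)
Definition has_value (y : B) (k : nat) (a : int) : Prop :=
  y * m%:R ^+ k * E = a%:~R * E.

Lemma monom_value (q : nat) (a : 'I_r -> int) :
  (forall j, g j * q%:R * E = (a j)%:~R * E) ->
  forall js, monom g js * q%:R ^+ size js * E = (\prod_(j <- js) a j)%:~R * E.
Proof.
move=> h; elim=> [|j js IH]; first by rewrite /monom !big_nil mul1r.
rewrite /monom !big_cons -/(monom g js) /= exprS intrM.
transitivity (g j * q%:R * (monom g js * q%:R ^+ size js * E)); first by cring B.
rewrite IH; set A := _%:~R; transitivity (A * (g j * q%:R * E)); first by cring B.
by rewrite h; cring B.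
Qed.

Lemma value_uniq y k a l b : has_value y k a -> has_value y l b ->
  lfrac (m%:R : int) a k = lfrac (m%:R : int) b l.
Proof.
move=> ya yb; apply/lfracP; exists 0%N; rewrite !add0n; apply: intr_E_inj.
rewrite !rmorphM !rmorphXn /= !rmorph_nat.
transitivity (m%:R ^+ l * (a%:~R * E)); first by cring B.
rewrite -ya; transitivity (m%:R ^+ k * (y * m%:R ^+ l * E)); first by cring B.
by rewrite yb; cring B.
Qed.

Lemma value_add y k a z l b : has_value y k a -> has_value z l b ->
  has_value (y + z) (k + l) ((m%:R : int) ^+ l * a + (m%:R : int) ^+ k * b).
Proof.
rewrite /has_value => ya zb; rewrite rmorphD !rmorphM !rmorphXn /= !rmorph_nat exprD.
transitivity (m%:R ^+ l * (y * m%:R ^+ k * E) + m%:R ^+ k * (z * m%:R ^+ l * E)); first by cring B.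
by rewrite ya zb; cring B.
Qed.

Lemma value_mul y k a z l b : has_value y k a -> has_value z l b ->
  has_value (y * z) (k + l) (a * b).
Proof.
rewrite /has_value => ya zb; rewrite intrM exprD.
transitivity (y * m%:R ^+ k * (z * m%:R ^+ l * E)); first by cring B.
rewrite zb; transitivity (b%:~R * (y * m%:R ^+ k * E)); first by cring B.
by rewrite ya; cring B.
Qed.

Lemma value_opp y k a : has_value y k a -> has_value (- y) k (- a).
Proof. by rewrite /has_value => ya; rewrite rmorphN !mulNr ya. Qed.

(* If [p] divides the common denominator [p * q] of the values [a j / (p * q)], then the
   relation [g j ^+ p = g j + p * (terms of degree at most p)] makes [p] divide every [a j]. *)
Lemma clear_prime p (q : nat) (a : 'I_r -> int) : prime p -> ~~ (p %| m)%N -> (0 < q)%N ->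
  (forall j, g j * (p * q)%:R * E = (a j)%:~R * E) ->
  forall j, exists b : int, g j * q%:R * E = b%:~R * E.
Proof.
move=> p_pr pm q0 h j; have [Q QE] : exists Q, Q = (p * q)%N by exists (p * q)%N.
rewrite -QE in h.
have [s [sp gE]] := g_frob p_pr pm j.
have [d dE] : exists d : int, (\sum_(t <- s) monom g t) * Q%:R ^+ p * E = d%:~R * E.
  rewrite -mulrA mulr_suml big_seq.
  elim/big_rec: _ => [|t x ts [d ->]]; first by exists 0; rewrite mul0r.
  exists ((Q%:Z) ^+ (p - size t) * (\prod_(i <- t) a i) + d).
  rewrite rmorphD mulrDl; congr (_ + _).
  have -> : Q%:R ^+ p = Q%:R ^+ (p - size t) * Q%:R ^+ size t :> B.
    by rewrite -exprD subnK // (allP sp).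
  rewrite rmorphM rmorphXn /=.
  transitivity (Q%:R ^+ (p - size t) * (monom g t * Q%:R ^+ size t * E)); first by cring B.
  by rewrite (monom_value h) pmulrn; cring B.
have pw n : g j ^+ n * Q%:R ^+ n * E = (a j ^+ n)%:~R * E.
  elim: n => [|n IH]; first by rewrite !expr0 mul1r.
  rewrite !exprS rmorphM /=.
  transitivity (g j * Q%:R * (g j ^+ n * Q%:R ^+ n * E)); first by cring B.
  rewrite IH; set A := (_ ^+ n)%:~R; transitivity (A * (g j * Q%:R * E)); first by cring B.
  by rewrite h; cring B.
have p1 : p = p.-1.+1 by rewrite prednK ?prime_gt0.
have eqa : a j ^+ p = a j * (Q%:Z) ^+ p.-1 + d * p%:Z.
  apply: intr_E_inj; rewrite -pw gE rmorphD !rmorphM rmorphXn /= -!pmulrn.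
  set D := \sum_(t <- s) _ in dE *.
  transitivity (g j * Q%:R * E * Q%:R ^+ p.-1 + p%:R * (D * Q%:R ^+ p * E)).
    have -> : Q%:R ^+ p = Q%:R * Q%:R ^+ p.-1 :> B by rewrite -exprS -p1.
    by cring B.
  by rewrite h dE; cring B.
have pa : (p%:Z %| a j)%Z.
  have : (p%:Z %| a j ^+ p)%Z.
    rewrite eqa rpredD // ?dvdz_mull // QE PoszM exprMn dvdz_mulr //.
    have : (0 < p.-1)%N by rewrite -ltnS -p1 prime_gt1.
    by case: (p.-1) => // k _; rewrite exprS dvdz_mulr.
  by rewrite !dvdzE abszX absz_nat Euclid_dvdX // => /andP[].
have /dvdzP[b bE] := pa; exists b.
apply: (natr_cancel (prime_gt0 p_pr)).
transitivity (g j * Q%:R * E); first by rewrite QE natrM; cring B.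
by rewrite h bE rmorphM /= -pmulrn; cring B.
Qed.

Hypothesis E_rational : exists q : nat, (0 < q)%N /\
  forall j, exists a : int, g j * q%:R * E = a%:~R * E.

(** The primes of the common denominator [q] are removed one at a time: a prime dividing [m] is
    moved into [m ^ k], any other is cancelled by [clear_prime]. *)
Lemma gen_values : exists k, forall j, exists a, has_value (g j) k a.
Proof.
suff h n q k : (q < n)%N -> (0 < q)%N ->
    (forall j, exists a : int, g j * (q * m ^ k)%:R * E = a%:~R * E) ->
    exists k, forall j, exists a, has_value (g j) k a.
  have [q [q0 hq]] := E_rational; apply: (h q.+1 q 0%N) => // j.
  by rewrite expn0 muln1.
elim: n q k => // n IH q k qn q0 hq.
have [q1|q1] := leqP q 1.
  exists k => j; have [a ha] := hq j; exists a.
  have q1' : q = 1%N by lia.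
  by rewrite /has_value -ha q1' mul1n natrX.
have p_pr := pdiv_prime q1; have /dvdnP[q' qE] := pdiv_dvd q.
set p := pdiv q in p_pr qE.
have q'0 : (0 < q')%N by move: q0; rewrite qE muln_gt0 => /andP[].
have q'n : (q' < n)%N by have := prime_gt1 p_pr; move: qn; rewrite {1}qE; nia.
have [/dvdnP[m1 mE]|pm] := boolP (p %| m)%N.
  apply: (IH q' k.+1) => // j; have [a ha] := hq j; exists (m1%:Z * a).
  transitivity (m1%:R * (a%:~R * E)); last by rewrite rmorphM /= -pmulrn; cring B.
  rewrite -ha expnS mE qE.
  have -> : (q' * (m1 * p * (m1 * p) ^ k) = m1 * (q' * p * (m1 * p) ^ k))%N by lia.
  by rewrite natrM; cring B.
have /choice[a ha] := hq.
apply: (IH q' k) => //; apply: (@clear_prime p (q' * m ^ k) a p_pr pm).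
  by rewrite muln_gt0 q'0 expn_gt0 m0.
by move=> j; rewrite -ha qE; congr (_ * _%:R * _); lia.
Qed.

Lemma value_exists y : exists k a, has_value y k a.
Proof.
have [K /choice[a ha]] := gen_values.
have mon js : exists k b, has_value (monom g js) k b.
  exists (K * size js)%N, (\prod_(j <- js) a j); rewrite /has_value exprM -natrX.
  by apply: monom_value => j; rewrite natrX; apply: ha.
have [k [s sE]] := g_gen y.
have [l [b hb]] : exists l b, has_value (y *+ m ^ k) l b.
  rewrite sE; elim: (s) => [|c s' [l [b IH]]].
    by exists 0%N, 0; rewrite /has_value big_nil !mul0r.
  have [l' [b' hb']] := mon c.2.
  have hc : has_value (monom g c.2 *~ c.1) l' (c.1 * b').
    rewrite /has_value intrM; transitivity (c.1%:~R * (b'%:~R * E)); last by cring B.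
    by rewrite -hb' -mulrzl; cring B.
  by rewrite big_cons; do 2 eexists; apply: value_add hc IH.
exists (k + l)%N, b; rewrite /has_value -hb exprD -[y *+ _]mulr_natr natrX.
by cring B.
Qed.

Definition char_value (y : B) : Zm :=
  lfrac _ (projT1 (cid (projT2 (cid (value_exists y))))) (projT1 (cid (value_exists y))).

Lemma char_valueP y : exists k a, has_value y k a /\ char_value y = lfrac _ a k.
Proof. by rewrite /char_value; case: (cid (value_exists y)) => k h /=; case: cid => a ha; exists k, a. Qed.

Lemma char_valueE y k a : has_value y k a -> char_value y = lfrac _ a k.
Proof. by have [l [b [hb ->]]] := char_valueP y; apply: value_uniq. Qed.

Lemma char_value_zmod : zmod_morphism char_value.
Proof.
move=> y z; have [k [a [ya ->]]] := char_valueP y; have [l [b [zb ->]]] := char_valueP z.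
rewrite (char_valueE (value_add ya (value_opp zb))).
rewrite -[- lfrac _ _ _]/(loc_opp _) loc_oppE -[RHS]/(loc_add _ _) loc_addE.
by [].
Qed.

Lemma char_value_monoid : monoid_morphism char_value.
Proof.
split; first by rewrite (@char_valueE _ 0%N 1) // /has_value !mulr1.
move=> y z; have [k [a [ya ->]]] := char_valueP y; have [l [b [zb ->]]] := char_valueP z.
by rewrite (char_valueE (value_mul ya zb)) -[RHS]/(loc_mul _ _) loc_mulE.
Qed.

Lemma char_value_eq0 y : char_value y = 0 -> y * E = 0.
Proof.
have [k [a [ya ->]]] := char_valueP y => /lfracP[t]; rewrite mulr0 addn0 => /eqP.
rewrite mulf_eq0 expf_eq0 natz eqz_nat gtn_eqF // andbF /= => /eqP a0.
rewrite /has_value a0 mul0r in ya.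
apply: (@natr_cancel (m ^ k)); first by rewrite expn_gt0 m0.
by rewrite mulr0 -ya natrX; cring B.
Qed.

End OneCharacter.
End Characters.

(** * Joint eigenspaces of the generators *)

Section Interpolation.
Variables (B : comNzRingType) (m : nat).
Hypothesis m0 : (0 < m)%N.
Hypothesis m_unit : exists u : B, m%:R * u = 1.
Hypothesis B_torsion_free : torsion_free B.
Variables (r : nat) (g : 'I_r -> B).
Hypothesis g_gen : loc_generates g m.
Hypothesis g_frob : frobenius_mod g m.
Local Notation Zm := (loc (m%:R : int)).

Variables (T : nat) (T0 : (0 < T)%N) (M N : 'I_r -> nat).
Hypothesis M0 : forall j, (0 < M j)%N.
Let z j : B := g j *+ M j + (N j)%:R.
Hypothesis z_root : forall j, \prod_(b <- iota 0 T) (z j - b%:R) = 0.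

Definition interp_factor (j : 'I_r) (c : nat) : B :=
  \prod_(b <- rem c (iota 0 T)) (z j - b%:R).

(* Up to an integer factor, the idempotent of the joint eigenspace on which each [z j] acts
   as [t j]. *)
Definition interpolator (t : {ffun 'I_r -> 'I_T}) : B := \prod_j interp_factor j (t j).

Lemma iota_ord (c : 'I_T) : (c : nat) \in iota 0 T.
Proof. by rewrite mem_iota /= add0n. Qed.

Lemma interpolator_root (t : {ffun 'I_r -> 'I_T}) j : (z j - (t j)%:R) * interpolator t = 0.
Proof.
rewrite /interpolator (bigD1 j) //= mulrA.
suff -> : (z j - (t j)%:R) * interp_factor j (t j) = 0 by rewrite mul0r.
rewrite -(z_root j) [RHS](perm_big _ (perm_to_rem (iota_ord (t j)))) /=.
by rewrite big_cons.
Qed.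

Lemma natr_sub_eq0 (a b : nat) (x : B) : a != b -> (a%:R - b%:R) * x = 0 -> x = 0.
Proof.
move=> ab; have -> : a%:R - b%:R = (a%:Z - b%:Z)%:~R :> B by rewrite rmorphB.
by move=> h; apply: (intr_torsion_free B_torsion_free _ h); rewrite subr_eq0 eqz_nat.
Qed.

(** Interpolation in one variable after another: two linear factors in the same [z j] differ by a
    nonzero integer, which can be cancelled because [B] is torsion-free. *)
Lemma interpolator_detect (x : B) : (forall t, x * interpolator t = 0) -> x = 0.
Proof.
suff h (s : seq 'I_r) : uniq s -> forall y, (forall t : {ffun 'I_r -> 'I_T},
    y * \prod_(j <- s) interp_factor j (t j) = 0) -> y = 0.
  by apply: h; exact: index_enum_uniq.
elim: s => [|j s IH] /= => [_ y hy|/andP[js us] y hy].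
  by have := hy [ffun=> Ordinal T0]; rewrite big_nil mulr1.
apply: (IH us) => t; set w := \prod_(j <- s) _.
apply: (@prod_pair_elim B _ (fun b : nat => z j - b%:R) (fun b => b = 0) (iota 0 T) (iota_uniq _ _)).
- by case: (T) T0.
- move=> a b x' _ _ ab ha hb; apply: (@natr_sub_eq0 b a); first by rewrite eq_sym.
  transitivity (x' * (z j - a%:R) - x' * (z j - b%:R)); first by cring B.
  by rewrite ha hb subrr.
- move=> c; rewrite mem_iota /= add0n => cT.
  pose t' : {ffun 'I_r -> 'I_T} := [ffun i => if i == j then Ordinal cT else t i].
  have := hy t'; rewrite big_cons ffunE eqxx /=.
  have -> : \prod_(i <- s) interp_factor i (t' i) = w.
    rewrite /w big_seq [RHS]big_seq; apply: eq_bigr => i si; rewrite ffunE.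
    by case: eqP => // ij; rewrite -ij si in js.
  by rewrite -[X in _ -> _ * X = _]/(interp_factor j c) => h; rewrite -[RHS]h; cring B.
Qed.

Lemma interpolator_rational (t : {ffun 'I_r -> 'I_T}) : exists q : nat, (0 < q)%N /\
  forall j, exists a : int, g j * q%:R * interpolator t = a%:~R * interpolator t.
Proof.
(* [g j] acts on [interpolator t] as [(t j - N j) / M j]; the product clears all these denominators
   at once. *)
exists (\prod_j M j)%N; split; first by rewrite prodn_gt0.
move=> j; rewrite (bigD1 j) //=; set q := (\prod_(i | _) _)%N.
exists (q%:Z * ((t j)%:Z - (N j)%:Z)).
rewrite natrM rmorphM rmorphB /= -!pmulrn; apply/eqP; rewrite -subr_eq0; apply/eqP.
transitivity (q%:R * ((z j - (t j)%:R) * interpolator t)); first by rewrite /z; cring B.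
by rewrite interpolator_root mulr0.
Qed.

Lemma interpolator_orth (t t' : {ffun 'I_r -> 'I_T}) : t != t' -> interpolator t * interpolator t' = 0.
Proof.
move=> tt'; have [j tj] : exists j, t j != t' j.
  apply: contrapT => nj; case/eqP: tt'; apply/ffunP => j; apply/eqP/negPn/negP => h.
  by apply: nj; exists j.
apply: (@natr_sub_eq0 (t j) (t' j)) => //.
transitivity (interpolator t * ((z j - (t' j)%:R) * interpolator t') -
  interpolator t' * ((z j - (t j)%:R) * interpolator t)); first by cring B.
by rewrite !interpolator_root !mulr0 subrr.
Qed.

(** Each factor of the interpolator acts on it as an integer, nonzero because the value [t j] has
    been removed from the list of roots. *)
Lemma interpolator_square (t : {ffun 'I_r -> 'I_T}) : exists d : int, d != 0 /\
  interpolator t * interpolator t = d%:~R * interpolator t.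
Proof.
set E := interpolator t.
have fac j b : (z j - b%:R) * E = ((t j)%:Z - b%:Z)%:~R * E.
  rewrite rmorphB /= -!pmulrn -[LHS]subr0 -(interpolator_root t j) -/E.
  by cring B.
have facs j (s : seq nat) :
    (\prod_(b <- s) (z j - b%:R)) * E = (\prod_(b <- s) ((t j)%:Z - b%:Z))%:~R * E.
  elim: s => [|b s IH]; first by rewrite !big_nil mul1r.
  rewrite !big_cons -mulrA IH intrM mulrCA fac; by cring B.
exists (\prod_j \prod_(b <- rem (t j : nat) (iota 0 T)) ((t j)%:Z - b%:Z)); split.
  apply/prodf_neq0 => j _; rewrite prodf_seq_neq0; apply/allP => b /=.
  by rewrite mem_rem_uniq ?iota_uniq // inE => /andP[bt _]; rewrite subr_eq0 eqz_nat eq_sym.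
rewrite {1}/E /interpolator; elim: (index_enum _) => [|j s IH].
  by rewrite !big_nil mul1r.
by rewrite !big_cons -mulrA IH intrM mulrCA facs; cring B.
Qed.

Definition support : {set {ffun 'I_r -> 'I_T}} := [set t | interpolator t != 0].

Lemma support_neq0 (i : 'I_#|support|) : interpolator (enum_val i) != 0.
Proof. by have := enum_valP i; rewrite inE. Qed.

Let E (i : 'I_#|support|) := interpolator (enum_val i).

Definition chr (i : 'I_#|support|) (y : B) : Zm :=
  char_value m0 B_torsion_free g_gen g_frob (support_neq0 i)
    (interpolator_rational (enum_val i)) y.

Definition characters (y : B) : {ffun 'I_#|support| -> Zm} := [ffun i => chr i y].

Lemma characters_zmod : zmod_morphism characters.
Proof. by move=> x y; apply/ffunP => i; rewrite !ffunE; apply: char_value_zmod. Qed.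

Lemma characters_monoid : monoid_morphism characters.
Proof.
have h i : monoid_morphism (chr i) by exact: char_value_monoid.
by split=> [|x y]; apply/ffunP => i; rewrite !ffunE; case: (h i).
Qed.

Lemma characters_inj : injective characters.
Proof.
move=> x y xy; apply/eqP; rewrite -subr_eq0; apply/eqP; apply: interpolator_detect => t.
have [->|t0] := eqVneq (interpolator t) 0; first by rewrite mulr0.
have tS : t \in support by rewrite inE.
rewrite -(enum_rankK_in tS tS) -/(E _).
have : chr (enum_rank_in tS t) (x - y) = 0.
  have := characters_zmod x y; rewrite xy subrr => /ffunP/(_ (enum_rank_in tS t)).
  by rewrite !ffunE.
exact: char_value_eq0.
Qed.

(** The characters send such a [y] to [d] times the [i]-th standard idempotent. *)
Definition isolates (i : 'I_#|support|) (d : nat) (y : B) : Prop :=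
  y * E i = d%:R * E i /\ forall i', i' != i -> y * E i' = 0.

Lemma isolates_exists i : exists d y, (0 < d)%N /\ isolates i d y.
Proof.
have [d [d0 dE]] := interpolator_square (enum_val i).
exists `|d|%N, (E i * (sgz d)%:~R); split; first by rewrite absz_gt0.
split=> [|i' ii'].
  rewrite pmulrn [X in X%:~R * _](_ : _ = sgz d * d); last by lia.
  by rewrite intrM -[RHS]mulrA -[in RHS]dE /E; cring B.
transitivity ((sgz d)%:~R * (E i * E i')); first by cring B.
by rewrite /E interpolator_orth ?mulr0 // (inj_eq enum_val_inj) eq_sym.
Qed.

(* Frobenius divides the isolated value by [p]: [y ^+ p - y] is divisible by [p]. *)
Lemma isolates_div i p d y : prime p -> ~~ (p %| m)%N ->
  isolates i (p * d) y -> exists y', isolates i d y'.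
Proof.
move=> p_pr pm [yi yo].
have [w wE] := frobenius m_unit g_gen g_frob y p_pr pm.
have [q pE] : exists q, p = q.+2 by case: (p) p_pr => [|[|q]] // _; exists q.
have [D DE] : exists D, D = (p * d)%N by exists (p * d)%N.
have powE n : y ^+ n * E i = D%:R ^+ n * E i.
  elim: n => [|n IH]; first by rewrite !expr0.
  rewrite !exprS -mulrA IH; transitivity (D%:R ^+ n * (y * E i)); first by cring B.
  by rewrite yi -DE; cring B.
have pwE x : p%:R * (w * x) = y ^+ p * x - y * x by rewrite -mulrBl wE -[w *+ p]mulr_natl; cring B.
(* On [E i], with [p = q + 2] and [D = p * d], the element [w] acts as
   [(D ^ p - D) / p = d * D ^ q.+1 - d] and [y] as [D], so the difference acts as [d]. *)
exists (y * (d * D ^ q)%:R - w); split=> [|i' ii'].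
  apply: (natr_cancel B_torsion_free (prime_gt0 p_pr)).
  transitivity (p%:R * (d * D ^ q)%:R * (y * E i) - p%:R * (w * E i)); first by cring B.
  rewrite pwE powE yi -DE mulrA -!natrM.
  have -> : (p * (d * D ^ q) = D * D ^ q)%N by rewrite DE mulnA.
  rewrite !natrM !natrX [in _ ^+ p]pE !exprS.
  by transitivity (D%:R * E i); [cring B | rewrite DE natrM mulrA].
have wi : w * E i' = 0.
  apply: (natr_cancel B_torsion_free (prime_gt0 p_pr)); rewrite pwE mulr0 pE exprS.
  transitivity (y ^+ q.+1 * (y * E i') - y * E i'); first by cring B.
  by rewrite yo // mulr0 subr0.
transitivity ((d * D ^ q)%:R * (y * E i') - w * E i'); first by cring B.
by rewrite wi yo // mulr0 subr0.
Qed.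

Lemma isolates_pow i : exists k y, isolates i (m ^ k) y.
Proof.
have [d [y [d0 dy]]] := isolates_exists i.
have [n] := ubnP d; elim: n d y d0 dy => // n IH d y d0 dy dn.
have [[p [p_pr pd pm]]|np] := pselect (exists p, [/\ prime p, (p %| d)%N & ~~ (p %| m)%N]).
  have /dvdnP[d' dE] := pd; rewrite dE mulnC in dy.
  have [y' y'E] := isolates_div p_pr pm dy.
  apply: IH y'E _; first by move: d0; rewrite dE muln_gt0 => /andP[].
  by have := prime_gt1 p_pr; move: dn d0; rewrite dE; nia.
have [k /dvdnP[c kE]] : exists k, (d %| m ^ k)%N.
  apply: dvdn_exp_primes => // p p_pr pd; apply/negPn/negP => pm.
  by apply: np; exists p.
exists k, (y * c%:R); case: dy => yi yo; split=> [|i' ii'].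
  by rewrite kE natrM -mulrA mulrCA yi; cring B.
by rewrite mulrAC yo // mul0r.
Qed.

Lemma characters_surj v : exists y, characters y = v.
Proof.
have isol i : exists y, y * E i = E i /\ forall i', i' != i -> y * E i' = 0.
  have [k [y [yi yo]]] := isolates_pow i; have [u mu] := m_unit.
  exists (y * u ^+ k); split=> [|i' ii']; last by rewrite mulrAC yo // mul0r.
  by rewrite mulrAC yi natrX mulrAC -exprMn mu expr1n mul1r.
have /choice[e eP] := isol; have [u mu] := m_unit.
have fr w : exists ak : int * nat, w = lfrac (m%:R : int) ak.1 ak.2.
  by elim/lfrac_ind: w => a k; exists (a, k).
have /choice[ak akE] : forall i, exists ak : int * nat, v i = lfrac (m%:R : int) ak.1 ak.2.
  by move=> i; apply: fr.
exists (\sum_i e i * (ak i).1%:~R * u ^+ (ak i).2); apply/ffunP => i; rewrite ffunE akE.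
apply: char_valueE; rewrite /has_value -/(E i) mulr_suml mulr_suml (bigD1 i) //=.
rewrite [X in _ + X]big1 ?addr0 => [|i' ii'].
  have [ei _] := eP i; rewrite -[in RHS]ei.
  transitivity ((m%:R * u) ^+ (ak i).2 * ((ak i).1%:~R * (e i * E i))); last by rewrite mu expr1n mul1r.
  by rewrite exprMn; cring B.
have [_ eo] := eP i'.
transitivity ((ak i').1%:~R * u ^+ (ak i').2 * m%:R ^+ (ak i).2 * (e i' * E i)); first by cring B.
by rewrite eo ?mulr0 // eq_sym.
Qed.

Lemma characters_iso : exists n (f : {rmorphism B -> {ffun 'I_n -> Zm}}), bijective f.
Proof.
have [f fE] := rmorphism_exists characters_zmod characters_monoid.
exists #|support|, f; have /choice[h hE] := characters_surj.
exists h => x; first by apply: characters_inj; rewrite hE fE.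
by rewrite fE hE.
Qed.
End Interpolation.

Section Splitting.
Variables (B : comNzRingType) (m : nat).
Hypothesis m0 : (0 < m)%N.
Hypothesis m_unit : exists u : B, m%:R * u = 1.
Hypothesis B_torsion_free : torsion_free B.
Variables (r : nat) (g : 'I_r -> B).
Hypothesis g_gen : loc_generates g m.
Hypothesis g_frob : frobenius_mod g m.
Local Notation Zm := (loc (m%:R : int)).

Theorem splitting : exists n (f : {rmorphism B -> {ffun 'I_n -> Zm}}), bijective f.
Proof.
have /choice[MN MNP] : forall j, exists MN : nat * nat, (0 < MN.1)%N /\
    \prod_(b <- iota 0 (2 * MN.2)) (g j *+ MN.1 + MN.2%:R - b%:R) = 0.
  move=> j; have [M [N MNP]] := linear_factors m0 m_unit B_torsion_free g_gen g_frob j.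
  by exists (M, N).
(* A common number of roots for all generators, since further factors keep the products zero; the
   successor makes [T] positive. *)
pose T := (\max_j (2 * (MN j).2)).+1%N.
apply: (@characters_iso B m m0 m_unit B_torsion_free r g g_gen g_frob T (ltn0Sn _)
  (fun j => (MN j).1) (fun j => (MN j).2)) => j.
  by case: (MNP j).
have le : (2 * (MN j).2 <= T)%N by apply: leqW; apply: (leq_bigmax j).
rewrite -(subnKC le) iotaD big_cat /=; case: (MNP j) => _ ->.
by rewrite mul0r.
Qed.

End Splitting.

(** * Reduction modulo a prime and the bound on the rank *)

Section Residue.
Variables (m p : nat).
Hypotheses (p_pr : prime p) (pm : ~~ (p %| m)%N).
Local Notation Zm := (loc (m%:R : int)).

Lemma natr_Fp_neq0 k : (m%:R : 'F_p) ^+ k != 0.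
Proof.
apply: expf_neq0; apply: contra pm => /eqP/(congr1 val).
by rewrite /= val_Fp_nat // => /eqP.
Qed.

Definition residue (w : Zm) : 'F_p := (repr w).1%:~R / m%:R ^+ (repr w).2.

Lemma residueE a k : residue (lfrac (m%:R : int) a k) = a%:~R / m%:R ^+ k.
Proof.
rewrite /residue; move: (lfrac_repr (lfrac (m%:R : int) a k)); case: (repr _) => b l /=.
move=> /lfracP[t /(congr1 (intr : int -> 'F_p))].
rewrite !rmorphM !rmorphXn /= !rmorph_nat !exprD -!mulrA => /(mulfI (natr_Fp_neq0 t)) e.
by apply/eqP; rewrite eqr_div ?natr_Fp_neq0 // mulrC e mulrC.
Qed.

Lemma residue_zmod : zmod_morphism residue.
Proof.
elim/lfrac_ind=> a k; elim/lfrac_ind=> b l.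
rewrite -[- lfrac _ _ _]/(loc_opp _) loc_oppE -[_ + _]/(loc_add _ _) loc_addE !residueE.
rewrite -mulNr addf_div ?natr_Fp_neq0 // rmorphD !rmorphM !rmorphXn /= !rmorph_nat rmorphN exprD.
by congr (_ / _); congr (_ + _); rewrite mulrC.
Qed.

Lemma residue_monoid : monoid_morphism residue.
Proof.
split; first by rewrite -[1]/(lfrac _ 1 0) residueE divr1.
elim/lfrac_ind=> a k; elim/lfrac_ind=> b l.
by rewrite -[_ * _]/(loc_mul _ _) loc_mulE !residueE mulf_div exprD rmorphM.
Qed.

(* The residues of the coordinates of [f] are [n] distinct ring morphisms to ['F_p], each
   determined by the images of the [r] generators. *)
Lemma rank_bound (B : comNzRingType) (r : nat) (g : 'I_r -> B) (n : nat)
    (f : {rmorphism B -> {ffun 'I_n -> Zm}}) :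
  loc_generates g m -> (forall v, exists y, f y = v) -> (n <= p ^ r)%N.
Proof.
move=> g_gen f_surj.
have /choice[h hE] : forall i, exists h : {rmorphism B -> 'F_p}, h =1 fun y => residue (f y i).
  move=> i; apply: rmorphism_exists => [x y|]; first by rewrite rmorphB !ffunE residue_zmod.
  split=> [|x y]; first by rewrite rmorph1 ffunE residue_monoid.1.
  by rewrite rmorphM ffunE residue_monoid.2.
pose c i : {ffun 'I_r -> 'F_p} := [ffun j => h i (g j)].
suff c_inj : injective c.
  by have := leq_card c c_inj; rewrite card_ffun !card_ord Fp_cast.
move=> i i' /ffunP cii'; apply/eqP/negPn/negP => ii'.
have hii' y : h i y = h i' y.
  have [k [s sE]] := g_gen y.
  have : h i (y *+ m ^ k) = h i' (y *+ m ^ k).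
    rewrite sE !rmorph_sum; apply: eq_bigr => t _; rewrite !rmorphMz /monom !rmorph_prod.
    by congr (_ *~ _); apply: eq_bigr => j _; have := cii' j; rewrite !ffunE.
  rewrite !rmorphMn /= -[LHS]mulr_natr -[RHS]mulr_natr natrX => e; exact: mulIf (natr_Fp_neq0 k) _ _ e.
have [y yE] := f_surj [ffun l => if l == i then 1 else 0].
have := hii' y; rewrite !hE yE !ffunE eqxx [i' == i]eq_sym (negPf ii') residue_monoid.1.
by rewrite -[X in residue X](subrr 1) residue_zmod subrr => /eqP; rewrite oner_eq0.
Qed.
End Residue.

(** * Transfer to the localization *)

Section LocalizedSplitting.
Variables (A : comPzRingType) (m : nat).
Hypothesis m0 : (0 < m)%N.
Hypothesis A_torsion_free :
  forall p (x : A), prime p -> ~~ (p %| m)%N -> x *+ p = 0 -> x = 0.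
Local Notation Am := (loc (m%:R : A)).
Local Notation Zm := (loc (m%:R : int)).

Lemma lfrac_zmod : zmod_morphism (fun x => lfrac (m%:R : A) x 0).
Proof.
move=> x y; rewrite -[- lfrac _ _ _]/(loc_opp _) loc_oppE -[RHS]/(loc_add _ _) loc_addE.
by rewrite !mul1r.
Qed.

Lemma lfrac_monoid : monoid_morphism (fun x => lfrac (m%:R : A) x 0).
Proof. by split=> // x y; rewrite -[RHS]/(loc_mul _ _) loc_mulE. Qed.

Lemma loc_unit : exists u : Am, m%:R * u = 1.
Proof.
have [h hE] := rmorphism_exists lfrac_zmod lfrac_monoid.
exists (lfrac _ 1 1); rewrite -(rmorph_nat h) hE -[_ * _]/(loc_mul _ _) loc_mulE mulr1.
by apply/lfracP; exists 0%N; rewrite mulr1 mul1r.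
Qed.

Lemma lfrac_mulm (x : A) k : lfrac (m%:R : A) x k *+ m ^ k = lfrac _ x 0.
Proof.
have [h hE] := rmorphism_exists lfrac_zmod lfrac_monoid.
rewrite -[LHS]mulr_natr -(rmorph_nat h) hE -[_ * _]/(loc_mul _ _) loc_mulE.
by apply/lfracP; exists 0%N; rewrite !add0n addn0 mul1r natrX mulrC.
Qed.

Lemma loc_torsion_free : torsion_free Am.
Proof.
move=> n y; have [k] := ubnP n; elim: k n y => // k IH n y nk n0 yn.
have [n1|n1] := leqP n 1.
  have n1' : n = 1%N by lia.
  by move: yn; rewrite n1' mulr1n.
have p_pr := pdiv_prime n1; have /dvdnP[n' nE] := pdiv_dvd n.
have n'0 : (0 < n')%N by move: n0; rewrite nE muln_gt0 => /andP[].
apply: (IH n') => //; first by have := prime_gt1 p_pr; move: nk; rewrite {1}nE; nia.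
move: p_pr nE; set p := pdiv n => p_pr nE; move: yn; rewrite nE mulrnA.
move: (y *+ n') => {}y yp.
have [/dvdnP[q mE]|pm] := boolP (p %| m)%N.
  have [u mu] := loc_unit; rewrite -[y]mulr1 -mu mulrA mulr_natr.
  have -> : y *+ m = 0 by rewrite [X in y *+ X]mE mulnC mulrnA yp mul0rn.
  by rewrite mul0r.
elim/lfrac_ind: y yp => x l.
have [h hE] := rmorphism_exists lfrac_zmod lfrac_monoid.
rewrite -[LHS]mulr_natr -(rmorph_nat h) hE -[_ * _]/(loc_mul _ _) loc_mulE => /lfracP[t].
rewrite mulr0 addn0 mulrA mulr_natr => /(A_torsion_free p_pr pm) e.
by apply/lfracP; exists t; rewrite mulr0 addn0.
Qed.

Variables (r : nat) (g : 'I_r -> A).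
Hypothesis g_gen : generates g.
Hypothesis g_frob : frobenius_mod g m.

(** [n] is fixed before the generators that enter the bound, because the theorem bounds a single [n]
    for every enumeration of the minimal marked structures. *)
Lemma loc_splitting : exists n : nat,
  (exists f : {rmorphism Am -> {ffun 'I_n -> Zm}}, bijective f) /\
  forall p r' (g' : 'I_r' -> A), prime p -> ~~ (p %| m)%N -> generates g' -> (n <= p ^ r')%N.
Proof.
(* The localization may be the zero ring, which is no [comNzRingType]; then [n = 0]. *)
have [e|nz] := eqVneq (1 : Am) 0.
  have all0 (y : Am) : y = 0 by rewrite -[y]mulr1 e mulr0.
  exists 0%N; split=> //.
  have f0 (u v : {ffun 'I_0 -> Zm}) : u = v by apply/ffunP => -[].
  have [||f _] := @rmorphism_exists Am {ffun 'I_0 -> Zm} (fun=> 0).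
  - by move=> x y; apply: f0.
  - by split=> [|x y]; apply: f0.
  by exists f, (fun=> 0) => x; [rewrite [x]all0 | apply: f0].
pose B : comNzRingType := HB.pack (GRing.ComPzRing.sort Am) (GRing.PzSemiRing_isNonZero.Build Am nz).
have [h hE] := @rmorphism_exists A B _ lfrac_zmod lfrac_monoid.
have gen r' (g' : 'I_r' -> A) : generates g' -> loc_generates (h \o g') m.
  move=> gg'; elim/lfrac_ind=> x k; have [s sE] := gg' x; exists k, s.
  transitivity (h x); first by rewrite hE; exact: lfrac_mulm.
  rewrite sE rmorph_sum; apply: eq_bigr => c _.
  by rewrite rmorphMz rmorph_prod.
have frob : frobenius_mod (h \o g) m.
  move=> p p_pr pm j; have [s [sp gE]] := g_frob p_pr pm j; exists s; split=> //.
  rewrite /= -rmorphXn gE rmorphD rmorphMn rmorph_sum; congr (_ + _ *+ _).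
  by apply: eq_bigr => t _; rewrite rmorph_prod.
have [n [f f_bij]] := @splitting B m m0 loc_unit loc_torsion_free r _ (gen _ _ g_gen) frob.
exists n; split; first by exists f.
move=> p r' g' p_pr pm gg'; apply: (rank_bound p_pr pm (f := f) (gen _ _ gg')) => v.
by have [f' _ f'K] := f_bij; exists (f' v).
Qed.

End LocalizedSplitting.

Theorem theorem1p1 (L : signature) (F : structure L -> Prop) (m : nat) :
  fraisse_class F ->
  (0 < m)%N ->
  (exists r : nat, num_classes (@minimal L F) (@marked_iso L F) r) ->
  (forall X : structure L, F X -> exists k : nat, (#|automorphisms X| %| m ^ k)%N) ->
  exists n : nat,
    (exists f : {rmorphism loc (m%:R : Theta F) -> {ffun 'I_n -> loc (m%:R : int)}},
       bijective f) /\
    (forall r p : nat,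
       num_classes (@minimal L F) (@marked_iso L F) r ->
       prime p -> ~~ (p %| m)%N ->
       (forall q : nat, prime q -> ~~ (q %| m)%N -> (p <= q)%N) ->
       (n <= p ^ r)%N).
Proof.
move=> HF m0 [r [a aP]] autF.
have aut p X : prime p -> ~~ (p %| m)%N -> F X -> ~~ (p %| #|automorphisms X|)%N.
  move=> p_pr pm /autF[k Xk]; apply: contra pm => pX.
  by have := dvdn_trans pX Xk; rewrite Euclid_dvdX // => /andP[].
have [|||n [f_iso bound]] := @loc_splitting (Theta F) m m0 _ r (min_gen HF a).
- by move=> p x p_pr pm; apply: theta_torsion_free => // X; apply: aut.
- exact: theta_generated.
- by move=> p p_pr pm j; apply: min_gen_frobenius => // X; apply: aut.
(* The bound is read off from the generators of the given enumeration [a'], which spares a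
   comparison of [r'] with [r]. *)
exists n; split=> // r' p [a' a'P] p_pr pm _.
apply: (bound p r' (min_gen HF a')) => //; exact: theta_generated.
Qed.
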